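(* In the setting of the context, let $p_{\mathrm{v}}:\mathcal D_{\mathscr F_{\mathrm v}}(M,L)\to\mathcal D_{\mathscr G_{\mathrm v}}(J^\circ,L)$ and $p_{\mathrm h}:\mathcal D_{\mathscr F_{\mathrm h}}(M,L)\to\mathcal D_{\mathscr G_{\mathrm h}}(J^\circ,L)$ be the pushforward maps, let $\mathcal F:\mathcal D_{\mathscr F_{\mathrm v}}(M,L)\to\mathcal D_{\mathscr F_{\mathrm h}}(M,L)$ be the integral along the leaves of $\mathscr F_{\mathrm h}$ (the Fourier transform), and let $\mathcal H_{\mathrm{Std}}:\mathcal D_{\mathscr G_{\mathrm v}}(J^\circ,L)\to\mathcal D_{\mathscr G_{\mathrm h}}(J^\circ,L)$ be the integral along the leaves of $\mathscr G_{\mathrm h}$. Then $\mathcal H_{\mathrm{Std}}\circ p_{\mathrm v}=p_{\mathrm h}\circ\mathcal F$.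
   Context: $F=\mathbb R$, $\psi(x)=e^{i\hbar x}$, $\hbar\neq0$; for a volume form $\Omega$, $|\Omega|$ is the associated measure using the $\psi$-self-dual measure on $F$. $V$ is $n$-dimensional, $M=\operatorname{End}(V)\oplus\operatorname{End}(V^* )$ (pairs $(A,B)$ of $n\times n$ matrices, $\langle A,B\rangle=\operatorname{tr}(AB)$), symplectic form $\omega_M=\sum_jdT_j\wedge dT_j^*$ for dual bases. $L$: sections are pairs $(\Phi,\Phi^* )$ of smooth functions on $M$ with $\Phi^*(A,B)=\psi(-\langle A,B\rangle)\Phi(A,B)$; connection $\nabla=(\nabla^0-i\hbar\sum_jT_j^*dT_j,\ \nabla^0+i\hbar\sum_jT_jdT_j^* )$, curvature $i\hbar\omega_M$. Foliations of $M$: $\mathscr F_{\mathrm v}:M\to\operatorname{End}(V)$ and $\mathscr F_{\mathrm h}:M\to\operatorname{End}(V^* )$. Definitions: a foliation is a smooth morphism $\mathscr F:X\to Y$ (leaves = fibers). Given $(L,\nabla)$ flat with trivial monodromy along leaves, $\mathcal D_{\mathscr F}(X,L)$ is the space of half-densities on $Y$ valued in the line bundle of sections of $L$ that are $\nabla$-flat along leaves. (So $\mathcal D_{\mathscr F_{\mathrm v}}(M,L)$ is identified with Schwartz half-densities on $\operatorname{End}(V)$, a function $h$ corresponding to $(\Phi,\Phi^* )=(h(A),h(A)\psi(-\langle A,B\rangle))$, and $\mathcal D_{\mathscr F_{\mathrm h}}(M,L)$ with Schwartz half-densities on $\operatorname{End}(V^* )$.) For two Lagrangian foliations $\mathscr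 F_1,\mathscr F_2$ of a symplectic $X$ with $(L,\nabla)$ of curvature $i\hbar\omega$, each restricting to a foliation on the leaves of the other, the integral of $\varphi\in\mathcal D_{\mathscr F_1}(X,L)$ along the leaves of $\mathscr F_2$ is the element of $\mathcal D_{\mathscr F_2}(X,L)$ with value at $x$ equal to $\int_{\mathscr F_{2,x}/\mathscr F_1}T_{x,z}\varphi(z)|\omega|^{\frac12\dim(\mathscr F_{2,x}/\mathscr F_1)}$, where $\mathscr F_{2,x}$ is the $\mathscr F_2$-leaf through $x$, $T_{x,z}$ is parallel transport, and the product of a transverse half-density for $\mathscr F_1$ with $|\omega\wedge\cdots\wedge\omega|^{1/2}$ is read as a measure on $\mathscr F_{2,x}/\mathscr F_1$ times a transverse half-density for $\mathscr F_2$ via the canonical isomorphism $\det(T/\ell_1)\otimes\det((\ell_1+\ell_2)/(\ell_1\cap\ell_2))=\det(T/\ell_2)\otimes\det(\ell_2/(\ell_1\cap\ell_2))^{\otimes2}$ of tangent data. Reduction: $N$ upper triangular unipotent, $f\in\mathfrak n^*$ the differential of $n\mapsto\sum_in_{i,i+1}$; $M_{-f,f}$ the preimage of $(-f,f)$ under the moment map for the right $N\times N$-action ($A\cdot(n_1,n_2)=n_1^{-1}An_2$, $B\cdot(n_1,n_2)=n_2^{-1}Bn_1$); $w$ the antidiagonal permutation matrix, $A$ diagonal torus, $M^\circ=NwAN\times NAwN$, $M^\circ_{-f,f}=M^\circ\cap M_{-f,f}$, $J^\circ=M^\circ_{-f,f}/(N\times N)\cong A_1\times A_2$ (with $A_1$,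 $A_2$ the images of $NwAN$, $NAwN$ in the double quotients of $\operatorname{End}(V)$, $\operatorname{End}(V^* )$), symplectic, with the descended $(L,\nabla)$ and the Lagrangian foliations $\mathscr G_{\mathrm v}:J^\circ\to A_1$, $\mathscr G_{\mathrm h}:J^\circ\to A_2$. Pushforward $p_{\mathrm v}$: fix a Haar measure $|d\underline n|$ on $N\times N$; for $\varphi\in\mathcal D_{\mathscr F_{\mathrm v}}(M,L)$, integrate $\varphi\cdot|d\underline n|^{1/2}$ over the quotients of the preimages in $M^\circ_{-f,f}$ of the leaves of $\mathscr G_{\mathrm v}$ by $\mathscr F_{\mathrm v}$ (on which $N\times N$-orbits give sections); in coordinates, for $\varphi=\Phi(dg)^{1/2}$ restricted to $\operatorname{GL}_n\subset\operatorname{End}(V)$ this gives $\delta^{1/2}(a)\,O_a(\Phi)\,(da)^{1/2}$ with $O_a(\Phi)=\int_{N\times N}\Phi(n_1wan_2)\psi^{-1}(n_1n_2)dn_1dn_2$, $\delta$ the modular character of the upper Borel; $p_{\mathrm h}$ is defined symmetrically using $\operatorname{GL}_n\subset\operatorname{End}(V^* )$ and $\mathscr G_{\mathrm h}$. All spaces are understood as the images of Schwartz half-densities under these (convergent) integral constructions.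
   Formalization: The form ω∧⋯∧ω is divided by d! (else the two sides differ by a constant for n≥2); transport between components of the disconnected leaves of J° goes through the connected leaves in M_{-f,f}; the integral H_Std over A_1 is iterated, a_n innermost. *)

(* Defs.v *)
From HB Require Import structures.
From mathcomp Require Import all_boot all_order all_algebra.
From mathcomp Require Import all_classical all_reals all_analysis.
From mathcomp Require Import complex.

Set Implicit Arguments.
Unset Strict Implicit.
Unset Printing Implicit Defensive.

Import Order.TTheory GRing.Theory Num.Theory.
Import numFieldNormedType.Exports.
Local Open Scope classical_set_scope.
Local Open Scope ring_scope.
Local Open Scope complex_scope.

Section Integration.
Variable R : realType.

(* The iterated Lebesgue integral
     \int dt_1 \int dt_2 ... \int dt_k F (x + t_1 v_1 + ... + t_k v_k)
   (v_k innermost).  For absolutely convergent integrals this is the integral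
   for the Lebesgue measure dt_1 ... dt_k, in any order of the v_i. *)
Fixpoint iter_int (V : lmodType R) (vs : seq V) (F : V -> R) (x : V) : R :=
  if vs is v :: vs' then
    \int[@lebesgue_measure R]_(t in setT) iter_int vs' F (x + t *: v)
  else F x.

Definition iter_intC (V : lmodType R) (vs : seq V) (F : V -> R[i]) (x : V) :
    R[i] :=
  iter_int vs (fun z => complex.Re (F z)) x
    +i* iter_int vs (fun z => complex.Im (F z)) x.

Definition rV_basis (d : nat) : seq 'rV[R]_d :=
  [seq delta_mx 0 i | i <- enum 'I_d].

(* \int_{Y} F(y) dy_1 ... dy_d for Y \subset R^d, as the iterated integral
   \int dy_1 (\int dy_2 ( ... \int dy_d)). *)
Definition coord_int (d : nat) (Y : set 'rV[R]_d) (F : 'rV[R]_d -> R[i]) :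
    R[i] :=
  iter_intC (rV_basis d) (fun y => if `[< Y y >] then F y else 0) 0.

End Integration.

Section Schwartz.
Variables (R : realType) (n : nat).

Definition iter_partial (s : seq ('I_n * 'I_n)) (f : 'M[R]_n -> R) :
    'M[R]_n -> R :=
  foldr (fun ij g => 'D_(delta_mx ij.1 ij.2) g) f s.

Definition schwartzR (f : 'M[R]_n -> R) : Prop :=
  forall s : seq ('I_n * 'I_n),
    (forall A i j, derivable (iter_partial s f) A (delta_mx i j)) /\
    (forall k : nat, exists K : R, forall A,
       (1 + `|A|) ^+ k * `|iter_partial s f A| <= K).

Definition schwartz (h : 'M[R]_n -> R[i]) : Prop :=
  schwartzR (fun A => complex.Re (h A)) /\
  schwartzR (fun A => complex.Im (h A)).

End Schwartz.

Section Bundle.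
Variables (R : realType) (n : nat) (hbar : R).

Definition phase_space : Type := ('M[R]_n * 'M[R]_n)%type.
Local Notation pt := phase_space.

(* With T_j = A_ij the dual coordinate is T_j^* = B_ji, since
   <A, B> = tr (A B); hence sum_j T_j^* dT_j = tr (B dA) and
   omega_M = sum_j dT_j /\ dT_j^* is the following form. *)
Definition omegaM (v v' : pt) : R :=
  \tr (v.1 *m v'.2) - \tr (v'.1 *m v.2).

(* Sections of L are represented by their component Phi in the first
   trivialization; the other one is Phi^* (A,B) = psi (- <A,B>) Phi (A,B).
   The two formulas for nabla correspond to each other under this change of
   trivialization, so that only nabla = nabla^0 - i hbar tr (B dA) is needed.
   [horizontal gamma u] says that the section u of L along the path gamma is
   nabla-flat, i.e. u' = i hbar tr (B A') u. *)
Definition horizontal (gamma : R -> pt) (u : R -> R[i]) : Prop :=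
  forall t : R,
    let du := (0 +i* (hbar * \tr ((gamma t).2 *m (derive1 gamma t).1))) * u t in
    is_derive t 1 (fun s => complex.Re (u s)) (complex.Re du) /\
    is_derive t 1 (fun s => complex.Im (u s)) (complex.Im du).

Definition C1_path (gamma : R -> pt) : Prop :=
  (forall t : R, derivable gamma t 1) /\
  continuous (derive1 gamma : R -> pt).

(* [is_transport S x z c]: parallel transport from z to x along some path
   contained in S is multiplication by c. *)
Definition is_transport (S : set pt) (x z : pt) (c : R[i]) : Prop :=
  exists gamma : R -> pt, exists u : R -> R[i],
    [/\ C1_path gamma, (forall t : R, 0 <= t <= 1 -> S (gamma t)),
        gamma 0 = z /\ gamma 1 = x, horizontal gamma u &
        u 0 = 1 /\ u 1 = c].

(* T_{x,z}.  It is independent of the path when L is flat with trivial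
   monodromy along S, which is the case for all the leaves below. *)
Definition transport (S : set pt) (x z : pt) : R[i] :=
  xget 0 [set c | is_transport S x z c].

(* [leaf x] is the leaf through x. *)
Definition flat_along (leaf : pt -> set pt) (phi : pt -> R[i]) : Prop :=
  forall x z c, is_transport (leaf x) x z c -> phi x = c * phi z.

End Bundle.

(* Half-densities on an open subset of R^d are written h |dy_1 ... dy_d|^{1/2},
   with |dy_1 ... dy_d| the Lebesgue measure, and represented by h.  Thus an
   element of D_F (X, L) is represented by a function phi : pt -> C, the
   coefficient of |dy|^{1/2}, which is a section of L flat along the leaves. *)

Section LeafIntegral.
Variables (R : realType) (n d : nat) (hbar : R).
Local Notation pt := (phase_space R n).

(* sigma realizes coordinates (y1, y2) on a 2d-dimensional symplectic
   (sub)quotient X of M, by lifting a point of X to M; its symplectic form is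
   sigma^* omega_M. *)
Variable sigma : 'rV[R]_d -> 'rV[R]_d -> pt.

Definition dsigma1 (y1 y2 : 'rV[R]_d) (i : 'I_d) : pt :=
  derive1 (fun t : R => sigma (y1 + t *: delta_mx 0 i) y2) 0.
Definition dsigma2 (y1 y2 : 'rV[R]_d) (i : 'I_d) : pt :=
  derive1 (fun t : R => sigma y1 (y2 + t *: delta_mx 0 i)) 0.

Definition omega_mx (y1 y2 : 'rV[R]_d) : 'M[R]_(d + d) :=
  let e1 := dsigma1 y1 y2 in let e2 := dsigma2 y1 y2 in
  block_mx (\matrix_(i, j) omegaM (e1 i) (e1 j))
           (\matrix_(i, j) omegaM (e1 i) (e2 j))
           (\matrix_(i, j) omegaM (e2 i) (e1 j))
           (\matrix_(i, j) omegaM (e2 i) (e2 j)).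

(* |omega^d / d!| = |Pf (omega_mx)| |dy1| |dy2|, and Pf^2 = det. *)
Definition liouville (y1 y2 : 'rV[R]_d) : R :=
  Num.sqrt `|\det (omega_mx y1 y2)|.

(* The self-dual measure on R for psi (x) = exp (i hbar x) is
   self_dual * (Lebesgue measure). *)
Definition self_dual : R := Num.sqrt (`|hbar| / (2 * pi)).

(* The foliations are F_1 = (y1 : X -> Y1) and F_2 = y2.  As F_1 and F_2 are
   transverse Lagrangian, F_{2,x} / F_1 is the leaf F_{2,x} itself, with
   coordinate y1, and for phi = h |dy1|^{1/2} one has
     phi * |omega|^{d/2}
       = h self_dual^d liouville^{1/2} |dy1|^{1/2} |dy1|^{1/2} |dy2|^{1/2}:
   a measure on the leaf times a transverse half-density for F_2.
   (|omega|^{d/2} is the square root of the measure on X attached to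
   omega^d / d!; that measure involves the self-dual measure 2d times.) *)
Definition leaf_integral (Y1 : set 'rV[R]_d) (leaf2 : pt -> set pt)
    (y2 : pt -> 'rV[R]_d) (phi : pt -> R[i]) (x : pt) :
    R[i] :=
  (self_dual ^+ d)%:C *
  coord_int Y1 (fun y1 =>
    let z := sigma y1 (y2 x) in
    transport hbar (leaf2 x) x z * phi z *
      (Num.sqrt (liouville y1 (y2 x)))%:C).

End LeafIntegral.

Section Setting.
Variables (R : realType) (n : nat) (hbar : R).
Local Notation pt := (phase_space R n).

Definition leaf_Fv (x : pt) : set pt := [set z | z.1 = x.1].
Definition leaf_Fh (x : pt) : set pt := [set z | z.2 = x.2].

Definition D_Fv (phi : pt -> R[i]) : Prop :=
  flat_along hbar leaf_Fv phi /\ schwartz (fun A => phi (A, 0)).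

Definition fourier : (pt -> R[i]) -> pt -> R[i] :=
  @leaf_integral R n (n * n) hbar
    (fun y1 y2 => (vec_mx y1, vec_mx y2)) setT leaf_Fh
    (fun x => mxvec x.2).

Definition strict_upper : set 'M[R]_n :=
  [set X | forall i j : 'I_n, (j <= i)%N -> X i j = 0].

Definition Ngroup : set 'M[R]_n := [set u | strict_upper (u - 1%:M)].

Definition fchar (X : 'M[R]_n) : R :=
  \sum_(i < n) \sum_(j < n | j == i.+1 :> nat) X i j.

Definition act (x : pt) (u : 'M[R]_n * 'M[R]_n) : pt :=
  (invmx u.1 *m x.1 *m u.2, invmx u.2 *m x.2 *m u.1).

(* Contraction of the primitive sum_j T_j^* dT_j = tr (B dA) of -omega_M with
   the vector field generated by (X1, X2), whose A-component is
   - X1 A + A X2. *)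
Definition moment (x : pt) (X1 X2 : 'M[R]_n) : R :=
  \tr (x.2 *m (x.1 *m X2 - X1 *m x.1)).

Definition M_ff : set pt :=
  [set x | forall X1 X2, strict_upper X1 -> strict_upper X2 ->
             moment x X1 X2 = - fchar X1 + fchar X2].

Definition wmx : 'M[R]_n := \matrix_(i, j) (j == rev_ord i)%:R.

Definition torus : set 'rV[R]_n := [set a | forall i, a 0 i != 0].

Definition same_orbit (A A' : 'M[R]_n) : Prop :=
  exists u1 u2, [/\ Ngroup u1, Ngroup u2 & A' = u1 *m A *m u2].

(* The elements w a of NwAN and b w of NAwN. *)
Definition slice_v (a : 'rV[R]_n) : 'M[R]_n := wmx *m diag_mx a.
Definition slice_h (b : 'rV[R]_n) : 'M[R]_n := diag_mx b *m wmx.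

Definition M_circ_ff : set pt :=
  [set x | [/\ M_ff x, (exists2 a, torus a & same_orbit (slice_v a) x.1) &
               (exists2 b, torus b & same_orbit (slice_h b) x.2)]].

(* The coordinates on A_1 and A_2 (unique by the Bruhat decomposition). *)
Definition coord_A1 (A : 'M[R]_n) : 'rV[R]_n :=
  xget 0 [set a | torus a /\ same_orbit (slice_v a) A].
Definition coord_A2 (B : 'M[R]_n) : 'rV[R]_n :=
  xget 0 [set b | torus b /\ same_orbit (slice_h b) B].

(* The lift of the point (a, b) of J^o = A_1 x A_2 to M^o_{-f,f} with first
   component w a; it is unique, as N x N acts simply transitively on
   N w a N. *)
Definition sigma_J (a b : 'rV[R]_n) : pt :=
  xget (0, 0) [set z | [/\ M_ff z, z.1 = slice_v a & same_orbit (slice_h b) z.2]].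

(* L on J^o is the quotient of L on M^o_{-f,f} by parallel transport along the
   N x N-orbits: its sections are the sections over M^o_{-f,f} flat along these
   orbits.  Hence L is treated upstairs, and the leaves of G_v and G_h are
   replaced by their inverse images.  These are taken in M_{-f,f} and not just
   in M^o_{-f,f}: the leaves of J^o have several connected components over the
   real numbers (they are isomorphic to (R^* )^n), but those of M_{-f,f}, of
   which they are dense open subsets, are connected, so that T_{x,z} is defined
   for all z. *)
Definition leaf_Gv (x : pt) : set pt :=
  [set z | M_ff z /\ same_orbit x.1 z.1].
Definition leaf_Gh (x : pt) : set pt :=
  [set z | M_ff z /\ same_orbit x.2 z.2].

Definition H_Std : (pt -> R[i]) -> pt -> R[i] :=
  @leaf_integral R n n hbar sigma_J torus leaf_Gh (fun x => coord_A2 x.2).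

(* At a point A of an orbit, the frame consisting of the vectors tangent to the
   orbit E_ij A and A E_ij (i < j), and of vectors v_i lifting the coordinate
   vectors of the orbit space. *)
Definition orbit_frame (A : 'M[R]_n) (v : 'I_n -> 'M[R]_n) (i j : 'I_n) :
    'M[R]_n :=
  if (i < j)%N then delta_mx i j *m A
  else if (j < i)%N then A *m delta_mx j i
  else v i.

(* The factor jac in |dA| = jac * |dn1 dn2| |da|, at A.  As N x N preserves
   |dA| and the Haar measures, it is enough to compute it at w a, resp. b w. *)
Definition orbit_jac (A : 'M[R]_n) (v : 'I_n -> 'M[R]_n) : R :=
  `|\det (lin_mx (fun X : 'M[R]_n =>
       \sum_(i < n) \sum_(j < n) X i j *: orbit_frame A v i j))|.

Definition jac_v (a : 'rV[R]_n) : R :=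
  orbit_jac (slice_v a) (fun i => slice_v (delta_mx 0 i)).
Definition jac_h (b : 'rV[R]_n) : R :=
  orbit_jac (slice_h b) (fun i => slice_h (delta_mx 0 i)).

(* \int_{N x N} F(n1, n2) for the Haar measure prod dn1_ij prod dn2_ij. *)
Definition upper_basis : seq 'M[R]_n :=
  [seq delta_mx ij.1 ij.2 |
     ij <- enum [pred ij : 'I_n * 'I_n | (ij.1 < ij.2)%N]].

Definition int_NN (F : 'M[R]_n * 'M[R]_n -> R[i]) : R[i] :=
  iter_intC ([seq (E, 0 : 'M[R]_n) | E <- upper_basis] ++
             [seq (0 : 'M[R]_n, E) | E <- upper_basis])
            F (1%:M, 1%:M).

(* The Haar measure on N x N is |dn| = c * prod dn1_ij prod dn2_ij; for
   phi = h |dA|^{1/2} one has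
     phi * |dn|^{1/2} = h (c * jac)^{1/2} (prod dn1_ij prod dn2_ij) |da|^{1/2}:
   a measure on the orbit of A times a half-density on A_1. *)
Variable c : R.

Definition p_v (phi : pt -> R[i]) (x : pt) : R[i] :=
  (Num.sqrt (c * jac_v (coord_A1 x.1)))%:C *
  int_NN (fun u => transport hbar (leaf_Gv x) x (act x u) * phi (act x u)).

Definition p_h (phi : pt -> R[i]) (x : pt) : R[i] :=
  (Num.sqrt (c * jac_h (coord_A2 x.2)))%:C *
  int_NN (fun u => transport hbar (leaf_Gh x) x (act x u) * phi (act x u)).

End Setting.

(* Main.v *)
(* All the parallel transports are explicit: [tr (B dA)] has the primitive [tr (B A)] on the leaves
   of F_h, [f U + f V] on the orbits [A = U w a V] and [tr (B A) - f U - f V] on the orbits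
   [B = U b w V] in M_{-f,f}, where [f] is the sum of the superdiagonal entries.  With these the
   theorem becomes an identity between two iterated integrals,
     int_a psi (- sum a_i b_i + sum 1 / (a_i b_(i+1))) prod |a_i|^(n-1-i)
       int_(U, V) psi (- f U - f V) h (V w a U)
     = sd^(n^2 - n) prod |b_i|^i int_(U, V) psi (f U + f V) hhat (U b w V),
   for the Fourier transform [hhat] of the Schwartz function [h] and the self-dual constant [sd].
   It is proved by induction on [n].  For a fixed first pivot [a], the integral over the first row
   and column defines a Schwartz function of the remaining minor, whose Fourier transform is
   computed with a linear substitution in the row variables and Fourier inversion in the column
   variables; the pivot is integrated last. *)

From HB Require Import structures.
From mathcomp Require Import all_boot all_order all_algebra.
From mathcomp Require Import all_classical all_reals all_analysis.
From mathcomp Require Import measurable_realfun complex ring lra zify.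
Require Import Defs.

Set Implicit Arguments.
Unset Strict Implicit.
Unset Printing Implicit Defensive.

Import Order.TTheory GRing.Theory Num.Theory.
Import numFieldNormedType.Exports.
Local Open Scope classical_set_scope.
Local Open Scope ring_scope.
Local Open Scope complex_scope.

(** * Integrals of continuous functions with quadratic decay *)

(** On the left, [psi (1 / (a b))] has no limit as the pivot [a] tends to [0], and the triangular
    factorization degenerates there, so no integral over a pivot is exchanged with another one on
    that side. On the right the pivot is the integration variable of the Fourier transform in the
    entry [(k, k)]; there the integrand decays rapidly in all variables and the pivot can be moved
    outermost. Hence the two sides are compared for each fixed [a <> 0]. All exchanges and
    substitutions take place in one class, [cr]: continuous functions of reals indexed by pairs,
    rapidly decreasing in a list of variables uniformly in the rest. It passes through partial
    integrals, partial Fourier transforms and substitutions with polynomially bounded inverse.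
    Schwartz functions enter only through [good]: all their partial Fourier transforms lie in the
    class. The step with [m] column variables to invert costs [m] factors [|hbar| / (2 pi) = sd^2].
    Over all steps this is [n (n - 1)] factors [sd], the difference between the [n^2] of the Fourier
    transform and the [n] of the reduced space. *)

Section TameIntegral.
Variable R : realType.
Local Notation mu := (@lebesgue_measure R).

(** The one decay condition in one variable: [1 / (1 + t^2)] is integrable with the explicit
    integral [pi], dominates limits, and survives affine substitutions up to the constant. *)
Definition tame (K : R) (f : R -> R) :=
  continuous f /\ forall t, `|f t| <= K * (oneDsqr t)^-1.

Lemma oneDsqr_gt0 (t : R) : 0 < oneDsqr t.
Proof. by apply: lt_le_trans (oneDsqr_ge1 t). Qed.

Lemma oneDsqrV_ge0 (t : R) : 0 <= (oneDsqr t)^-1.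
Proof. by rewrite invr_ge0 ltW// oneDsqr_gt0. Qed.

Lemma eintegral_oneDsqrV : (\int[mu]_t ((oneDsqr t)^-1)%:E = (pi : R)%:E)%E.
Proof.
rewrite ge0_symfun_integralT; last 3 first.
- by move=> t; exact: oneDsqrV_ge0.
- by move=> t; exact: continuous_oneDsqrV.
- by move=> t /=; rewrite /oneDsqr sqrrN.
rewrite -set_itvcy integral0y_oneDsqr -EFinM; congr EFin.
by rewrite mulrC divfK.
Qed.

Lemma measurable_oneDsqrV (K : R) :
  measurable_fun [set: R] (fun t => K * (oneDsqr t)^-1).
Proof.
apply: continuous_measurable_fun => t; apply: cvgM; first exact: cvg_cst.
exact: continuous_oneDsqrV.
Qed.

Lemma integrable_oneDsqrV (K : R) :
  mu.-integrable setT (EFin \o (fun t => K * (oneDsqr t)^-1)).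
Proof.
have -> : EFin \o (fun t : R => K * (oneDsqr t)^-1) =
    (fun t => K%:E * ((oneDsqr t)^-1)%:E)%E.
  by apply/funext => t; rewrite /= EFinM.
apply: integrableZl => //; apply/integrableP; split.
  apply/measurable_EFinP; apply: continuous_measurable_fun => t.
  exact: continuous_oneDsqrV.
rewrite [X in (X < _)%E](_ : _ = (\int[mu]_t ((oneDsqr t)^-1)%:E)%E).
  by rewrite eintegral_oneDsqrV ltry.
by apply: eq_integral => t _; rewrite /= ger0_norm ?oneDsqrV_ge0.
Qed.

Lemma Rintegral_oneDsqrV (K : R) :
  \int[mu]_t (K * (oneDsqr t)^-1) = K * pi.
Proof.
rewrite RintegralZl//.
  by rewrite /Rintegral eintegral_oneDsqrV.
have := integrable_oneDsqrV 1; apply: eq_integrable => // t _ /=.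
by rewrite mul1r.
Qed.

Lemma tame_measurable K f : tame K f -> measurable_fun setT f.
Proof. by case=> cf _; exact: continuous_measurable_fun. Qed.

Lemma dominated_integrable_oneDsqrV K (f : R -> R) : measurable_fun setT f ->
  (forall t, `|f t| <= K * (oneDsqr t)^-1) -> mu.-integrable setT (EFin \o f).
Proof.
move=> mf fK; apply: (le_integrable measurableT _ _ (integrable_oneDsqrV K)).
  exact/measurable_EFinP.
by move=> t _ /=; rewrite lee_fin (le_trans (fK t))// ler_norm.
Qed.

Lemma tame_integrable K f : tame K f -> mu.-integrable setT (EFin \o f).
Proof.
by move=> Kf; apply: dominated_integrable_oneDsqrV (tame_measurable Kf) Kf.2.
Qed.

Lemma tame_le_int K f : tame K f -> `|\int[mu]_t f t| <= K * pi.
Proof.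
move=> Kf; apply: le_trans (le_normr_Rintegral _ (tame_integrable Kf)) _ => //.
rewrite -Rintegral_oneDsqrV; apply: le_Rintegral => //.
- have := integrable_norm (tame_integrable Kf).
  by apply: eq_integrable.
- exact: integrable_oneDsqrV.
- by move=> t _; exact: Kf.2.
Qed.

Lemma dominated_cvg_int K (f_ : nat -> R -> R) f :
  (forall n, measurable_fun setT (f_ n)) ->
  (forall n t, `|f_ n t| <= K * (oneDsqr t)^-1) ->
  (forall t, f_ n t @[n --> \oo] --> f t) ->
  \int[mu]_t f_ n t @[n --> \oo] --> \int[mu]_t f t.
Proof.
move=> mf_ Kf_ f_f.
have mf : measurable_fun setT f.
  by apply: (measurable_fun_cvg mf_) => t _; exact: f_f.
have fK t : `|f t| <= K * (oneDsqr t)^-1.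
  have /(@cvg_lim _) <- // : `|f_ n t| @[n --> \oo] --> `|f t|.
    by apply: cvg_norm; exact: f_f.
  apply: limr_le; first by apply: is_cvg_norm; apply/cvg_ex; exists (f t); exact: f_f.
  by apply: nearW => n; exact: Kf_.
have fint := dominated_integrable_oneDsqrV mf fK.
have := @dominated_cvg _ _ R mu setT measurableT (fun n => EFin \o f_ n)
  (EFin \o f) (EFin \o (fun t => K * (oneDsqr t)^-1)).
move/(_ (fun n => (measurable_EFinP _ _).2 (mf_ n))).
have H1 : forall x, [set: R] x -> ((EFin \o f_ n) x @[n --> \oo] --> (EFin \o f) x)%E.
  by move=> t _; apply: cvg_EFin; [exact: nearW|exact: f_f].
move=> /(_ H1 (fun _ _ => isT) (integrable_oneDsqrV K)).
have H2 : forall n x, [set: R] x ->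
   (`|(EFin \o f_ n) x| <= (EFin \o (fun t => K * (oneDsqr t)^-1)%R) x)%E.
  by move=> n t _ /=; rewrite lee_fin; exact: Kf_.
move=> /(_ H2) H.
apply: fine_cvg; rewrite fineK; last exact: integrable_fin_num.
exact: H.
Qed.

Lemma tame_cvg_int K (f_ : nat -> R -> R) f :
  (forall n, tame K (f_ n)) -> (forall t, f_ n t @[n --> \oo] --> f t) ->
  \int[mu]_t f_ n t @[n --> \oo] --> \int[mu]_t f t.
Proof.
by move=> Kf; apply: dominated_cvg_int (fun n => tame_measurable (Kf n)) _ => n;
   exact: (Kf n).2.
Qed.

Lemma ge0_integral_affine (c d : R) (G : R -> R) : 0 < c -> continuous G ->
  (forall x, 0 <= G x) ->
  (\int[mu]_x (G x)%:E)%E = (\int[mu]_x (G (c * x + d)%R * c)%:E)%E.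
Proof.
move=> c0 cG G0; pose F := (fun x : R => c * x + d).
have dF (x : R) : is_derive x 1 F c.
  rewrite /F; apply: is_derive_eq => //.
  by rewrite /GRing.scale /=; ring.
have F'E : derive1 F = fun=> c.
  by apply/funext => x; rewrite derive1E; exact: derive_val.
rewrite (@increasing_ge0_integration_by_substitutionT R F G) //.
- by apply: eq_integral => x _; rewrite F'E.
- by move=> x y xy; rewrite /F ltrD2r ltr_pM2l.
- by rewrite F'E => x; exact: cvg_cst.
- by rewrite F'E; exact: is_cvg_cst.
- by rewrite F'E; exact: is_cvg_cst.
- apply/cvgrNyPle => A.
  apply: filterS (nbhs_ninfty_le (num_real ((A - d) / c))) => x.
  by rewrite ler_pdivlMr// lerBrDr mulrC.
- apply/cvgryPge => A.
  apply: filterS (nbhs_pinfty_ge (num_real ((A - d) / c))) => x.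
  by rewrite ler_pdivrMr// lerBlDr mulrC.
Qed.

Lemma ge0_integral_opp (G : R -> R) : continuous G -> (forall x, 0 <= G x) ->
  (\int[mu]_x (G x)%:E)%E = (\int[mu]_x (G (- x)%R)%:E)%E.
Proof.
suff split0 (H : R -> R) : continuous H -> (forall x, 0 <= H x) ->
    (\int[mu]_x (H x)%:E)%E = (\int[mu]_(x in `[0%R, +oo[) (H x)%:E +
       \int[mu]_(x in `[0%R, +oo[) (H (- x)%R)%:E)%E.
  move=> cG G0; rewrite split0// [RHS]split0//; last first.
    by move=> x; apply: continuous_comp; [exact: opp_continuous|exact: cG].
  by rewrite addeC; congr (_ + _)%E; apply: eq_integral => x _; rewrite opprK.
move=> cH H0; have mH : measurable_fun [set: R] H by exact: continuous_measurable_fun.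
have mposnums : measurable [set x : R | 0 <= x]%R by rewrite -set_itvcy.
rewrite -(setUv [set x : R | 0 <= x]%R) ge0_integral_setU//= ; last 4 first.
  exact: measurableC.
  by apply/measurable_EFinP; rewrite setUv.
  by move=> x _; rewrite lee_fin.
  exact/disj_setPCl.
rewrite -set_itvcy// setCitvr; congr (_ + _)%E.
rewrite integral_itv_bndo_bndc; last exact/measurable_EFinP/measurable_funTS.
rewrite -{1}oppr0 ge0_integration_by_substitutionNy//.
exact: continuous_subspaceT.
Qed.

Lemma tame_maxr0 K f : tame K f -> tame K (fun x => Num.max (f x) 0).
Proof.
move=> [cf fK]; split.
  move=> x; apply: (@continuous_max _ _ f (fun=> 0)); first exact: cf.
  exact: cst_continuous.
move=> t; apply: le_trans (fK t).
by rewrite ger0_norm ?le_max ?lexx ?orbT// ge_max ler_norm normr_ge0.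
Qed.

Lemma tame_opp K f : tame K f -> tame K (fun x => - f x).
Proof.
by move=> [cf fK]; split=> [x|t]; [apply: cvgN; exact: cf|rewrite normrN].
Qed.

(** Carries reflection and affine substitution from nonnegative functions, where they hold as
    identities of extended reals, to signed ones. *)
Lemma tame_posneg_int (K : R) (f : R -> R) : tame K f ->
  \int[mu]_t f t = \int[mu]_t Num.max (f t) 0 - \int[mu]_t Num.max (- f t) 0.
Proof.
move=> Kf; rewrite -RintegralB//; first last.
- exact: tame_integrable (tame_maxr0 (tame_opp Kf)).
- exact: tame_integrable (tame_maxr0 Kf).
apply: eq_Rintegral => t _; rewrite /= /Num.max oppr_lt0.
have [ft|ft|->] := ltrgtP (f t) 0; last by rewrite oppr0 subr0.
  by rewrite sub0r opprK.
by rewrite subr0.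
Qed.

Lemma tame_integral_opp K f : tame K f ->
  \int[mu]_t f (- t) = \int[mu]_t f t.
Proof.
move=> Kf.
have Kf' : tame K (fun t => f (- t)).
  split; first by move=> x; apply: continuous_comp; [exact: opp_continuous|exact: Kf.1].
  by move=> t; have := Kf.2 (- t); rewrite /oneDsqr sqrrN.
rewrite (tame_posneg_int Kf) (tame_posneg_int Kf') /Rintegral.
congr (fine _ - fine _).
  by rewrite [RHS]ge0_integral_opp//; [exact: (tame_maxr0 Kf).1|
     move=> x; rewrite le_max lexx orbT].
by rewrite [RHS]ge0_integral_opp//; [exact: (tame_maxr0 (tame_opp Kf)).1|
     move=> x; rewrite le_max lexx orbT].
Qed.

Lemma tame_affine K f (c d : R) : c != 0 -> tame K f ->
  exists L, tame L (fun t => f (c * t + d)).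
Proof.
move=> c0 [cf fK].
(* Chosen so that [1 + t^2 <= C (1 + (c t + d)^2)], using [(c t)^2 <= 2 (c t + d)^2 + 2 d^2]. *)
pose C := 2 * (1 + d ^+ 2 + c ^+ 2) / c ^+ 2.
have c2 : 0 < c ^+ 2 by rewrite lt_neqAle eq_sym expf_neq0//= sqr_ge0.
have C0 : 0 < C.
  rewrite /C !mulr_gt0 ?invr_gt0// -addrA ltr_pwDl// addr_ge0 ?sqr_ge0//.
exists (K * C); split.
  move=> x; apply: continuous_comp; last exact: cf.
  by apply: cvgD; [apply: cvgM; [exact: cvg_cst|exact: cvg_id]|exact: cvg_cst].
move=> t; apply: le_trans (fK _) _.
have K0 : 0 <= K.
  by have := le_trans (normr_ge0 _) (fK 0); rewrite /oneDsqr expr0n/= addr0 invr1 mulr1.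
rewrite -mulrA ler_wpM2l//.
rewrite ler_pdivlMr ?oneDsqr_gt0// mulrC ler_pdivrMr ?oneDsqr_gt0//.
rewrite /C /oneDsqr mulrAC ler_pdivlMr//.
have h1 : (c * t) ^+ 2 <= 2 * (c * t + d) ^+ 2 + 2 * d ^+ 2.
  have := sqr_ge0 (c * t + d + d); have := sqr_ge0 (c * t + d - (-d)); nra.
rewrite -subr_ge0.
have -> : 2 * (1 + d ^+ 2 + c ^+ 2) * (1 + (c * t + d) ^+ 2) - (1 + t ^+ 2) * c ^+ 2
  = (2 * (c * t + d) ^+ 2 + 2 * d ^+ 2 - (c * t) ^+ 2) + 2 + c ^+ 2 +
    2 * (d * (c * t + d)) ^+ 2 + 2 * (c * (c * t + d)) ^+ 2 by ring.
have := sqr_ge0 (d * (c * t + d)); have := sqr_ge0 (c * (c * t + d)).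
by have := ltW c2; move: h1; nra.
Qed.

Lemma tame_integral_affine K f (c d : R) : c != 0 -> tame K f ->
  `|c| * \int[mu]_t f (c * t + d) = \int[mu]_t f t.
Proof.
suff pos c' d' f' K' : 0 < c' -> tame K' f' ->
    c' * \int[mu]_t f' (c' * t + d') = \int[mu]_t f' t.
  rewrite neq_lt => /orP[c0|c0] Kf; last by rewrite gtr0_norm// (pos _ _ _ _ c0 Kf).
  rewrite ltr0_norm//; have [L Lf] := tame_affine d (ltr0_neq0 c0) Kf.
  rewrite -(tame_integral_opp Lf).
  under eq_Rintegral do rewrite mulrN -mulNr.
  by apply: (pos (- c) d f K) => //; rewrite oppr_gt0.
move=> c0 Kf; have cn0 : c' != 0 by rewrite gt_eqF.
have [L Lf] := tame_affine d' cn0 Kf.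
rewrite (tame_posneg_int Kf) (tame_posneg_int Lf) mulrBr.
have main g M : tame M g -> (forall x, 0 <= g x) ->
    c' * \int[mu]_t g (c' * t + d') = \int[mu]_t g t.
  move=> Mg g0; have [N Ng] := tame_affine d' cn0 Mg.
  rewrite mulrC -RintegralZr//; last exact: tame_integrable Ng.
  by rewrite /Rintegral (@ge0_integral_affine c' d' g) //; exact: Mg.1.
congr (_ - _).
  by apply: (main _ _ (tame_maxr0 Kf)) => x; rewrite le_max lexx orbT.
by apply: (main _ _ (tame_maxr0 (tame_opp Kf))) => x; rewrite le_max lexx orbT.
Qed.

(** Rounding the first variable down to multiples of [1 / (m + 1)] gives functions that are
    measurable on countably many strips, and they converge pointwise by continuity in that variable.
    [tame_Fubini] assumes separate continuity only and gets joint measurability from here. *)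
Lemma measurable_caratheodory (f : R -> R -> R) :
  (forall y, continuous (f ^~ y)) -> (forall x, measurable_fun setT (f x)) ->
  measurable_fun setT (fun p : R * R => f p.1 p.2).
Proof.
move=> cf mf.
pose h (m : nat) (x : R) : R := (Num.floor (x * m.+1%:R))%:~R / m.+1%:R.
have hx x : h m x @[m --> \oo] --> x.
  apply/cvgrPdist_le => e e0; near=> m.
  have m0 : 0 < m.+1%:R :> R by [].
  have : `|x - h m x| <= m.+1%:R^-1.
    rewrite -(ler_pM2r m0) mulVf ?gt_eqF// -[X in _ * X](gtr0_norm m0) -normrM.
    rewrite /h mulrBl divfK ?gt_eqF//.
    have := floor_itv (x * m.+1%:R); rewrite intrD => /andP[h1 h2].
    by rewrite ger0_norm ?subr_ge0// lerBlDl ltW.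
  move/le_trans; apply; near: m.
  exists (Num.truncn e^-1) => //= m /= em.
  rewrite -[leRHS]invrK lef_pV2 ?posrE ?invr_gt0//.
  apply/ltW/(lt_le_trans (truncnS_gt _)).
  by rewrite ler_nat ltnS.
apply: (@measurable_fun_cvg _ _ _ _ (fun m p => f (h m p.1) p.2)); last first.
  move=> [x y] _ /=; apply: (@continuous_cvg _ _ _ _ _ _ (f ^~ y)); first exact: cf.
  exact: hx.
move=> m _ Y mY; rewrite setTI.
have -> : (fun p : R * R => f (h m p.1) p.2) @^-1` Y =
    \bigcup_(k : int) (((fun x : R => Num.floor (x * m.+1%:R)) @^-1` [set k]) `*`
        (f (k%:~R / m.+1%:R) @^-1` Y)).
  apply/seteqP; split=> [[x y] /= fY|[x y] [k _ /= [<- //]]].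
  by exists (Num.floor (x * m.+1%:R)).
apply: countable_bigcupT_measurable => // k; apply: measurableX.
  have -> : (fun x : R => Num.floor (x * m.+1%:R)) @^-1` [set k] =
      `[k%:~R / m.+1%:R, (k + 1)%:~R / m.+1%:R[%classic.
    apply/seteqP; split=> x /=; rewrite in_itv /= ler_pdivrMr// ltr_pdivlMr//.
      by move=> <-; exact: floor_itv.
    by move=> xk; exact: floor_def.
  exact: measurable_itv.
by rewrite -[_ @^-1` _]setTI; exact: mf.
Unshelve. all: by end_near. Qed.

Lemma tame_Fubini (f : R -> R -> R) (K : R) :
  (forall y, continuous (f ^~ y)) -> (forall x, continuous (f x)) ->
  (forall x y, `|f x y| <= K * (oneDsqr x)^-1 * (oneDsqr y)^-1) ->
  \int[mu]_x (\int[mu]_y f x y) = \int[mu]_y (\int[mu]_x f x y).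
Proof.
move=> cx cy fK.
have mf : measurable_fun setT (fun p : R * R => f p.1 p.2).
  by apply: measurable_caratheodory => // x; apply: continuous_measurable_fun.
have t1 x : tame (K * (oneDsqr x)^-1) (f x) by split.
have t2 y : tame (K * (oneDsqr y)^-1) (f ^~ y).
  by split=> // x; rewrite mulrAC.
have E1 x : ((\int[mu]_y f x y)%:E = \int[mu]_y (f x y)%:E)%E.
  by rewrite /Rintegral fineK//; apply: integrable_fin_num => //; exact: tame_integrable (t1 x).
have E2 y : ((\int[mu]_x f x y)%:E = \int[mu]_x (f x y)%:E)%E.
  by rewrite /Rintegral fineK//; apply: integrable_fin_num => //; exact: tame_integrable (t2 y).
rewrite [LHS]/Rintegral [RHS]/Rintegral; congr fine.
transitivity (\int[mu]_x (\int[mu]_y (f x y)%:E))%E.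
  by apply: eq_integral => x _; exact: E1.
transitivity (\int[mu]_y (\int[mu]_x (f x y)%:E))%E; last first.
  by apply: eq_integral => x _; rewrite E2.
apply: (@Fubini _ _ _ _ R mu mu (EFin \o (fun p : R * R => f p.1 p.2))).
apply/integrable12ltyP; first exact/measurable_EFinP.
apply: (@le_lt_trans _ _ (\int[mu]_x (K * pi * (oneDsqr x)^-1)%:E)%E); last first.
  have := integrable_oneDsqrV (K * pi) => /integrable_lty; apply => //.
apply: ge0_le_integral => //.
- by move=> x _; apply: integral_ge0.
- apply: (@measurable_fun_fubini_tonelli_F _ _ _ _ R mu
     (fun p : R * R => (`|f p.1 p.2|)%:E)) => //.
  by apply/measurable_EFinP; apply: measurableT_comp.
- by apply/measurable_EFinP; exact: measurable_oneDsqrV.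
- move=> x _ /=.
  have ta : tame (K * (oneDsqr x)^-1) (fun y => `|f x y|).
    split; last by move=> t; rewrite normr_id.
    by move=> y; apply: cvg_norm; exact: cy.
  have := tame_le_int ta; rewrite ger0_norm ?Rintegral_ge0// => h.
  rewrite [X in (X <= _)%E](_ : _ = (\int[mu]_y `|f x y|)%:E).
    by rewrite lee_fin (le_trans h)// mulrAC.
  rewrite /Rintegral fineK//; apply: integrable_fin_num => //.
  exact: tame_integrable ta.
Qed.

Lemma FTC2_is_derive (f F : R -> R) (a b : R) : a < b -> continuous f ->
  (forall t : R, is_derive t 1 F (f t)) ->
  \int[mu]_(t in `[a, b]) f t = F b - F a.
Proof.
move=> ab cf dF.
have cF : continuous F.
  by move=> x; apply/differentiable_continuous/derivable1_diffP; case: (dF x).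
rewrite /Rintegral (@continuous_FTC2 _ f F)//.
- exact: continuous_subspaceT.
- split; first by move=> x _; case: (dF x).
  + by apply: cvg_at_right_filter; exact: cF.
  + by apply: cvg_at_left_filter; exact: cF.
- by move=> x _; rewrite derive1E; exact: derive_val.
Qed.

(** The half-lines have separate antiderivatives because the Abel factor [exp (- e |z|)] has a
    corner at [0]. The integral is the limit of the integrals over the intervals
    [[-(m + 1), m + 1]]. *)
Lemma FTC_tame_split K (f f1 f2 F1 F2 : R -> R) (l1 l2 : R) : tame K f ->
  continuous f1 -> continuous f2 ->
  (forall t : R, is_derive t 1 F1 (f1 t)) -> (forall t : R, is_derive t 1 F2 (f2 t)) ->
  (forall t, 0 <= t -> f t = f1 t) -> (forall t, t <= 0 -> f t = f2 t) ->
  F1 t @[t --> +oo] --> l1 -> F2 t @[t --> -oo] --> l2 ->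
  \int[mu]_t f t = (l1 - F1 0) + (F2 0 - l2).
Proof.
move=> Kf cf1 cf2 dF1 dF2 ff1 ff2 Fl1 Fl2.
pose f_ (m : nat) := f \_ `[- m.+1%:R, m.+1%:R].
have f_f : \int[mu]_t f_ m t @[m --> \oo] --> \int[mu]_t f t.
  apply: (@dominated_cvg_int K).
  - move=> m; apply/(measurable_restrict _ _ _).1 => //.
    exact: measurable_funTS (tame_measurable Kf).
  - move=> m t; rewrite /f_ patchE; case: ifPn => _; first exact: Kf.2.
    by rewrite normr0 (le_trans (normr_ge0 _) (Kf.2 t)).
  - move=> t; apply: cvg_near_cst.
    exists (Num.truncn `|t|) => //= m /= mt; rewrite /f_ patchE ifT//.
    rewrite inE/= in_itv/= -ler_norml; apply/ltW/(lt_le_trans (truncnS_gt _)).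
    by rewrite ler_nat ltnS.
have E m : \int[mu]_t f_ m t = (F1 m.+1%:R - F1 0) + (F2 0 - F2 (- m.+1%:R)).
  have m0 : 0 < m.+1%:R :> R by [].
  rewrite /f_ -Rintegral_mkcond.
  have /= := @Rintegral_itvB R f (BLeft (- m.+1%:R)) (BRight m.+1%:R) 0.
  have ifm : mu.-integrable `[- m.+1%:R, m.+1%:R]%classic (EFin \o f).
    exact: integrableS (tame_integrable Kf).
  rewrite !bnd_simp oppr_le0 => /(_ ifm (ltW m0) (ltW m0)).
  rewrite Rintegral_itv_obnd_cbnd; last first.
    exact: integrableS (tame_integrable Kf).
  move=> /(canRL (subrK _)) ->; congr (_ + _).
    rewrite -(FTC2_is_derive m0 cf1 dF1); apply: eq_Rintegral => t.
    by rewrite inE/= in_itv/= => /andP[t0 _]; exact: ff1.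
  have m0' : - m.+1%:R < 0 :> R by rewrite oppr_lt0.
  rewrite -(FTC2_is_derive m0' cf2 dF2); apply: eq_Rintegral => t.
  by rewrite inE/= in_itv/= => /andP[_ t0]; exact: ff2.
apply: (cvg_unique _ f_f) => /=; first exact: norm_hausdorff.
rewrite (eq_cvg _ _ E).
have S1 : m.+1%:R @[m --> \oo] --> (+oo : set_system R).
  apply/cvgryPge => A; exists (Num.truncn `|A|) => //= m /= mA.
  apply: le_trans (ler_norm _) _; apply/ltW/(lt_le_trans (truncnS_gt _)).
  by rewrite ler_nat ltnS.
apply: cvgD; apply: cvgB; try exact: cvg_cst.
  exact: cvg_comp S1 Fl1.
apply: cvg_comp Fl2; first exact/cvgNrNy.
Unshelve. all: by end_near. Qed.

Lemma dominated_cvg0_pinfty K (F : R -> R) :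
  (forall t, 0 <= t -> `|F t| <= K * (oneDsqr t)^-1) -> F t @[t --> +oo] --> 0.
Proof.
move=> FK.
have K0 : 0 <= K.
  have := le_trans (normr_ge0 _) (FK 0 (lexx _)).
  by rewrite /oneDsqr expr0n/= addr0 invr1 mulr1.
apply/cvgrPdist_le => e e0.
apply: filterS2 (nbhs_pinfty_ge (num_real 1)) (nbhs_pinfty_ge (num_real (K / e))).
move=> t t1 tK; rewrite sub0r normrN (le_trans (FK _ _))//; first exact: le_trans t1.
rewrite ler_pdivrMr ?oneDsqr_gt0//; move: tK; rewrite ler_pdivrMr// => tK.
apply: le_trans tK _; rewrite mulrC ler_wpM2l ?(ltW e0)// /oneDsqr.
nra.
Qed.

Lemma dominated_cvg0_ninfty K (F : R -> R) :
  (forall t, t <= 0 -> `|F t| <= K * (oneDsqr t)^-1) -> F t @[t --> -oo] --> 0.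
Proof.
move=> FK; apply/cvgNy_compNP; apply: (@dominated_cvg0_pinfty K) => t t0 /=.
by have := FK (- t); rewrite oppr_le0 /oneDsqr sqrrN => /(_ t0).
Qed.

End TameIntegral.

(** * Complex integrals and one-dimensional Fourier inversion *)

Section ComplexIntegral.
Variable R : realType.
Local Notation mu := (@lebesgue_measure R).
Local Notation C := R[i].
Local Notation Re := complex.Re.
Local Notation Im := complex.Im.

(** The l^1 norm bounds real and imaginary parts separately, as integrals computed part by part
    require, and is still submultiplicative. *)
Definition N1 (z : C) : R := `|Re z| + `|Im z|.

Lemma ReM (x y : C) : Re (x * y) = Re x * Re y - Im x * Im y.
Proof. by case: x y => [a b] [c d]. Qed.
Lemma ImM (x y : C) : Im (x * y) = Re x * Im y + Im x * Re y.
Proof. by case: x y => [a b] [c d]. Qed.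
Lemma ReD (x y : C) : Re (x + y) = Re x + Re y.
Proof. by case: x y => [a b] [c d]. Qed.
Lemma ImD (x y : C) : Im (x + y) = Im x + Im y.
Proof. by case: x y => [a b] [c d]. Qed.
Lemma complex_ext (x y : C) : Re x = Re y -> Im x = Im y -> x = y.
Proof. by case: x y => [a b] [c d] /= -> ->. Qed.

Lemma N1_ge0 z : 0 <= N1 z. Proof. by rewrite addr_ge0. Qed.
Lemma le_Re_N1 z : `|Re z| <= N1 z. Proof. by rewrite lerDl. Qed.
Lemma le_Im_N1 z : `|Im z| <= N1 z. Proof. by rewrite lerDr. Qed.

Lemma N1M x y : N1 (x * y) <= N1 x * N1 y.
Proof.
rewrite /N1 ReM ImM mulrDl !mulrDr -!normrM.
apply: le_trans (lerD (ler_normB _ _) (ler_normD _ _)) _.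
by rewrite le_eqVlt; apply/orP; left; apply/eqP; ring.
Qed.

Lemma N1_real (x : R) : N1 x%:C = `|x|.
Proof. by rewrite /N1 /= normr0 addr0. Qed.

Definition cvgC (u : nat -> C) (z : C) : Prop :=
  (Re (u n) @[n --> \oo] --> Re z) /\ (Im (u n) @[n --> \oo] --> Im z).

Lemma cvgC_cst z : cvgC (fun=> z) z.
Proof. by split; exact: cvg_cst. Qed.

Lemma cvgC_unique u z z' : cvgC u z -> cvgC u z' -> z = z'.
Proof.
by move=> [r i] [r' i']; apply: complex_ext;
  [apply: cvg_unique r r'|apply: cvg_unique i i']; exact: norm_hausdorff.
Qed.

Lemma cvgCM u v z z' : cvgC u z -> cvgC v z' -> cvgC (fun n => u n * v n) (z * z').
Proof.
move=> [r i] [r' i']; split; rewrite ?ReM ?ImM.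
  under eq_cvg do rewrite ReM.
  by apply: cvgB; apply: cvgM.
under eq_cvg do rewrite ImM.
by apply: cvgD; apply: cvgM.
Qed.

Lemma cvgC_real (u : nat -> R) (l : R) : u n @[n --> \oo] --> l ->
  cvgC (fun n => (u n)%:C) l%:C.
Proof. by move=> ul; split => //=; exact: cvg_cst. Qed.

Definition intC (f : R -> C) : C :=
  (\int[mu]_t Re (f t)) +i* (\int[mu]_t Im (f t)).

Definition tameC (K : R) (f : R -> C) :=
  [/\ continuous (fun t => Re (f t)), continuous (fun t => Im (f t)) &
      forall t, N1 (f t) <= K * (oneDsqr t)^-1].

Lemma tameC_Re K f : tameC K f -> tame K (fun t => Re (f t)).
Proof. by move=> [cr ci fK]; split => // t; apply: le_trans (fK t); exact: le_Re_N1. Qed.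
Lemma tameC_Im K f : tameC K f -> tame K (fun t => Im (f t)).
Proof. by move=> [cr ci fK]; split => // t; apply: le_trans (fK t); exact: le_Im_N1. Qed.

Lemma eq_intC f g : f =1 g -> intC f = intC g.
Proof. by move=> /funext ->. Qed.

Lemma tameC_le_intC K f : tameC K f -> N1 (intC f) <= K * (2 * pi).
Proof.
move=> Kf; rewrite /N1 /= mulrCA mulr2n mulrDl mul1r.
by apply: lerD; [apply: tame_le_int (tameC_Re Kf)|apply: tame_le_int (tameC_Im Kf)].
Qed.

Lemma tameC_cvg K (f_ : nat -> R -> C) f : (forall n, tameC K (f_ n)) ->
  (forall t, cvgC (f_ ^~ t) (f t)) -> cvgC (fun n => intC (f_ n)) (intC f).
Proof.
move=> Kf_ f_f; split => /=.
  by apply: (@tame_cvg_int _ K) => [n|t]; [apply: tameC_Re|apply: (f_f t).1].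
by apply: (@tame_cvg_int _ K) => [n|t]; [apply: tameC_Im|apply: (f_f t).2].
Qed.

Lemma intCZ K (c : C) f : tameC K f -> intC (fun t => c * f t) = c * intC f.
Proof.
move=> Kf; have iR := tame_integrable (tameC_Re Kf).
have iI := tame_integrable (tameC_Im Kf).
have iZ (k : R) (g : R -> R) : mu.-integrable setT (EFin \o g) ->
   mu.-integrable setT (EFin \o (fun t => k * g t)).
  move=> ig; have := integrableZl measurableT k ig.
  by apply: eq_integrable => // t _ /=; rewrite EFinM.
apply: complex_ext; rewrite ?ReM ?ImM /=.
  under eq_Rintegral do rewrite ReM.
  rewrite RintegralB//; [|exact: iZ|exact: iZ].
  by rewrite !RintegralZl.
under eq_Rintegral do rewrite ImM.
rewrite RintegralD//; [|exact: iZ|exact: iZ].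
by rewrite !RintegralZl.
Qed.

Lemma intC_affine K f (c d : R) : c != 0 -> tameC K f ->
  `|c|%:C * intC (fun t => f (c * t + d)) = intC f.
Proof.
move=> c0 Kf; apply: complex_ext; rewrite ?ReM ?ImM /= mul0r ?subr0 ?addr0.
  exact: tame_integral_affine (tameC_Re Kf).
exact: tame_integral_affine (tameC_Im Kf).
Qed.

Lemma intC_Fubini (f : R -> R -> C) K :
  (forall y, continuous (fun x => Re (f x y))) ->
  (forall y, continuous (fun x => Im (f x y))) ->
  (forall x, continuous (fun y => Re (f x y))) ->
  (forall x, continuous (fun y => Im (f x y))) ->
  (forall x y, N1 (f x y) <= K * (oneDsqr x)^-1 * (oneDsqr y)^-1) ->
  intC (fun x => intC (f x)) = intC (fun y => intC (f ^~ y)).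
Proof.
move=> c1 c2 c3 c4 fK; apply: complex_ext => /=.
  by apply: (@tame_Fubini _ (fun x y => Re (f x y)) K) => // x y;
     exact: le_trans (le_Re_N1 _) (fK x y).
by apply: (@tame_Fubini _ (fun x y => Im (f x y)) K) => // x y;
   exact: le_trans (le_Im_N1 _) (fK x y).
Qed.

Lemma Rintegral_eq_off0 (f g : R -> R) : continuous g ->
  (forall t, t != 0 -> f t = g t) -> \int[mu]_t f t = \int[mu]_t g t.
Proof.
move=> cg fg; rewrite /Rintegral; congr fine.
have mg : measurable_fun setT g by exact: continuous_measurable_fun.
apply: ae_eq_integral => //; last 2 first.
- exact/measurable_EFinP.
- exists [set 0]; split; [exact: measurable_set1|exact: lebesgue_measure_set1|].
  move=> t /= ft; apply: contrapT => /eqP t0; apply: ft => _.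
  by rewrite /= fg.
apply/measurable_EFinP.
have -> : f = (fun t => if t == 0 then f 0 else g t).
  by apply/funext => t; case: eqP => [->//|/eqP t0]; exact: fg.
apply: measurable_fun_if => //.
- apply: (measurable_fun_bool true); rewrite setTI.
  rewrite [X in measurable X](_ : _ = [set 0]) ?measurable_set1//.
  by apply/seteqP; split => t /= /eqP.
- exact: measurable_funTS.
Qed.

(** Measurability of [f] follows from that of [g], since a single value is changed. It serves the
    integrals over a pivot, where the integrand on the torus side is set to [0] at a vanishing
    pivot. *)
Lemma intC_eq_off0 K (f g : R -> C) : tameC K g ->
  (forall t, t != 0 -> f t = g t) -> intC f = intC g.
Proof.
move=> [cr ci _] fg; apply: complex_ext => /=.
  by apply: Rintegral_eq_off0 => // t t0; rewrite fg.
by apply: Rintegral_eq_off0 => // t t0; rewrite fg.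
Qed.

Lemma tameCM K (f g : R -> C) (B : R) : tameC K f ->
  continuous (fun t => Re (g t)) -> continuous (fun t => Im (g t)) ->
  (forall t, N1 (g t) <= B) -> tameC (B * K) (fun t => g t * f t).
Proof.
move=> [cr ci fK] gr gi gB; split.
- under [X in continuous X]eq_fun do rewrite ReM.
  by move=> t; apply: cvgB; apply: cvgM; [apply: gr|apply: cr|apply: gi|apply: ci].
- under [X in continuous X]eq_fun do rewrite ImM.
  by move=> t; apply: cvgD; apply: cvgM; [apply: gr|apply: ci|apply: gi|apply: cr].
- move=> t; apply: le_trans (N1M _ _) _; rewrite -mulrA.
  by apply: ler_pM => //; exact: N1_ge0.
Qed.

Lemma tameCD K L (f g : R -> C) : tameC K f -> tameC L g ->
  tameC (K + L) (fun t => f t + g t).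
Proof.
move=> [cr ci fK] [gr gi gL]; split.
- under [X in continuous X]eq_fun do rewrite ReD.
  by move=> t; apply: cvgD; [apply: cr|apply: gr].
- under [X in continuous X]eq_fun do rewrite ImD.
  by move=> t; apply: cvgD; [apply: ci|apply: gi].
- move=> t; rewrite mulrDl; apply: le_trans (lerD (fK t) (gL t)).
  rewrite /N1 ReD ImD addrACA; apply: lerD; exact: ler_normD.
Qed.

Lemma intCD K L (f g : R -> C) : tameC K f -> tameC L g ->
  intC (fun t => f t + g t) = intC f + intC g.
Proof.
move=> Kf Lg; apply: complex_ext; rewrite ?ReD ?ImD /=.
  under eq_Rintegral do rewrite ReD.
  by rewrite RintegralD//; [exact: tame_integrable (tameC_Re Kf)|
    exact: tame_integrable (tameC_Re Lg)].
under eq_Rintegral do rewrite ImD.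
by rewrite RintegralD//; [exact: tame_integrable (tameC_Im Kf)|
  exact: tame_integrable (tameC_Im Lg)].
Qed.

Lemma tameC_cstM K (c : C) (f : R -> C) : tameC K f ->
  tameC (N1 c * K) (fun t => c * f t).
Proof.
by move=> Kf; apply: (@tameCM K f (fun=> c)) => // t; exact: cvg_cst.
Qed.

Lemma tameC_ge0 K f : tameC K f -> 0 <= K.
Proof.
move=> [_ _ fK]; have := le_trans (N1_ge0 _) (fK 0).
by rewrite /oneDsqr expr0n/= addr0 invr1 mulr1.
Qed.

Lemma tameC_bounded K f t : tameC K f -> N1 (f t) <= K.
Proof.
move=> Kf; have K0 := tameC_ge0 Kf; case: Kf => _ _ fK.
by apply: le_trans (fK t) _; rewrite ler_piMr// oneDsqrV_le1.
Qed.

Lemma intC_oneDsqrV (z : C) :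
  intC (fun t => z * ((oneDsqr t)^-1)%:C) = z * (pi : R)%:C.
Proof.
apply: complex_ext; rewrite ?ReM ?ImM /= mulr0 ?subr0 ?add0r.
  under eq_Rintegral do rewrite ReM /= mulr0 subr0.
  exact: Rintegral_oneDsqrV.
under eq_Rintegral do rewrite ImM /= mulr0 add0r.
exact: Rintegral_oneDsqrV.
Qed.

End ComplexIntegral.

(** * One-dimensional Fourier inversion by Abel summation *)

Section Inversion.
Variables (R : realType) (hbar : R).
Hypothesis hbar0 : hbar != 0.
Local Notation mu := (@lebesgue_measure R).
Local Notation C := R[i].
Local Notation Re := complex.Re.
Local Notation Im := complex.Im.

Definition psi (x : R) : C := cos (hbar * x) +i* sin (hbar * x).

Lemma psiD x y : psi (x + y) = psi x * psi y.
Proof.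
by apply: complex_ext; rewrite ?ReM ?ImM /= mulrDr ?cosD// sinD; ring.
Qed.

Lemma psi0 : psi 0 = 1.
Proof. by rewrite /psi mulr0 cos0 sin0. Qed.

Lemma psiN x : psi x * psi (- x) = 1.
Proof. by rewrite -psiD subrr psi0. Qed.

Lemma N1_psi x : N1 (psi x) <= 2.
Proof.
rewrite /N1 /=.
have h (u : R) : -1 <= u <= 1 -> `|u| <= 1 by rewrite ler_norml.
by apply: lerD; apply: h; rewrite ?cos_geN1 ?cos_le1 ?sin_geN1 ?sin_le1.
Qed.

Lemma continuous_Re_psi (c : R) : continuous (fun t => Re (psi (c * t))).
Proof.
move=> t /=; apply: continuous_comp; last exact: continuous_cos.
by apply: cvgM; [exact: cvg_cst|apply: cvgM; [exact: cvg_cst|exact: cvg_id]].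
Qed.
Lemma continuous_Im_psi (c : R) : continuous (fun t => Im (psi (c * t))).
Proof.
move=> t /=; apply: continuous_comp; last exact: continuous_sin.
by apply: cvgM; [exact: cvg_cst|apply: cvgM; [exact: cvg_cst|exact: cvg_id]].
Qed.

Lemma tameC_psiM K (f : R -> C) (c : R) : tameC K f ->
  tameC (2 * K) (fun t => psi (c * t) * f t).
Proof.
move=> Kf; apply: tameCM => //; [exact: continuous_Re_psi|exact: continuous_Im_psi|].
by move=> t; exact: N1_psi.
Qed.

(** Abel summation factor: it makes the double integral of the inversion formula absolutely
    convergent and tends to [1] as [e] tends to [0]. *)
Definition abel (e : R) (z : R) : R := expR (- (e * `|z|)).

Lemma abel_continuous e : continuous (abel e).
Proof.
move=> z; apply: continuous_comp; last exact: continuous_expR.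
apply: cvgN; apply: cvgM; first exact: cvg_cst.
by apply: cvg_norm; exact: cvg_id.
Qed.

Lemma abel_le1 e z : 0 < e -> 0 <= abel e z <= 1.
Proof.
move=> e0; rewrite expR_ge0/= /abel -expR0 ler_expR oppr_le0 mulr_ge0//.
exact: ltW.
Qed.

Lemma abel_dominated e z : 0 < e ->
  `|abel e z| <= (1 + 4 / e ^+ 2) * (oneDsqr z)^-1.
Proof.
move=> e0; rewrite ger0_norm ?expR_ge0// /abel expRN.
rewrite ler_pdivlMr ?oneDsqr_gt0// mulrC ler_pdivrMr ?expR_gt0//.
set y := e * `|z|.
have y0 : 0 <= y by rewrite mulr_ge0// ltW.
(* For [y >= 0], [1 + y^2 / 4 <= (1 + y / 2)^2 <= exp (y / 2)^2]; with [y = e |z|] this controls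
   [z^2] at the cost of [4 / e^2]. *)
have h : 1 + y ^+ 2 / 4 <= expR y.
  have -> : expR y = expR (y / 2) ^+ 2.
    by rewrite expr2 -expRD -splitr.
  have h1 := expR_ge1Dx (y / 2).
  apply: (@le_trans _ _ ((1 + y / 2) ^+ 2)); first nra.
  by rewrite lerXn2r// nnegrE ?addr_ge0 ?divr_ge0 ?expR_ge0.
apply: le_trans (ler_wpM2l _ h); last by rewrite addr_ge0// divr_ge0// sqr_ge0.
have -> : (1 + 4 / e ^+ 2) * (1 + y ^+ 2 / 4) = 1 + `|z| ^+ 2 + (4 / e ^+ 2 + y ^+ 2 / 4).
  rewrite /y; field; exact: lt0r_neq0.
rewrite /oneDsqr real_normK ?num_real// lerDl addr_ge0// divr_ge0// sqr_ge0//.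
Qed.

Lemma tame_abel e (g : R -> R) : 0 < e -> continuous g -> (forall z, `|g z| <= 1) ->
  tame (1 + 4 / e ^+ 2) (fun z => abel e z * g z).
Proof.
move=> e0 cg g1; split; first by move=> z; apply: cvgM; [exact: abel_continuous|exact: cg].
move=> z; rewrite normrM; apply: le_trans (abel_dominated z e0).
by rewrite ler_piMr.
Qed.

Lemma cos_abs_le1 (u : R) : `|cos u| <= 1.
Proof. by rewrite ler_norml cos_geN1 cos_le1. Qed.
Lemma sin_abs_le1 (u : R) : `|sin u| <= 1.
Proof. by rewrite ler_norml sin_geN1 sin_le1. Qed.

Lemma continuous_cosM (k : R) : continuous (fun z => cos (k * z)).
Proof.
move=> z; apply: continuous_comp; last exact: continuous_cos.
by apply: cvgM; [exact: cvg_cst|exact: cvg_id].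
Qed.
Lemma continuous_sinM (k : R) : continuous (fun z => sin (k * z)).
Proof.
move=> z; apply: continuous_comp; last exact: continuous_sin.
by apply: cvgM; [exact: cvg_cst|exact: cvg_id].
Qed.

Lemma integral_abel_cos e k : 0 < e ->
  \int[mu]_z (abel e z * cos (k * z)) = 2 * e / (e ^+ 2 + k ^+ 2).
Proof.
move=> e0.
have D0 : 0 < e ^+ 2 + k ^+ 2 by rewrite ltr_wpDr ?sqr_ge0// exprn_gt0.
have Dn : e ^+ 2 + k ^+ 2 != 0 by rewrite gt_eqF.
(* An antiderivative of [exp (- s z) cos (k z)]; [s = e] serves on the positive half-line and
   [s = - e] on the negative one. *)
pose P (s : R) z := expR (- (s * z)) * (- s * cos (k * z) + k * sin (k * z)) / (e ^+ 2 + k ^+ 2).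
have dP (s : R) : s ^+ 2 = e ^+ 2 -> forall z : R, is_derive z 1 (P s) (expR (- (s * z)) * cos (k * z)).
  move=> se z; rewrite /P; apply: is_derive_eq.
  rewrite /GRing.scale /=.
  have -> : e ^+ 2 = s ^+ 2 by [].
  rewrite -se in Dn.
  by field.
have cP (s : R) : continuous (fun z => expR (- (s * z)) * cos (k * z)).
  move=> z; apply: cvgM; last exact: continuous_cosM.
  apply: continuous_comp; last exact: continuous_expR.
  by apply: cvgN; apply: cvgM; [exact: cvg_cst|exact: cvg_id].
have bP (s z : R) : s ^+ 2 = e ^+ 2 -> `|P s z| <= (`|s| + `|k|) / (e ^+ 2 + k ^+ 2) * expR (- (s * z)).
  move=> se; rewrite /P !normrM normrV ?unitfE// (gtr0_norm D0) (gtr0_norm (expR_gt0 _)).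
  rewrite mulrAC -mulrA mulrC [X in X * _ <= _]mulrC; apply: ler_wpM2r; first exact: expR_ge0.
  apply: ler_wpM2r; first by rewrite invr_ge0 ltW.
  apply: le_trans (ler_normD _ _) _; rewrite !normrM normrN.
  by apply: lerD; apply: ler_piMr => //; rewrite ?cos_abs_le1 ?sin_abs_le1.
have C0 : 0 <= (e + `|k|) / (e ^+ 2 + k ^+ 2).
  by rewrite divr_ge0 ?(ltW D0)// addr_ge0// ltW.
have ta : tame (1 + 4 / e ^+ 2) (fun z => abel e z * cos (k * z)).
  by apply: tame_abel => // [|z]; [exact: continuous_cosM|exact: cos_abs_le1].
have h1 (t : R) : 0 <= t -> abel e t * cos (k * t) = expR (- (e * t)) * cos (k * t).
  by move=> t0; rewrite /abel ger0_norm.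
have h2 (t : R) : t <= 0 -> abel e t * cos (k * t) = expR (- (- e * t)) * cos (k * t).
  by move=> t0; rewrite /abel ler0_norm// mulrN mulNr.
have h3 : P e t @[t --> +oo] --> 0.
  apply: (@dominated_cvg0_pinfty _ ((e + `|k|) / (e ^+ 2 + k ^+ 2) * (1 + 4 / e ^+ 2))) => t t0.
  apply: le_trans (bP _ _ _) _ => //; rewrite (gtr0_norm e0) -[leRHS]mulrA; apply: ler_wpM2l => //.
  have := abel_dominated t e0; rewrite /abel (ger0_norm t0); apply: le_trans.
  by rewrite ler_norm.
have h4 : P (- e) t @[t --> -oo] --> 0.
  apply: (@dominated_cvg0_ninfty _ ((e + `|k|) / (e ^+ 2 + k ^+ 2) * (1 + 4 / e ^+ 2))) => t t0.
  apply: le_trans (bP _ _ _) _; first by rewrite sqrrN.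
  rewrite normrN (gtr0_norm e0) -[leRHS]mulrA; apply: ler_wpM2l => //.
  have := abel_dominated t e0; rewrite /abel (ler0_norm t0) mulrN mulNr; apply: le_trans.
  by rewrite ler_norm.
have := FTC_tame_split ta (cP e) (cP (- e)) (dP e erefl) (dP (- e) (sqrrN e)) h1 h2 h3 h4.
move=> ->; rewrite /P !mulr0 oppr0 cos0 sin0 expR0; field; exact: Dn.
Qed.

Lemma integral_abel_sin e k : 0 < e -> \int[mu]_z (abel e z * sin (k * z)) = 0.
Proof.
move=> e0.
have ta : tame (1 + 4 / e ^+ 2) (fun z => abel e z * sin (k * z)).
  by apply: tame_abel => // [|z]; [exact: continuous_sinM|exact: sin_abs_le1].
have := tame_integral_opp ta.
under eq_Rintegral do rewrite /abel normrN mulrN sinN mulrN -mulN1r.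
rewrite RintegralZl//; last exact: tame_integrable ta.
rewrite mulN1r => /eqP; rewrite eq_sym -addr_eq0 -mulr2n mulrn_eq0 /=.
by move=> /eqP.
Qed.

Lemma intC_abel_psi e s : 0 < e ->
  intC (fun z => (abel e z)%:C * psi (s * z)) =
  (2 * e / (e ^+ 2 + (hbar * s) ^+ 2))%:C.
Proof.
move=> e0; apply: complex_ext => /=.
  under eq_Rintegral do rewrite mul0r subr0 mulrA.
  exact: integral_abel_cos.
under eq_Rintegral do rewrite mul0r addr0 mulrA.
exact: integral_abel_sin.
Qed.

(** With the Abel factor the order of integration can be exchanged, and the inner integral is a
    Poisson kernel concentrating at [t = x]. The rescaling [t = x + (e / hbar) v] turns the kernel
    into the fixed density [1 / (1 + v^2)] of mass [pi]. The factor is removed by dominated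
    convergence, thanks to the decay assumed of the transform. *)
Lemma fourier_inversion1 K K' (f : R -> C) (x : R) : tameC K f ->
  tameC K' (fun z => intC (fun t => psi (- z * t) * f t)) ->
  (`|hbar| / (2 * pi))%:C *
    intC (fun z => psi (x * z) * intC (fun t => psi (- z * t) * f t)) = f x.
Proof.
move=> Kf Kfh; set fh := (fun z => intC _) in Kfh *.
pose e (m : nat) : R := m.+1%:R^-1.
have e0 m : 0 < e m by rewrite invr_gt0.
have e_0 : e m @[m --> \oo] --> 0 by exact: cvg_harmonic.
pose A m := intC (fun z => (abel (e m) z)%:C * (psi (x * z) * fh z)).
have S1 : cvgC A (intC (fun z => psi (x * z) * fh z)).
  apply: (@tameC_cvg _ (1 * (2 * K'))) => [m|z].
    apply: tameCM => [|||z]; [exact: tameC_psiM|exact: abel_continuous| |].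
      by move=> z; exact: cvg_cst.
    by rewrite N1_real; have /andP[h1 h2] := abel_le1 z (e0 m); rewrite ger0_norm.
  rewrite -[X in cvgC _ X]mul1r; apply: cvgCM; last exact: cvgC_cst.
  apply: cvgC_real; rewrite /abel -[X in _ --> X]expR0.
  apply: continuous_cvg; first exact: continuous_expR.
  rewrite -oppr0 -[X in - X](mul0r `|z|); apply: cvgN.
  by apply: cvgM; [exact: e_0|exact: cvg_cst].
pose P m s := 2 * e m / (e m ^+ 2 + (hbar * s) ^+ 2).
have Dn m s : 0 < e m ^+ 2 + (hbar * s) ^+ 2.
  by rewrite ltr_wpDr ?sqr_ge0// exprn_gt0.
have S2 m : A m = intC (fun t => (P m (x - t))%:C * f t).
  transitivity (intC (fun z => intC (fun t =>
      ((abel (e m) z)%:C * psi ((x - t) * z)) * f t))).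
    apply: eq_intC => z; rewrite mulrA -(intCZ _ (tameC_psiM (- z) Kf)).
    apply: eq_intC => t; rewrite !mulrA -[_ * psi _ * psi _]mulrA -psiD.
    by congr (_ * psi _ * _); ring.
  have ta t : tameC ((1 + 4 / e m ^+ 2) * 2) (fun z => (abel (e m) z)%:C * psi ((x - t) * z)).
    split.
    + move=> z /=; apply: cvgB; apply: cvgM; try exact: cvg_cst.
      * exact: abel_continuous.
      * exact: continuous_Re_psi.
      * exact: continuous_Im_psi.
    + move=> z /=; apply: cvgD; apply: cvgM; try exact: cvg_cst.
      * exact: abel_continuous.
      * exact: continuous_Im_psi.
      * exact: continuous_Re_psi.
    + move=> z; apply: le_trans (N1M _ _) _; rewrite N1_real mulrAC.
      apply: ler_pM => //; [exact: N1_ge0|exact: abel_dominated|exact: N1_psi].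
  have tz t : tameC (N1 (f t) * ((1 + 4 / e m ^+ 2) * 2))
      (fun z => (abel (e m) z)%:C * psi ((x - t) * z) * f t).
    by have := tameC_cstM (f t) (ta t); congr tameC; apply/funext => z; rewrite mulrC.
  have tt z : tameC (N1 ((abel (e m) z)%:C * psi (x * z)) * (2 * K))
      (fun t => (abel (e m) z)%:C * psi ((x - t) * z) * f t).
    have := tameC_cstM ((abel (e m) z)%:C * psi (x * z)) (tameC_psiM (- z) Kf).
    congr tameC; apply/funext => t.
    rewrite !mulrA -[_ * psi _ * psi _]mulrA -psiD.
    by congr (_ * psi _ * _); ring.
  rewrite (@intC_Fubini _ _ ((1 + 4 / e m ^+ 2) * 2 * K)).
  - apply: eq_intC => t.
    transitivity (intC (fun z => f t * ((abel (e m) z)%:C * psi ((x - t) * z)))).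
      by apply: eq_intC => z; rewrite mulrC.
    by rewrite (intCZ _ (ta t)) intC_abel_psi// mulrC.
  - by move=> t; case: (tz t).
  - by move=> t; case: (tz t).
  - by move=> z; case: (tt z).
  - by move=> z; case: (tt z).
  - move=> z t; apply: le_trans (N1M _ _) _.
    have -> : (1 + 4 / e m ^+ 2) * 2 * K / oneDsqr z / oneDsqr t =
      ((1 + 4 / e m ^+ 2) / oneDsqr z * 2) * (K / oneDsqr t) by ring.
    apply: ler_pM; try exact: N1_ge0; last by case: Kf.
    apply: le_trans (N1M _ _) _; rewrite N1_real.
    apply: ler_pM => //; [exact: N1_ge0|exact: abel_dominated|exact: N1_psi].
pose B m := intC (fun v => f (e m / hbar * v + x) * ((oneDsqr v)^-1)%:C).
have tB m : tameC K (fun v => f (e m / hbar * v + x) * ((oneDsqr v)^-1)%:C).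
  split.
  - have -> : (fun v => Re (f (e m / hbar * v + x) * ((oneDsqr v)^-1)%:C)) =
       (fun v => Re (f (e m / hbar * v + x)) * (oneDsqr v)^-1).
      by apply/funext => v; rewrite ReM /= mulr0 subr0.
    move=> v; apply: cvgM; last exact: continuous_oneDsqrV.
    apply: (@continuous_comp _ _ _ (fun v => e m / hbar * v + x) (fun t => Re (f t))).
      by apply: cvgD; [apply: cvgM; [exact: cvg_cst|exact: cvg_id]|exact: cvg_cst].
    by case: Kf => h _ _; exact: h.
  - have -> : (fun v => Im (f (e m / hbar * v + x) * ((oneDsqr v)^-1)%:C)) =
       (fun v => Im (f (e m / hbar * v + x)) * (oneDsqr v)^-1).
      by apply/funext => v; rewrite ImM /= mulr0 add0r.
    move=> v; apply: cvgM; last exact: continuous_oneDsqrV.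
    apply: (@continuous_comp _ _ _ (fun v => e m / hbar * v + x) (fun t => Im (f t))).
      by apply: cvgD; [apply: cvgM; [exact: cvg_cst|exact: cvg_id]|exact: cvg_cst].
    by case: Kf => _ h _; exact: h.
  - move=> v; apply: le_trans (N1M _ _) _; rewrite N1_real ger0_norm ?oneDsqrV_ge0//.
    by apply: ler_wpM2r; [exact: oneDsqrV_ge0|exact: tameC_bounded].
have S3 m : A m = (2 / `|hbar|)%:C * B m.
  have c0 : e m / hbar != 0 by rewrite mulf_neq0 ?invr_eq0// gt_eqF.
  have tF : tameC (2 / e m * K) (fun t => (P m (x - t))%:C * f t).
    apply: tameCM => // [t|t|t].
    - apply: cvgM; first exact: cvg_cst.
      apply: cvgV; first by rewrite gt_eqF.
      apply: cvgD; first exact: cvg_cst.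
      have cc : continuous (fun t => hbar * (x - t)).
        move=> s; apply: cvgM; first exact: cvg_cst.
        by apply: cvgB; [exact: cvg_cst|exact: cvg_id].
      by rewrite expr2; apply: cvgM; exact: cc.
    - exact: cvg_cst.
    - rewrite N1_real ger0_norm; last first.
        by rewrite divr_ge0 ?(ltW (Dn _ _))// mulr_ge0 ?(ltW (e0 _)).
      rewrite /P ler_pdivrMr// mulrDr.
      have -> : 2 / e m * e m ^+ 2 = 2 * e m by field; rewrite gt_eqF.
      by rewrite lerDl mulr_ge0 ?sqr_ge0// divr_ge0// ltW.
  rewrite S2 -(intC_affine x c0 tF).
  rewrite (eq_intC (g := fun v => (2 / e m)%:C *
     (f (e m / hbar * v + x) * ((oneDsqr v)^-1)%:C))); last first.
    move=> v; rewrite [RHS]mulrCA [RHS]mulrC -rmorphM; congr (_%:C * _).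
    rewrite /P /oneDsqr; have em0 : e m != 0 by rewrite gt_eqF.
    have v0 : 1 + v ^+ 2 != 0 by rewrite gt_eqF// (oneDsqr_gt0 v).
    have D1 : e m ^+ 2 + (hbar * (x - (e m / hbar * v + x))) ^+ 2 != 0 by rewrite gt_eqF.
    have E1 : hbar * (x - (e m / hbar * v + x)) = - (e m * v) by field.
    rewrite E1 in D1 *; rewrite sqrrN in D1 *.
    by field; rewrite em0 v0 D1.
  rewrite (intCZ _ (tB m)) mulrA -rmorphM; congr (_%:C * _).
  rewrite normrM (gtr0_norm (e0 m)) normfV.
  by field; rewrite normr_eq0 hbar0 gt_eqF.
have S4 : cvgC B (f x * (pi : R)%:C).
  rewrite -intC_oneDsqrV; apply: (tameC_cvg tB) => v.
  apply: cvgCM; last exact: cvgC_cst.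
  have e1 : (e m / hbar * v + x) @[m --> \oo] --> x.
    rewrite -[X in _ --> X]add0r -[X in _ --> X + _](mul0r (hbar^-1 * v)).
    apply: cvgD; last exact: cvg_cst.
    under eq_cvg do rewrite -mulrA.
    by apply: cvgM; [exact: e_0|exact: cvg_cst].
  case: Kf => cr ci _; split.
    by apply: (@continuous_cvg _ _ _ _ _ _ (fun t => Re (f t))) => //; exact: cr.
  by apply: (@continuous_cvg _ _ _ _ _ _ (fun t => Im (f t))) => //; exact: ci.
have S5 : cvgC A ((2 / `|hbar|)%:C * (f x * (pi : R)%:C)).
  have -> : A = fun m => (2 / `|hbar|)%:C * B m by apply/funext.
  by apply: cvgCM => //; exact: cvgC_cst.
have E (a b c z : C) : a * (b * (z * c)) = z * (a * b * c) by ring.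
rewrite (cvgC_unique S1 S5) E -[RHS]mulr1 -2!(rmorphM (real_complex R)).
congr (_ * _); rewrite -[RHS](rmorph1 (real_complex R)); congr (_%:C).
have h1 : `|hbar| != 0 by rewrite normr_eq0.
have h2 : (pi : R) != 0 by rewrite gt_eqF// pi_gt0.
move: (pi : R) `|hbar| h2 h1 => p q p0 q0.
field.
by rewrite ?p0 ?q0.
Qed.

(** Integration by parts: [psi (- z t) f t] tends to [0] at both ends, so the integral of its
    derivative vanishes. *)
Lemma FT_derive K (f f' : R -> C) (z : R) : tameC K f -> tameC K f' ->
  (forall t : R, is_derive t 1 (fun s => Re (f s)) (Re (f' t))) ->
  (forall t : R, is_derive t 1 (fun s => Im (f s)) (Im (f' t))) ->
  intC (fun t => psi (- z * t) * f' t) =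
  (0 +i* (hbar * z)) * intC (fun t => psi (- z * t) * f t).
Proof.
move=> Kf Kf' dr di.
have t1 := tameC_psiM (- z) Kf'.
have t2 := tameC_cstM (0 +i* - (hbar * z)) (tameC_psiM (- z) Kf).
suff : intC (fun t => psi (- z * t) * f' t +
    (0 +i* - (hbar * z)) * (psi (- z * t) * f t)) = 0.
  rewrite (intCD t1 t2) (intCZ _ (tameC_psiM (- z) Kf)) => /eqP.
  by rewrite addr_eq0 -mulNr => /eqP ->; congr (_ * _); apply: complex_ext => /=;
     rewrite ?oppr0 ?opprK.
have t3 := tameCD t1 t2.
have t4 := tameC_psiM (- z) Kf.
have dpr (t : R) : is_derive t 1 (fun s => cos (hbar * (- z * s))) (hbar * z * sin (hbar * (- z * t))).
  by apply: is_derive_eq; rewrite /GRing.scale /=; ring.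
have dpi (t : R) : is_derive t 1 (fun s => sin (hbar * (- z * s))) (- (hbar * z * cos (hbar * (- z * t)))).
  by apply: is_derive_eq; rewrite /GRing.scale /=; ring.
have zero g G : (forall t : R, is_derive t 1 G (g t)) -> continuous g ->
    (forall t, `|g t| <= (2 * K + N1 (0 +i* - (hbar * z)) * (2 * K)) * (oneDsqr t)^-1) ->
    (forall t, `|G t| <= 2 * K * (oneDsqr t)^-1) -> \int[mu]_t g t = 0.
  move=> dG cg gK GK.
  have := @FTC_tame_split R _ g g g G G 0 0 (conj cg gK) cg cg dG dG
    (fun _ _ => erefl) (fun _ _ => erefl)
    (dominated_cvg0_pinfty (fun t _ => GK t)) (dominated_cvg0_ninfty (fun t _ => GK t)).
  by move=> ->; ring.
apply: complex_ext => /=.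
  apply: (@zero _ (fun t => Re (psi (- z * t) * f t))).
  - move=> t; have -> : (fun t => Re (psi (- z * t) * f t)) =
      (fun s => cos (hbar * (- z * s)) * Re (f s) - sin (hbar * (- z * s)) * Im (f s)).
      by apply/funext => s; rewrite ReM.
    apply: is_derive_eq; rewrite /GRing.scale /= !ReD !ReM !ImM /=; ring.
  - by case: t3.
  - by move=> t; case: t3 => _ _ /(_ t); apply: le_trans; exact: le_Re_N1.
  - by move=> t; case: t4 => _ _ /(_ t); apply: le_trans; exact: le_Re_N1.
apply: (@zero _ (fun t => Im (psi (- z * t) * f t))).
- move=> t; have -> : (fun t => Im (psi (- z * t) * f t)) =
    (fun s => cos (hbar * (- z * s)) * Im (f s) + sin (hbar * (- z * s)) * Re (f s)).
    by apply/funext => s; rewrite ImM.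
  apply: is_derive_eq; rewrite /GRing.scale /= !ImD !ImM !ReM /=; ring.
- by case: t3.
- by move=> t; case: t3 => _ _ /(_ t); apply: le_trans; exact: le_Im_N1.
- by move=> t; case: t4 => _ _ /(_ t); apply: le_trans; exact: le_Im_N1.
Qed.

End Inversion.

(** * Iterated integrals and partial Fourier transforms *)

Section Slots.
Variables (R : realType) (hbar : R).
Hypothesis hbar0 : hbar != 0.
Variable I : eqType.
Local Notation C := R[i].
Local Notation Re := complex.Re.
Local Notation Im := complex.Im.
Local Notation pt := (I -> R).
Local Notation psi := (@psi R hbar).
Implicit Types (x y z : pt) (F G : pt -> C) (s S T : seq I).

Definition upd x (i : I) (t : R) : pt := fun j => if j == i then t else x j.

Lemma upd_same x i t : upd x i t i = t. Proof. by rewrite /upd eqxx. Qed.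
Lemma upd_other x i t j : j != i -> upd x i t j = x j.
Proof. by rewrite /upd => /negPf ->. Qed.
Lemma updC x i j t u : i != j -> upd (upd x i t) j u = upd (upd x j u) i t.
Proof.
move=> ij; apply/funext => k; rewrite /upd; case: eqP => [->|//].
by rewrite eq_sym (negPf ij).
Qed.
Lemma upd_upd x i t u : upd (upd x i t) i u = upd x i u.
Proof. by apply/funext => k; rewrite /upd; case: eqP. Qed.
Lemma upd_id x i : upd x i (x i) = x.
Proof. by apply/funext => k; rewrite /upd; case: eqP => [->|]. Qed.

Definition cvg_pt (x_ : nat -> pt) (x : pt) : Prop := forall j, x_ n j @[n --> \oo] --> x j.
(** Continuity is stated with coordinatewise convergent sequences because this is the form that
    dominated convergence delivers for an integral with parameters. *)
Definition sc F : Prop := forall (x_ : nat -> pt) x, cvg_pt x_ x -> cvgC (fun n => F (x_ n)) (F x).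
Definition scR (g : pt -> R) : Prop :=
  forall (x_ : nat -> pt) x, cvg_pt x_ x -> g (x_ n) @[n --> \oo] --> g x.

Lemma cvg_pt_upd (x_ : nat -> pt) x (t_ : nat -> R) t i : cvg_pt x_ x -> t_ n @[n --> \oo] --> t ->
  cvg_pt (fun n => upd (x_ n) i (t_ n)) (upd x i t).
Proof. by move=> xx tt j; rewrite /upd; case: (j == i) => //; exact: xx. Qed.

Lemma scR_cst c : scR (fun=> c). Proof. by move=> *; exact: cvg_cst. Qed.
Lemma scR_coord i : scR (fun x => x i). Proof. by move=> x_ x; exact. Qed.
Lemma scRD g h : scR g -> scR h -> scR (fun x => g x + h x).
Proof. by move=> cg ch x_ x xx; apply: cvgD; [exact: cg|exact: ch]. Qed.
Lemma scRM g h : scR g -> scR h -> scR (fun x => g x * h x).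
Proof. by move=> cg ch x_ x xx; apply: cvgM; [exact: cg|exact: ch]. Qed.
Lemma scRN g : scR g -> scR (fun x => - g x).
Proof. by move=> cg x_ x xx; apply: cvgN; exact: cg. Qed.
Lemma scR_sum (J : Type) (r : seq J) (P : pred J) (g : J -> pt -> R) :
  (forall j, P j -> scR (g j)) -> scR (fun x => \sum_(j <- r | P j) g j x).
Proof.
move=> cg; elim: r => [|j r IH].
  by under eq_fun do rewrite big_nil; exact: scR_cst.
under eq_fun do rewrite big_cons.
case: (boolP (P j)) => Pj //; apply: scRD => //; exact: cg.
Qed.

Lemma scM F G : sc F -> sc G -> sc (fun x => F x * G x).
Proof. by move=> cF cG x_ x xx; apply: cvgCM; [exact: cF|exact: cG]. Qed.
Lemma sc_cst (c : C) : sc (fun=> c).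
Proof. by move=> x_ x xx; exact: cvgC_cst. Qed.
Lemma sc_psi g : scR g -> sc (fun x => psi (g x)).
Proof.
move=> cg x_ x xx; have cgh : hbar * g (x_ n) @[n --> \oo] --> hbar * g x.
  by apply: cvgM; [exact: cvg_cst|exact: cg].
split => /=.
  by apply: continuous_cvg cgh; exact: continuous_cos.
by apply: continuous_cvg cgh; exact: continuous_sin.
Qed.
Lemma sc_comp F (Phi : pt -> pt) : (forall j, scR (fun x => Phi x j)) -> sc F ->
  sc (fun x => F (Phi x)).
Proof. by move=> cP cF x_ x xx; apply: cF => j; exact: cP. Qed.
Lemma scR_comp (g : pt -> R) (Phi : pt -> pt) : (forall j, scR (fun x => Phi x j)) ->
  scR g -> scR (fun x => g (Phi x)).
Proof. by move=> cP cF x_ x xx; apply: cF => j; exact: cP. Qed.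

Lemma sc_slice F x i : sc F ->
  continuous (fun t => Re (F (upd x i t))) /\ continuous (fun t => Im (F (upd x i t))).
Proof.
move=> cF.
suff H (t : R) (u : nat -> R) : u n @[n --> \oo] --> t ->
    cvgC (fun n => F (upd x i (u n))) (F (upd x i t)).
  by split=> t; apply/(@cvg_nbhsP _ R^o) => u ut; case: (H _ _ ut).
by move=> ut; apply: cF; apply: cvg_pt_upd => // j; exact: cvg_cst.
Qed.

Definition nrm S x : R := 1 + \sum_(i <- S) `|x i|.

Lemma nrm_ge1 S x : 1 <= nrm S x.
Proof. by rewrite lerDl sumr_ge0. Qed.
Lemma nrm_gt0 S x : 0 < nrm S x.
Proof. exact: lt_le_trans (nrm_ge1 S x). Qed.
Lemma nrm_coord S x i : i \in S -> `|x i| <= nrm S x.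
Proof.
move=> iS; rewrite /nrm (perm_big _ (perm_to_rem iS)) /= big_cons addrCA lerDl.
by rewrite addr_ge0// sumr_ge0.
Qed.

Definition rd S F := forall k, exists K, forall x, N1 (F x) * nrm S x ^+ k <= K.
(* All bounds are uniform in the variables outside [S]. *)
Definition cr S F := sc F /\ rd S F.

Lemma exp_le_exp (a : R) m k : 1 <= a -> (m <= k)%N -> a ^+ m <= a ^+ k.
Proof. by move=> a1 mk; rewrite ler_weXn2l. Qed.

(* A substitution [Phi] preserves rapid decrease when the old variables are polynomially bounded
   in terms of the new ones. *)
Definition gb S (Phi : pt -> pt) (g : pt -> R) :=
  exists C, exists e : nat, forall x, `|g x| <= C * nrm S (Phi x) ^+ e.

Lemma gb_cst S Phi c : gb S Phi (fun=> c).
Proof. by exists `|c|, 0%N => x; rewrite expr0 mulr1. Qed.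
Lemma gb_coord S Phi i : i \in S -> gb S Phi (fun x => Phi x i).
Proof. by move=> iS; exists 1, 1%N => x; rewrite expr1 mul1r nrm_coord. Qed.
Lemma gbW S Phi g : gb S Phi g ->
  exists C, exists e : nat, 0 <= C /\ forall x, `|g x| <= C * nrm S (Phi x) ^+ e.
Proof.
move=> [c [e H]]; exists `|c|, e; split => // x; apply: le_trans (H x) _.
by rewrite ler_wpM2r ?exprn_ge0 ?ler_norm// ltW// nrm_gt0.
Qed.
Lemma gbD S Phi g h : gb S Phi g -> gb S Phi h -> gb S Phi (fun x => g x + h x).
Proof.
move=> /gbW[c [e [c0 H]]] /gbW[c' [e' [c'0 H']]]; exists (c + c'), (e + e')%N => x.
apply: le_trans (ler_normD _ _) _; rewrite mulrDl.
by apply: lerD; [apply: le_trans (H x) _|apply: le_trans (H' x) _];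
   apply: ler_wpM2l => //; apply: exp_le_exp; rewrite ?nrm_ge1 ?leq_addr ?leq_addl.
Qed.
Lemma gbM S Phi g h : gb S Phi g -> gb S Phi h -> gb S Phi (fun x => g x * h x).
Proof.
move=> [c [e H]] [c' [e' H']]; exists (c * c'), (e + e')%N => x.
by rewrite normrM exprD mulrACA ler_pM.
Qed.

Lemma gb_sum (J : eqType) (r : seq J) S Phi (g : J -> pt -> R) :
  (forall j, j \in r -> gb S Phi (g j)) -> gb S Phi (fun x => \sum_(j <- r) g j x).
Proof.
elim: r => [|j r IH] H; first by under eq_fun do rewrite big_nil; exact: gb_cst.
under eq_fun do rewrite big_cons.
apply: gbD; first exact/H/mem_head.
by apply: IH => l lr; apply: H; rewrite inE lr orbT.
Qed.

Lemma gb_nrm S S' Phi : (forall i, i \in S' -> gb S Phi (fun x => x i)) ->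
  gb S Phi (nrm S').
Proof.
elim: S' => [|i S' IH] H.
  by rewrite /nrm; under eq_fun do rewrite big_nil addr0; exact: gb_cst.
have -> : nrm (i :: S') = (fun x => `|x i| + nrm S' x).
  by apply/funext => x; rewrite /nrm big_cons addrCA.
apply: gbD; last by apply: IH => j jS; apply: H; rewrite inE jS orbT.
have [c [e E]] := H i (mem_head _ _).
by exists c, e => x; rewrite normr_id.
Qed.

Lemma rd_comp S S' F (Phi : pt -> pt) :
  (forall i, i \in S' -> gb S Phi (fun x => x i)) -> rd S F ->
  rd S' (fun x => F (Phi x)).
Proof.
move=> /gb_nrm/gbW[c [e [c0 H]]] rF k; have [K FK] := rF (e * k)%N.
exists (K * c ^+ k) => x.
apply: (@le_trans _ _ (N1 (F (Phi x)) * (c * nrm S (Phi x) ^+ e) ^+ k)).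
  apply: ler_wpM2l; first exact: N1_ge0.
  rewrite lerXn2r ?nnegrE ?(ltW (nrm_gt0 _ _)) ?mulr_ge0 ?exprn_ge0 ?(ltW (nrm_gt0 _ _))//.
  by apply: le_trans (H x); rewrite ler_norm.
rewrite exprMn -exprM mulrCA mulrC; apply: ler_wpM2r; first exact: exprn_ge0.
exact: FK.
Qed.

Lemma cr_comp S S' F (Phi : pt -> pt) : (forall j, scR (fun x => Phi x j)) ->
  (forall i, i \in S' -> gb S Phi (fun x => x i)) -> cr S F ->
  cr S' (fun x => F (Phi x)).
Proof. by move=> cP gP [cF rF]; split; [exact: sc_comp|exact: rd_comp rF]. Qed.

Lemma crS S S' F : {subset S' <= S} -> cr S F -> cr S' F.
Proof.
move=> SS [cF rF]; split=> //; apply: (@rd_comp S S' F id) => // i iS.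
exact/gb_coord/SS.
Qed.

Lemma crM S F G B : sc G -> (forall x, N1 (G x) <= B) -> cr S F ->
  cr S (fun x => G x * F x).
Proof.
move=> cG GB [cF rF]; split; first exact: scM.
move=> k; have [K FK] := rF k; exists (B * K) => x.
apply: le_trans (ler_wpM2r _ (N1M _ _)) _.
  by rewrite exprn_ge0// ltW// nrm_gt0.
rewrite -mulrA; apply: ler_pM => //; first exact: N1_ge0.
by rewrite mulr_ge0 ?N1_ge0// exprn_ge0// ltW// nrm_gt0.
Qed.

Lemma cr_psiM S F g : scR g -> cr S F -> cr S (fun x => psi (g x) * F x).
Proof. by move=> cg; apply: (@crM _ _ _ 2); [exact: sc_psi|move=> x; exact: N1_psi]. Qed.
Lemma cr_cstM S F (c : C) : cr S F -> cr S (fun x => c * F x).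
Proof. by apply: crM => //; exact: sc_cst. Qed.

Lemma nrm_cons_upd S x i t : i \notin S -> nrm (i :: S) (upd x i t) = nrm S x + `|t|.
Proof.
move=> iS; rewrite /nrm big_cons upd_same -addrA [X in _ + X]addrC; congr (_ + (_ + _)).
by apply: eq_big_seq => j jS; rewrite upd_other//; apply: contraNneq iS => <-.
Qed.

(** Of the [k + 2] orders of decay, two are spent on the variable [i], where they yield
    [1 / (1 + t^2)]; the other [k] remain with the variables of [S]. *)
Lemma cr_slice S F i k : i \notin S -> cr (i :: S) F ->
  exists K, 0 <= K /\ forall x, tameC (K / nrm S x ^+ k) (fun t => F (upd x i t)).
Proof.
move=> iS [cF rF]; have [K FK] := rF (k + 2)%N.
exists `|K|; split=> // x; split; [exact: (sc_slice x i cF).1|exact: (sc_slice x i cF).2|].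
move=> t; have n0 := nrm_gt0 S x.
rewrite -mulrA -invfM ler_pdivlMr ?mulr_gt0 ?exprn_gt0 ?oneDsqr_gt0//.
apply: le_trans (ler_norm _); apply: le_trans (FK (upd x i t)).
apply: ler_wpM2l; first exact: N1_ge0.
rewrite nrm_cons_upd// exprD; apply: ler_pM.
- by rewrite exprn_ge0// ltW.
- exact/ltW/oneDsqr_gt0.
- apply: lerXn2r; rewrite ?nnegrE; first exact: ltW.
    by apply: addr_ge0 => //; exact: ltW.
  by rewrite lerDl.
- have n1 := nrm_ge1 S x; rewrite /oneDsqr -(real_normK (num_real t)).
  have := normr_ge0 t; nra.
Qed.

Lemma cr_tame S F i x : i \in S -> cr S F -> exists K, tameC K (fun t => F (upd x i t)).
Proof.
move=> iS cF; have cF' : cr [:: i] F by apply: crS cF => j; rewrite inE => /eqP ->.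
have [K [K0 H]] := @cr_slice [::] F i 0 isT cF'.
by exists (K / nrm [::] x ^+ 0).
Qed.

Definition I_ (i : I) F : pt -> C := fun x => intC (fun t => F (upd x i t)).
Definition IL s F : pt -> C := foldr I_ F s.
Definition FT (i : I) F : pt -> C :=
  fun x => intC (fun t => psi (- x i * t) * F (upd x i t)).
Definition FTL s F : pt -> C := foldr FT F s.

(** A general frequency [g] covers the partial Fourier transform ([g x = - x i]) and the plain
    integral ([g = 0]) at once; the bounds do not see [g], as [psi] is bounded. The variable [i]
    leaves the list: decay in the frequency is a matter for [good]. *)
Lemma cr_FTgen S F i (g : pt -> R) : i \notin S -> scR g -> cr (i :: S) F ->
  cr S (fun x => intC (fun t => psi (g x * t) * F (upd x i t))).
Proof.
move=> iS cg cF; split.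
  have [K [K0 H]] := cr_slice 0 iS cF.
  move=> x_ x xx; apply: (@tameC_cvg _ (2 * K)) => [n|t].
    by apply: tameC_psiM; have := H (x_ n); rewrite expr0 invr1 mulr1.
  apply: cvgCM.
    apply: (@sc_psi (fun x => g x * t)) => //.
    by apply: scRM => //; exact: scR_cst.
  by apply: cF.1; apply: cvg_pt_upd => //; exact: cvg_cst.
move=> k; have [K [K0 H]] := cr_slice k iS cF.
exists (2 * K * (2 * pi)) => x.
have := tameC_le_intC (tameC_psiM hbar (g x) (H x)).
have n0 : 0 < nrm S x ^+ k by rewrite exprn_gt0// nrm_gt0.
rewrite -(ler_pM2r n0) => /le_trans; apply.
move: (nrm S x ^+ k) n0 => w w0; rewrite le_eqVlt; apply/orP; left; apply/eqP.
by field; rewrite gt_eqF.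
Qed.

Lemma cr_FT S F i : i \notin S -> cr (i :: S) F -> cr S (FT i F).
Proof. by move=> iS cF; apply: cr_FTgen => //; apply: scRN; exact: scR_coord. Qed.

Lemma cr_I S F i : i \notin S -> cr (i :: S) F -> cr S (I_ i F).
Proof.
move=> iS cF; have := cr_FTgen iS (@scR_cst 0) cF; congr (cr _ _).
by apply/funext => x; apply: eq_intC => t; rewrite mul0r psi0 mul1r.
Qed.

Lemma cr_IL s S F : uniq (s ++ S) -> cr (s ++ S) F -> cr S (IL s F).
Proof.
elim: s S => [//|i s IH] S /= /andP[iS uS] cF; apply: cr_I.
  by apply: contra iS; rewrite mem_cat => ->; rewrite orbT.
apply: IH.
  by rewrite (perm_uniq (permEl (perm_catCA s [:: i] S))) /= iS uS.
by apply: crS cF => j; rewrite !(mem_cat, inE) orbCA.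
Qed.

Lemma cr_FTL s S F : uniq (s ++ S) -> cr (s ++ S) F -> cr S (FTL s F).
Proof.
elim: s S => [//|i s IH] S /= /andP[iS uS] cF; apply: cr_FT.
  by apply: contra iS; rewrite mem_cat => ->; rewrite orbT.
apply: IH.
  by rewrite (perm_uniq (permEl (perm_catCA s [:: i] S))) /= iS uS.
by apply: crS cF => j; rewrite !(mem_cat, inE) orbCA.
Qed.

Lemma FTgen_comm F i j (a b : R) x : i != j -> cr [:: i; j] F ->
  intC (fun t => psi (a * t) * intC (fun u => psi (b * u) * F (upd (upd x i t) j u))) =
  intC (fun u => psi (b * u) * intC (fun t => psi (a * t) * F (upd (upd x j u) i t))).
Proof.
move=> ij cF.
have cFj y : exists K, tameC K (fun t => F (upd y j t)).
  by apply: cr_tame cF; rewrite !inE eqxx orbT.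
have cFi y : exists K, tameC K (fun t => F (upd y i t)).
  by apply: cr_tame cF; rewrite !inE eqxx.
transitivity (intC (fun t => intC (fun u => psi (a * t) * (psi (b * u) * F (upd (upd x i t) j u))))).
  apply: eq_intC => t; have [K HK] := cFj (upd x i t).
  by rewrite (intCZ _ (tameC_psiM hbar b HK)).
transitivity (intC (fun u => intC (fun t => psi (b * u) * (psi (a * t) * F (upd (upd x j u) i t))))); last first.
  apply: eq_intC => u; have [K HK] := cFi (upd x j u).
  by rewrite (intCZ _ (tameC_psiM hbar a HK)).
have E t u : psi (a * t) * (psi (b * u) * F (upd (upd x i t) j u)) =
    psi (b * u) * (psi (a * t) * F (upd (upd x j u) i t)).
  by rewrite mulrCA updC.
(* Four orders of decay give two for each of [t] and [u]; the factor [4] in the Fubini bound comes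
   from [N1 (psi _) <= 2], used twice. *)
have [K FK] := cF.2 4%N.
have c1 u : exists K, tameC K (fun t => psi (a * t) * (psi (b * u) * F (upd (upd x i t) j u))).
  have [L HL] := cFi (upd x j u).
  have := tameC_cstM (psi (b * u)) (tameC_psiM hbar a HL).
  by eexists; move: H; congr tameC; apply/funext => t; rewrite E.
have c2 t : exists K, tameC K (fun u => psi (a * t) * (psi (b * u) * F (upd (upd x i t) j u))).
  have [L HL] := cFj (upd x i t).
  by eexists; exact: (tameC_cstM (psi (a * t)) (tameC_psiM hbar b HL)).
rewrite (@intC_Fubini _ _ (4 * `|K|)).
- by apply: eq_intC => u; apply: eq_intC => t; rewrite E.
- by move=> u; have [L []] := c1 u.
- by move=> u; have [L []] := c1 u.
- by move=> t; have [L []] := c2 t.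
- by move=> t; have [L []] := c2 t.
- move=> t u; rewrite -mulrA -invfM ler_pdivlMr ?mulr_gt0 ?oneDsqr_gt0//.
  have := FK (upd (upd x i t) j u).
  rewrite /nrm !big_cons big_nil upd_same upd_other// upd_same addr0 => H.
  apply: (@le_trans _ _ (4 * N1 (F (upd (upd x i t) j u)) * (oneDsqr t * oneDsqr u))).
    apply: ler_wpM2r; first by rewrite mulr_ge0// ltW// oneDsqr_gt0.
    apply: le_trans (N1M _ _) _.
    apply: (@le_trans _ _ (2 * (2 * N1 (F (upd (upd x i t) j u))))); last by rewrite mulrA -natrM.
    apply: ler_pM; rewrite ?N1_ge0 ?N1_psi//.
    apply: le_trans (N1M _ _) _; apply: ler_pM; rewrite ?N1_ge0 ?N1_psi//.
  rewrite -mulrA; apply: ler_wpM2l => //; apply: le_trans (ler_norm _).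
  apply: le_trans H; apply: ler_wpM2l; first exact: N1_ge0.
  rewrite (exprD _ 2 2); apply: ler_pM; try exact/ltW/oneDsqr_gt0.
    rewrite /oneDsqr -(real_normK (num_real t)); have := normr_ge0 t; have := normr_ge0 u; nra.
  rewrite /oneDsqr -(real_normK (num_real u)); have := normr_ge0 t; have := normr_ge0 u; nra.
Qed.

Lemma FT_comm F i j : i != j -> cr [:: i; j] F -> FT i (FT j F) = FT j (FT i F).
Proof.
move=> ij cF; apply/funext => x.
have E1 t : upd x i t j = x j by rewrite upd_other// eq_sym.
have E2 t : upd x j t i = x i by rewrite upd_other.
have := FTgen_comm (- x i) (- x j) x ij cF; rewrite /FT.
move=> H; transitivity (intC (fun t => psi (- x i * t) *
    intC (fun u => psi (- x j * u) * F (upd (upd x i t) j u)))).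
  congr (intC _); apply/funext => t; congr (_ * intC _); apply/funext => u.
  by congr (psi (- _ * _) * _); exact: E1.
rewrite H; congr (intC _); apply/funext => t; congr (_ * intC _); apply/funext => u.
by rewrite E2.
Qed.

Lemma I_comm F i j : i != j -> cr [:: i; j] F -> I_ i (I_ j F) = I_ j (I_ i F).
Proof.
move=> ij cF; apply/funext => x.
have := FTgen_comm 0 0 x ij cF; rewrite /I_.
have e (f : R -> C) : intC (fun t => psi (0 * t) * f t) = intC f.
  by apply: eq_intC => t; rewrite mul0r psi0 mul1r.
rewrite !e; under [in X in X = _ -> _]eq_intC do rewrite e.
by under [in X in _ = X -> _]eq_intC do rewrite e.
Qed.

(** The head of one list is moved to the front of the other by exchanging neighbours, and the tails
    are handled by induction. The operator is generic so that integration and Fourier transform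
    share the argument. *)
Lemma foldr_perm (op : I -> (pt -> C) -> pt -> C) :
  (forall s S F, uniq (s ++ S) -> cr (s ++ S) F -> cr S (foldr op F s)) ->
  (forall F i j, i != j -> cr [:: i; j] F -> op i (op j F) = op j (op i F)) ->
  forall s s' F, perm_eq s s' -> uniq s -> cr s F -> foldr op F s = foldr op F s'.
Proof.
move=> cop opC.
have front i s1 s2 F : uniq (s1 ++ i :: s2) -> cr (s1 ++ i :: s2) F ->
    foldr op F (s1 ++ i :: s2) = foldr op F (i :: s1 ++ s2).
  elim: s1 => [//|j s1 IH] /= /andP[js us] cF.
  rewrite IH //; last by apply: crS cF => k ks; rewrite inE ks orbT.
  have uis : uniq (i :: s1 ++ s2).
    by move: us; rewrite (perm_uniq (permEl (perm_catCA s1 [:: i] s2))).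
  have ji : j != i by apply: contraNneq js => ->; rewrite mem_cat mem_head orbT.
  rewrite /= opC//; apply: (cop (s1 ++ s2)).
    have -> : uniq ((s1 ++ s2) ++ [:: j; i]) = uniq (j :: i :: s1 ++ s2).
      by rewrite uniq_catC.
    rewrite cons_uniq uis andbT inE (negPf ji) /=.
    by apply: contra js; rewrite !mem_cat inE; case/orP => ->; rewrite ?orbT.
  apply: crS cF => k; rewrite !(mem_cat, inE).
  by case/orP => [/orP[]->|/orP[]->]; rewrite ?orbT.
elim=> [|i s IH] s' F ss.
  by have /perm_size := ss; rewrite -(perm_nilP (etrans (perm_sym _ _) ss)).
have is' : i \in s' by rewrite -(perm_mem ss) mem_head.
case/splitPr: is' ss => s1 s2 ss us cF.
have us' : uniq (s1 ++ i :: s2) by rewrite -(perm_uniq ss).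
rewrite front//; last by apply: crS cF => k; rewrite (perm_mem ss).
rewrite /= (IH (s1 ++ s2))//.
- rewrite -(perm_cons i); apply: perm_trans ss _.
  exact: permEl (perm_catCA s1 [:: i] s2).
- by case/andP: us.
- by apply: crS cF => k ks; rewrite inE ks orbT.
Qed.

Lemma IL_perm s s' F : perm_eq s s' -> uniq s -> cr s F -> IL s F = IL s' F.
Proof. by apply: foldr_perm; [exact: cr_IL|exact: I_comm]. Qed.
Lemma FTL_perm s s' F : perm_eq s s' -> uniq s -> cr s F -> FTL s F = FTL s' F.
Proof. by apply: foldr_perm; [exact: cr_FTL|exact: FT_comm]. Qed.
Lemma IL_cat s s' F : IL (s ++ s') F = IL s (IL s' F).
Proof. exact: foldr_cat. Qed.
Lemma FTL_cat s s' F : FTL (s ++ s') F = FTL s (FTL s' F).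
Proof. exact: foldr_cat. Qed.

Lemma ILZ s F (c : pt -> C) : uniq s -> cr s F ->
  (forall x i t, i \in s -> c (upd x i t) = c x) ->
  IL s (fun x => c x * F x) = fun x => c x * IL s F x.
Proof.
elim: s => [//|i s IH] /= /andP[iS us] cF cc.
rewrite IH//; last by move=> x j t js; apply: cc; rewrite inE js orbT.
  apply/funext => x; rewrite /I_.
  have : cr [:: i] (IL s F).
    apply: cr_IL; first by rewrite uniq_catC /= iS us.
    by apply: crS cF => j; rewrite mem_cat !inE orbC.
  move/(cr_tame x (mem_head _ _)) => [K HK].
  by rewrite -(intCZ _ HK); apply: eq_intC => t; rewrite cc// mem_head.
by apply: crS cF => j js; rewrite inE js orbT.
Qed.

Fixpoint upds x s (ts : seq R) : pt :=
  match s, ts with i :: s', t :: ts' => upds (upd x i t) s' ts' | _, _ => x end.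

Lemma upds_notin x s ts j : j \notin s -> upds x s ts j = x j.
Proof.
elim: s x ts => [|i s IH] x [|t ts] //=; rewrite inE negb_or => /andP[ji js].
by rewrite IH// upd_other.
Qed.

End Slots.
Arguments IL {R I} s F x : simpl never.
Arguments FTL {R} hbar {I} s F x : simpl never.

Section IL_transfer.
Variables (R : realType) (I J : eqType).

(* [I] and [J] are distinct so that the variables of integration can be renamed. *)
Lemma IL_eq (s : seq I) (s' : seq J) (F : (I -> R) -> R[i]) (F' : (J -> R) -> R[i]) x x' :
  size s = size s' ->
  (forall ts, size ts = size s -> F (upds x s ts) = F' (upds x' s' ts)) ->
  IL s F x = IL s' F' x'.
Proof.
elim: s s' x x' => [|i s IH] [|i' s'] x x' //=; first by move=> _ /(_ [::]); exact.
move=> [ss] H.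
apply: eq_intC => t; apply: IH => // ts tss.
by apply: (H (t :: ts)); rewrite /= tss.
Qed.

End IL_transfer.

Section SlotChange.
Variables (R : realType) (hbar : R).
Hypothesis hbar0 : hbar != 0.
Variable I : eqType.
Local Notation C := R[i].
Local Notation pt := (I -> R).
Local Notation psi := (@psi R hbar).
Local Notation FT := (@FT R hbar I).
Local Notation FTL := (@FTL R hbar I).
Implicit Types (x y z : pt) (F G : pt -> C) (s S T : seq I).

Lemma IL_cons i s F x : IL (i :: s) F x = intC (fun t => IL s F (upd x i t)).
Proof. by []. Qed.

Lemma IL_ext s F G x : (forall ts, size ts = size s -> F (upds x s ts) = G (upds x s ts)) ->
  IL s F x = IL s G x.
Proof. by move=> H; apply: IL_eq. Qed.

Lemma IL_upd_notin s F x i t : i \notin s ->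
  IL s F (upd x i t) = IL s (fun y => F (upd y i t)) x.
Proof.
elim: s x => [//|j s IH] x; rewrite inE negb_or => /andP[ij is_].
rewrite /IL /= -/(IL s F) -/(IL s (fun y => F (upd y i t))) /I_.
by apply: eq_intC => u; rewrite updC// IH.
Qed.

Definition tri s (c : I -> R) (g : I -> pt -> R) : pt -> pt :=
  fun y j => if j \in s then c j * y j + g j y else y j.

(* [g i] may depend only on the variables that precede [i] in [s] or lie outside [s]. *)
Fixpoint triangular s (g : I -> pt -> R) : Prop :=
  if s is i :: s' then
    (forall j y t, j \in s -> g i (upd y j t) = g i y) /\ triangular s' g
  else True.

Lemma invariant_agree (A : Type) s (g : pt -> A) y y' :
  (forall j y t, j \in s -> g (upd y j t) = g y) ->
  (forall j, j \notin s -> y j = y' j) -> g y = g y'.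
Proof.
elim: s y => [|i s IH] y inv agr; first by congr g; apply/funext => j; exact: agr.
rewrite -(inv i y (y' i) (mem_head _ _)); apply: IH.
  by move=> j z t js; apply: inv; rewrite inE js orbT.
move=> j js; rewrite /upd; case: eqP => [->//|/eqP ji]; apply: agr.
by rewrite inE negb_or ji.
Qed.

Lemma IL_tri s (c : I -> R) (g : I -> pt -> R) F x : uniq s ->
  (forall i, i \in s -> c i != 0) -> (forall i, i \in s -> scR (g i)) ->
  triangular s g -> cr s F ->
  IL s F x = (\prod_(i <- s) `|c i|)%:C * IL s (fun y => F (tri s c g y)) x.
Proof.
elim: s F x => [|i s IH] F x.
  move=> _ _ _ _ _; rewrite /IL /= big_nil mul1r; congr F.
rewrite cons_uniq => /andP[iS us] c0 cg [gi tg] cF.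
have js j : j \in s -> j \in i :: s by move=> h; rewrite inE h orbT.
pose F1 y := F (upd y i (c i * y i + g i y)).
have gtri y : g i (tri s c g y) = g i y.
  apply: (@invariant_agree _ s) => [j z t jS|j jS]; first exact/gi/js.
  by rewrite /tri (negPf jS).
have E1 y : F (tri (i :: s) c g y) = F1 (tri s c g y).
  rewrite /F1 gtri; congr F; apply/funext => j; rewrite /upd /tri inE.
  by case: eqP => [->|//] /=; rewrite (negPf iS).
have cF1 : cr s F1.
  apply: (@cr_comp _ _ (i :: s) s F) cF => [j|j jS].
    rewrite /upd; case: (j == i); last exact: scR_coord.
    apply: scRD; last exact/cg/mem_head.
    by apply: scRM; [exact: scR_cst|exact: scR_coord].
  exists 1, 1%N => y; rewrite mul1r expr1; apply: le_trans (nrm_coord _ (js _ jS)).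
  by rewrite upd_other//; apply: contraNneq iS => <-.
pose P := (\prod_(j <- s) `|c j|).
have P0 : P != 0.
  rewrite /P prodf_seq_neq0; apply/allP => j jS; apply/implyP => _.
  by rewrite normr_eq0; exact/c0/js.
have E2 t : IL s (fun y => F (tri (i :: s) c g y)) (upd x i t) =
    (P^-1)%:C * IL s F (upd x i (c i * t + g i x)).
  have -> : IL s F (upd x i (c i * t + g i x)) = IL s F1 (upd x i t).
    rewrite !IL_upd_notin//; apply: IL_ext => ts sts; rewrite /F1 upd_upd upd_same.
    rewrite gi ?mem_head//; congr (F (upd _ _ (_ + _))).
    by apply: (@invariant_agree _ s) => [j z u jS|j jS]; [exact/gi/js|rewrite upds_notin].
  rewrite (IH F1)//; [|by move=> j jS; exact/c0/js|by move=> j jS; exact/cg/js].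
  rewrite mulrA -rmorphM mulVf// mul1r.
  by congr (IL s _ _); apply/funext => y; rewrite E1.
have [K HK] : exists K, tameC K (fun t => IL s F (upd x i t)).
  apply: (@cr_tame _ _ [:: i]); rewrite ?mem_head//; apply: (cr_IL hbar).
    by rewrite uniq_catC /= iS us.
  by apply: crS cF => j; rewrite mem_cat !inE orbC.
rewrite big_cons -/P /IL /= -/(IL s _) -/(IL s _) /I_.
transitivity ((P * `|c i|)%:C * intC (fun t => (P^-1)%:C * IL s F (upd x i (c i * t + g i x)))); last first.
  by rewrite [X in X%:C * _]mulrC; congr (_ * _); apply: eq_intC => t; rewrite E2.
rewrite rmorphM -mulrA.
have := @intC_affine _ _ _ (c i) (g i x) (c0 _ (mem_head _ _)) (tameC_cstM (P^-1)%:C HK).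
move=> ->; rewrite (intCZ _ HK) mulrA -rmorphM divff// mul1r.
by [].
Qed.

Lemma FTL_IL s F z : uniq s -> cr s F ->
  FTL s F z = IL s (fun x => psi (- (\sum_(i <- s) z i * x i)) * F x) z.
Proof.
elim: s z => [|i s IH] z; first by rewrite /FTL /IL /= big_nil oppr0 psi0 mul1r.
rewrite cons_uniq => /andP[iS us] cF.
have cFs : cr s F by apply: crS cF => j js; rewrite inE js orbT.
rewrite /FTL /IL /= -/(FTL s F) -/(IL s _) /FT /I_.
apply: eq_intC => t; rewrite IH//.
pose G y := psi (- (\sum_(j <- s) upd z i t j * y j)) * F y.
have cG : cr s G.
  by apply: cr_psiM => //; apply/scRN/scR_sum => j _; apply: scRM; [exact: scR_cst|exact: scR_coord].
have cc (y : pt) j (u : R) : j \in s -> psi (- z i * upd y j u i) = psi (- z i * y i).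
  by move=> js; rewrite upd_other//; apply: contraNneq iS => ->.
have := ILZ hbar (c := fun y => psi (- z i * y i)) us cG cc.
move=> /(congr1 (fun f => f (upd z i t))) /=; rewrite upd_same => <-.
congr (IL s _ _); apply/funext => y; rewrite /G mulrA -psiD big_cons; congr (psi _ * _).
rewrite opprD mulNr; congr (_ - _); apply: eq_big_seq => j js.
by rewrite upd_other//; apply: contraNneq iS => <-.
Qed.

Lemma FT_I_comm F i j : i != j -> cr [:: i; j] F -> FT i (I_ j F) = I_ j (FT i F).
Proof.
move=> ij cF; apply/funext => x.
have E2 t : upd x j t i = x i by rewrite upd_other.
have := FTgen_comm hbar (- x i) 0 x ij cF.
have e (f : R -> C) : intC (fun t => psi (0 * t) * f t) = intC f.
  by apply: eq_intC => t; rewrite mul0r psi0 mul1r.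
rewrite e => H; rewrite [RHS]/I_ [in RHS]/FT.
transitivity (intC (fun u => intC (fun t => psi (- x i * t) * F (upd (upd x j u) i t)))).
  by rewrite -H; congr (intC _); apply/funext => t; rewrite e.
congr (intC _); apply/funext => t; congr (intC _); apply/funext => u.
by rewrite E2.
Qed.

Lemma FT_IL_comm s F i : uniq s -> i \notin s -> cr (i :: s) F ->
  FT i (IL s F) = IL s (FT i F).
Proof.
elim: s => [//|j s IH]; rewrite cons_uniq inE negb_or => /andP[js us] /andP[ij is_] cF.
have E (G : pt -> C) : IL (j :: s) G = I_ j (IL s G) by [].
rewrite !E -IH//; last first.
  by apply: crS cF => l; rewrite !inE => /orP[->//|->]; rewrite !orbT.
apply: FT_I_comm => //; apply: (cr_IL hbar); last first.
  by apply: crS cF => l; rewrite !(mem_cat, inE); case/orP => [->|/orP[]->]; rewrite ?orbT.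
by rewrite uniq_catC /= inE (negPf ij) is_ js us.
Qed.

Lemma FTL_inv_mul s F (c : pt -> C) : uniq s -> cr s F ->
  (forall x i t, i \in s -> c (upd x i t) = c x) ->
  FTL s (fun x => c x * F x) = fun x => c x * FTL s F x.
Proof.
elim: s => [//|i s IH]; rewrite cons_uniq => /andP[iS us] cF cc.
have E (G : pt -> C) : FTL (i :: s) G = FT i (FTL s G) by [].
rewrite !E IH//; [|by apply: crS cF => j js; rewrite inE js orbT|by move=> x j t js; apply: cc; rewrite inE js orbT].
apply/funext => x.
have : cr [:: i] (FTL s F).
  apply: cr_FTL; first by rewrite uniq_catC /= iS us.
  by apply: crS cF => j; rewrite mem_cat !inE orbC.
move/(cr_tame x (mem_head _ _)) => [K HK].
rewrite /FT -(intCZ _ (tameC_psiM hbar (- x i) HK)).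
by congr (intC _); apply/funext => t; rewrite cc ?mem_head// mulrCA.
Qed.

Lemma FTLZ s F (c : C) : uniq s -> cr s F ->
  FTL s (fun x => c * F x) = fun x => c * FTL s F x.
Proof. by move=> us cF; exact: (FTL_inv_mul (c := fun=> c)). Qed.

(** Decay is required in all variables of [S], including those already transformed. This takes the
    place of the Schwartz condition: it allows Fourier inversion and can be propagated along the
    elimination without derivatives. *)
Definition good S F := forall T, uniq T -> {subset T <= S} -> cr S (FTL T F).

Lemma good_cr S F : good S F -> cr S F. Proof. by move=> /(_ [::]); apply. Qed.

Lemma good_FTL S T F : uniq T -> {subset T <= S} -> good S F ->
  forall T', uniq (T' ++ T) -> {subset T' <= S} -> cr S (FTL T' (FTL T F)).
Proof.
move=> uT TS gF T' uT' T'S; rewrite -FTL_cat; apply: gF => // j.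
by rewrite mem_cat => /orP[/T'S|/TS].
Qed.

(** The inner variables are inverted by induction for the function already transformed in [i], which
    leaves one-dimensional inversion in [i]. Goodness gives the decay of the function and of its
    transform that the latter needs. *)
Lemma FTL_inv s F (c : pt) x : uniq s -> good s F ->
  ((`|hbar| / (2 * pi)) ^+ size s)%:C *
    IL s (fun y => psi (\sum_(i <- s) c i * y i) * FTL s F y) x =
  F (fun j => if j \in s then c j else x j).
Proof.
elim: s F x => [|i s IH] F x us gF.
  by rewrite /FTL /IL /= expr0 mul1r big_nil psi0 mul1r.
move: us; rewrite cons_uniq => /andP[iS us].
have ss : {subset s <= i :: s} by move=> j js; rewrite inE js orbT.
have gi : good s (FT i F).
  move=> T uT TS; have -> : FTL T (FT i F) = FTL (rcons T i) F by rewrite /FTL -foldr_rcons.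
  apply: crS ss _; apply: gF.
    by rewrite rcons_uniq uT andbT; apply: contra iS => /TS.
  by move=> j; rewrite mem_rcons !inE => /orP[->//|/TS ->]; rewrite orbT.
have E : FTL (i :: s) F = FTL s (FT i F).
  have -> : FTL s (FT i F) = FTL (rcons s i) F by rewrite /FTL -foldr_rcons.
  apply: FTL_perm; rewrite ?cons_uniq ?iS//; first by rewrite perm_sym perm_rcons.
  exact: good_cr gF.
pose q : C := ((`|hbar| / (2 * pi)) ^+ size s)%:C.
have -> : ((`|hbar| / (2 * pi)) ^+ size (i :: s))%:C = (`|hbar| / (2 * pi))%:C * q.
  by rewrite [size _]/= exprS rmorphM.
rewrite E IL_cons -mulrA.
have E2 t : q * IL s (fun y => psi (\sum_(j <- i :: s) c j * y j) * FTL s (FT i F) y) (upd x i t) =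
    psi (c i * t) * FT i F (upd (fun j => if j \in s then c j else x j) i t).
  pose G y := psi (\sum_(j <- s) c j * y j) * FTL s (FT i F) y.
  have cG : cr s G.
    apply: cr_psiM; last exact: gi.
    by apply/scR_sum => j _; apply: scRM; [exact: scR_cst|exact: scR_coord].
  have cc (y : pt) j (u : R) : j \in s -> psi (c i * upd y j u i) = psi (c i * y i).
    by move=> js; rewrite upd_other//; apply: contraNneq iS => ->.
  have := ILZ hbar (c := fun y => psi (c i * y i)) us cG cc.
  move=> /(congr1 (fun f => f (upd x i t))) /=; rewrite upd_same => H.
  transitivity (q * (psi (c i * t) * IL s G (upd x i t))).
    rewrite -H; congr (_ * IL s _ _); apply/funext => y.
    by rewrite /G mulrA -psiD big_cons.
  rewrite mulrCA (IH _ _ us gi); congr (_ * FT i F _).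
  by apply/funext => j; rewrite /upd; case: eqP => [->|//]; rewrite (negPf iS).
have ci : cr [:: i] F by apply: crS (good_cr gF) => j; rewrite !inE => ->.
have ci' : cr [:: i] (FT i F).
  by apply: crS (gF [:: i] isT _) => j; rewrite !inE => ->.
pose xc := (fun j => if j \in s then c j else x j).
have [K HK] := cr_tame xc (mem_head i [::]) ci.
have [K' HK'] := cr_tame xc (mem_head i [::]) ci'.
have FTE (z : R) : FT i F (upd xc i z) = intC (fun t => psi (- z * t) * F (upd xc i t)).
  rewrite /FT upd_same; apply: eq_intC => t; rewrite upd_upd.
  by [].
have HK2 : tameC K' (fun z : R => intC (fun t => psi (- z * t) * F (upd xc i t))).
  by move: HK'; congr tameC; apply/funext => z; exact: FTE.
have [L HL] : exists L, tameC L (fun t => IL s (fun y => psi (\sum_(j <- i :: s) c j * y j) *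
    FTL s (FT i F) y) (upd x i t)).
  apply: (@cr_tame _ _ [:: i]); rewrite ?mem_head//; apply: (cr_IL hbar).
    by rewrite uniq_catC /= iS us.
  apply: cr_psiM.
    by apply/scR_sum => j _; apply: scRM; [exact: scR_cst|exact: scR_coord].
  rewrite -E; apply: (@crS _ _ (i :: s)); last by apply: gF; rewrite ?cons_uniq ?iS.
  by move=> j; rewrite mem_cat !inE orbC.
rewrite -(intCZ q HL).
have := fourier_inversion1 hbar0 (c i) HK HK2.
have -> : upd xc i (c i) = (fun j => if j \in i :: s then c j else x j).
  by apply/funext => j; rewrite /upd /xc inE; case: eqP => [->|].
move=> <-; congr (_ * _); apply: eq_intC => t; rewrite E2 FTE.
by [].
Qed.

(** For [M] the maximum of [1] and the [|x i|], the norm is at most [(1 + size S) M] and [M^k] is at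
    most [1 + sum |x i|^k], so decay may be checked in one coordinate at a time. *)
Lemma rd_of_coords S F : (exists K, forall x, N1 (F x) <= K) ->
  (forall i k, i \in S -> exists K, forall x, N1 (F x) * `|x i| ^+ k <= K) -> rd S F.
Proof.
move=> [K0 FK0] H k.
suff [K HK] : exists K, forall x, N1 (F x) * (1 + \sum_(i <- S) `|x i| ^+ k) <= K.
  exists (K * (1 + size S)%:R ^+ k) => x.
  apply: le_trans (ler_wpM2r _ (HK x)); last by rewrite exprn_ge0.
  rewrite -mulrA; apply: ler_wpM2l; first exact: N1_ge0.
  have [M [M0 HM MH]] : exists M, [/\ 1 <= M, forall i, i \in S -> `|x i| <= M &
      M ^+ k <= 1 + \sum_(i <- S) `|x i| ^+ k].
    elim: S {H HK} => [|i S [M [M1 HM MS]]].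
      by exists 1; split => //; rewrite expr1n big_nil addr0.
    exists (Num.max M `|x i|); split; first by rewrite le_max M1.
      move=> j; rewrite inE => /orP[/eqP ->|jS]; first by rewrite le_max lexx orbT.
      by rewrite le_max HM.
    rewrite big_cons; have [xM|xM] := leP `|x i| M.
      by apply: le_trans MS _; rewrite lerD2l lerDr exprn_ge0.
    by rewrite addrCA lerDl addr_ge0// sumr_ge0// => j _; rewrite exprn_ge0.
  have M0' : 0 <= M := le_trans ler01 M0.
  apply: (@le_trans _ _ ((1 + size S)%:R ^+ k * M ^+ k)); last first.
    by rewrite mulrC; apply: ler_wpM2r => //; rewrite exprn_ge0.
  rewrite -exprMn; apply: lerXn2r; rewrite ?nnegrE.
  - exact/ltW/nrm_gt0.
  - by rewrite mulr_ge0.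
  rewrite natrD mulrDl mul1r; apply: lerD => //.
  have : \sum_(i <- S) `|x i| <= \sum_(i <- S) M.
    by rewrite big_seq [leRHS]big_seq; apply: ler_sum.
  by move/le_trans; apply; rewrite big_const_seq count_predT iter_addr_0 mulr_natl.
have [K1 HK1] : exists K, forall x, N1 (F x) * (\sum_(i <- S) `|x i| ^+ k) <= K.
  elim: S H => [|i S IH] H; first by exists 0 => x; rewrite big_nil mulr0.
  have [K HK] := IH (fun j k' jS => H j k' (@mem_behead _ (i :: S) _ jS)).
  have [K' HK'] := H i k (mem_head _ _).
  by exists (K' + K) => x; rewrite big_cons mulrDr lerD.
by exists (K0 + K1) => x; rewrite mulrDr mulr1 lerD.
Qed.

(** Polynomials as a family of functions closed under the ring operations: continuity, growth,
    dependence on [A] alone and differentiability along curves each take one induction. *)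
Inductive polyf (A : pred I) : (pt -> R) -> Prop :=
| polyf_cst c : polyf A (fun=> c)
| polyf_coord i of A i : polyf A (fun x => x i)
| polyfD p q of polyf A p & polyf A q : polyf A (fun x => p x + q x)
| polyfM p q of polyf A p & polyf A q : polyf A (fun x => p x * q x).

Lemma polyfN A p : polyf A p -> polyf A (fun x => - p x).
Proof.
move=> Ap; have := polyfM (polyf_cst A (-1)) Ap; congr polyf.
by apply/funext => x; rewrite mulN1r.
Qed.

Lemma polyf_sum (J : Type) (r : seq J) A (P : pred J) (g : J -> pt -> R) :
  (forall j, P j -> polyf A (g j)) -> polyf A (fun x => \sum_(j <- r | P j) g j x).
Proof.
move=> cg; elim: r => [|j r IH].
  by under eq_fun do rewrite big_nil; exact: polyf_cst.
under eq_fun do rewrite big_cons.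
by case: (boolP (P j)) => Pj //; apply: polyfD => //; exact: cg.
Qed.

Lemma polyf_scR A p : polyf A p -> scR p.
Proof.
by elim=> *; [exact: scR_cst|exact: scR_coord|exact: scRD|exact: scRM].
Qed.

Lemma polyf_gb (A : pred I) S Phi p : (forall i, A i -> i \in S) -> polyf A p ->
  gb S Phi (fun x => p (Phi x)).
Proof.
move=> AS; elim=> [c|i Ai|q r _ Hq _ Hr|q r _ Hq _ Hr].
- exact: gb_cst.
- exact/gb_coord/AS.
- exact: gbD.
- exact: gbM.
Qed.

Lemma polyf_agree (A : pred I) p x y : polyf A p -> (forall i, A i -> x i = y i) -> p x = p y.
Proof. by move=> Ap H; elim: Ap => [c|i /H|q r _ -> _ ->|q r _ -> _ ->]. Qed.

Lemma polyf_derivable (A : pred I) p (c : R -> pt) (t : R) : polyf A p ->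
  (forall i, A i -> derivable (fun u : R => c u i) t 1) ->
  derivable (fun u : R => p (c u)) t 1.
Proof.
move=> Ap H; elim: Ap => [k|i /H//|q r _ Hq _ Hr|q r _ Hq _ Hr].
- exact: derivable_cst.
- exact: derivableD.
- exact: derivableM.
Qed.

End SlotChange.

(** * Triangular factorizations in coordinates *)

Section LDU.
Variables (R : realType) (hbar : R).
Variables (n : nat) (b : nat -> R).
Local Notation C := R[i].
Local Notation sl := (nat * nat)%type.
Local Notation pt := (sl -> R).
Local Notation psi := (@psi R hbar).
Local Notation FT := (@FT R hbar sl).
Local Notation FTL := (@FTL R hbar sl).
Local Notation good := (@good R hbar sl).
Implicit Types (x y z : pt) (F G h : pt -> C) (s S T : seq sl) (k : nat).

Definition blk k : seq sl := [seq (i, j) | i <- index_iota k n, j <- index_iota k n].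
Definition row k : seq sl := [seq (k, j) | j <- index_iota k.+1 n].
Definition col k : seq sl := [seq (i, k) | i <- index_iota k.+1 n].
Definition off k : seq sl := [seq p <- blk k | p.1 != p.2].
Definition dg k : seq sl := [seq (i, i) | i <- index_iota k n].
Definition inb k (p : sl) := (k <= p.1 < n)%N && (k <= p.2 < n)%N.

Lemma mem_blk k p : (p \in blk k) = inb k p.
Proof.
apply/allpairsP/idP => [[[i j] /= [i_ j_ ->]]|/andP[]].
  by rewrite /inb /= -!mem_index_iota i_ j_.
by rewrite -!mem_index_iota => p1 p2; exists p; rewrite p1 p2; case: p {p1 p2}.
Qed.
Lemma mem_row k p : (p \in row k) = (p.1 == k) && (k < p.2 < n)%N.
Proof.
apply/mapP/andP => [[j + ->]|[/eqP pk pj]]; first by rewrite mem_index_iota eqxx.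
by exists p.2; rewrite ?mem_index_iota//; case: p pk {pj} => i j /= ->.
Qed.
Lemma mem_col k p : (p \in col k) = (p.2 == k) && (k < p.1 < n)%N.
Proof.
apply/mapP/andP => [[j + ->]|[/eqP pk pj]]; first by rewrite mem_index_iota eqxx.
by exists p.1; rewrite ?mem_index_iota//; case: p pk {pj} => i j /= ->.
Qed.
Lemma mem_off k p : (p \in off k) = (p.1 != p.2) && inb k p.
Proof. by rewrite mem_filter mem_blk. Qed.
Lemma mem_dg k p : (p \in dg k) = (p.1 == p.2) && (k <= p.1 < n)%N.
Proof.
apply/mapP/andP => [[j + ->]|[/eqP pk pj]]; first by rewrite mem_index_iota eqxx.
by exists p.1; rewrite ?mem_index_iota//; case: p pk {pj} => i j /= ->.
Qed.
Lemma uniq_blk k : uniq (blk k).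
Proof. by apply: allpairs_uniq; rewrite ?iota_uniq// => -[i j] [i' j'] _ _ /= []-> ->. Qed.
Lemma uniq_off k : uniq (off k).
Proof. exact/filter_uniq/uniq_blk. Qed.
Lemma uniq_row k : uniq (row k).
Proof. by rewrite map_inj_uniq ?iota_uniq// => i j []. Qed.
Lemma uniq_col k : uniq (col k).
Proof. by rewrite map_inj_uniq ?iota_uniq// => i j []. Qed.
Lemma uniq_dg k : uniq (dg k).
Proof. by rewrite map_inj_uniq ?iota_uniq// => i j []. Qed.

Lemma uniq_rc k : uniq (row k ++ col k).
Proof.
rewrite cat_uniq uniq_row uniq_col andbT /=; apply/hasPn => p.
by rewrite mem_col mem_row; lia.
Qed.

Lemma uniq_rcb k : uniq ((row k ++ col k) ++ blk k.+1).
Proof.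
rewrite cat_uniq uniq_rc uniq_blk andbT /=; apply/hasPn => -[i j].
by rewrite mem_blk mem_cat mem_col mem_row /inb /=; lia.
Qed.

Lemma perm_blk k : (k < n)%N ->
  perm_eq (blk k) ((k, k) :: (row k ++ col k) ++ blk k.+1).
Proof.
move=> kn; apply: uniq_perm; first exact: uniq_blk.
  rewrite cons_uniq uniq_rcb andbT !mem_cat mem_blk mem_col mem_row /inb /=; lia.
move=> [i j]; rewrite inE !mem_cat !mem_blk mem_col mem_row /inb /= xpair_eqE; lia.
Qed.

Lemma perm_off k : (k < n)%N ->
  perm_eq (off k) (off k.+1 ++ row k ++ col k).
Proof.
move=> kn; apply: uniq_perm; first exact: uniq_off.
  rewrite cat_uniq uniq_off uniq_rc andbT /=; apply/hasPn => -[i j].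
  by rewrite mem_off mem_cat mem_col mem_row /inb /=; lia.
by move=> [i j]; rewrite !mem_cat !mem_off mem_col mem_row /inb /=; lia.
Qed.

Lemma dg_cons k : (k < n)%N -> dg k = (k, k) :: dg k.+1.
Proof. by move=> kn; rewrite /dg /index_iota -{1}(subnSK kn). Qed.

(* A point [x] encodes triangular matrices with unit diagonal by its off-diagonal entries: on the
   indices [k <= i < n], [LDU k x] has the entries of a lower times a diagonal times an upper
   triangular matrix, the triangular factors being stored transposed, and [UDL k x] those of
   upper * diag b * lower.  Both maps fix the remaining coordinates. *)
Definition L1 x p q : R := if p == q then 1 else x (p, q).

Definition LDU k x : pt := fun p => if inb k p then
  \sum_(k <= q < n | ((q <= p.1) && (q <= p.2))%N) L1 x q p.1 * x (q, q) * L1 x p.2 q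
  else x p.
Definition UDL k x : pt := fun p => if inb k p then
  \sum_(k <= q < n | ((p.1 <= q) && (p.2 <= q))%N) L1 x p.1 q * b q * L1 x q p.2
  else x p.
(* [Yt k a [::]] is one step of Gaussian elimination, from [LDU k.+1] to [LDU k] with pivot [a];
   in the coordinates [T], which have been Fourier transformed, the translation is left out (it
   becomes a phase). *)
Definition Yt k (a : R) T x : pt := fun p =>
  if ~~ inb k p then x p else
  if p.1 == k then (if p.2 == k then a else a * x (p.2, k)) else
  if p.2 == k then a * x (k, p.1) else
  x p + (if p \in T then 0 else a * x (k, p.1) * x (p.2, k)).
(** The entry [(k, k)] is not transformed together with its row and column: it holds the pivot
    itself, and the entry [(k, k)] of [UDL] appears in a phase instead. *)
Definition Wt k (a : R) x : pt := fun p => if p == (k, k) then a else UDL k x p.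

Lemma scR_L1 p q : scR (fun x => L1 x p q).
Proof. by rewrite /L1; case: eqP => _; [exact: scR_cst|exact: scR_coord]. Qed.

Lemma scR_LDU k j : scR (fun x => LDU k x j).
Proof.
rewrite /LDU; case: (inb k j); last exact: scR_coord.
apply: scR_sum => q _; apply: scRM; last exact: scR_L1.
by apply: scRM; [exact: scR_L1|exact: scR_coord].
Qed.
Lemma scR_UDL k j : scR (fun x => UDL k x j).
Proof.
rewrite /UDL; case: (inb k j); last exact: scR_coord.
apply: scR_sum => q _; apply: scRM; last exact: scR_L1.
by apply: scRM; [exact: scR_L1|exact: scR_cst].
Qed.
Lemma scR_Yt k a T j : scR (fun x => Yt k a T x j).
Proof.
have c : scR (fun x => a * x (k, j.1)) by apply: scRM; [exact: scR_cst|exact: scR_coord].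
rewrite /Yt; case: (~~ inb k j); first exact: scR_coord.
case: (j.1 == k); first case: (j.2 == k); first exact: scR_cst.
  by apply: scRM; [exact: scR_cst|exact: scR_coord].
case: (j.2 == k); first exact: c.
apply: scRD; first exact: scR_coord.
case: (j \in T); first exact: scR_cst.
by apply: scRM; [exact: c|exact: scR_coord].
Qed.

Lemma UDL_upd k x p t : (forall i j, inb k (i, j) -> (i, j) != p) ->
  UDL k (upd x p t) = upd (UDL k x) p t.
Proof.
move=> kp; apply/funext => -[i j]; rewrite /UDL.
case: ifPn => kij; last by rewrite /upd; case: eqP => // _; rewrite (negPf kij).
rewrite upd_other ?kp// kij; apply: congr_big_nat => // q kq.
congr (_ * _ * _); rewrite /L1; case: eqP => // _; rewrite upd_other// kp//.
  by move: kij kq; rewrite /inb /=; lia.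
by move: kij kq; rewrite /inb /=; lia.
Qed.
Lemma LDU_upd k x p t : (forall i j, inb k (i, j) -> (i, j) != p) ->
  LDU k (upd x p t) = upd (LDU k x) p t.
Proof.
move=> kp; apply/funext => -[i j]; rewrite /LDU.
case: ifPn => kij; last by rewrite /upd; case: eqP => // _; rewrite (negPf kij).
rewrite upd_other ?kp// kij; apply: congr_big_nat => // q kq.
have kqq : inb k (q, q) by move: kij kq; rewrite /inb /=; lia.
rewrite (upd_other _ _ (kp _ _ kqq)).
congr (_ * _ * _); rewrite /L1; case: eqP => // _; rewrite upd_other// kp//.
  by move: kij kq; rewrite /inb /=; lia.
by move: kij kq; rewrite /inb /=; lia.
Qed.

Lemma upds_comm (Phi : pt -> pt) s x ts :
  (forall x p t, p \in s -> Phi (upd x p t) = upd (Phi x) p t) ->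
  Phi (upds x s ts) = upds (Phi x) s ts.
Proof.
move=> H; elim: s x ts H => [|p s IH] x [|t ts] H //=.
rewrite IH ?H ?mem_head// => y q u qs; apply: H; rewrite inE qs orbT//.
Qed.

Lemma IL_comm_map (Phi : pt -> pt) s F x :
  (forall x p t, p \in s -> Phi (upd x p t) = upd (Phi x) p t) ->
  IL s F (Phi x) = IL s (fun y => F (Phi y)) x.
Proof. by move=> H; apply: IL_eq => // ts _; rewrite upds_comm. Qed.

Lemma UDL_inv k : (forall i, (i < n)%N -> b i != 0) -> forall q i, (k <= i < q)%N -> (q < n)%N ->
  (exists p, polyf (fun r => (r \in off k)) p /\ forall x, x (i, q) = p (UDL k x)) /\
  (exists p, polyf (fun r => (r \in off k)) p /\ forall x, x (q, i) = p (UDL k x)).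
Proof.
move=> b0; suff H m : forall q i, (k <= i < q)%N -> (q < n)%N -> (n <= q + m)%N ->
  (exists p, polyf (fun r => (r \in off k)) p /\ forall x, x (i, q) = p (UDL k x)) /\
  (exists p, polyf (fun r => (r \in off k)) p /\ forall x, x (q, i) = p (UDL k x)).
  by move=> q i iq qn; apply: (H n) => //; rewrite leq_addl.
elim: m => [|m IH] q i iq qn nq; first by exfalso; lia.
have b_q := b0 _ qn.
have E1 x : x (i, q) = (b q)^-1 * (UDL k x (i, q) - \sum_(q.+1 <= r < n) x (i, r) * b r * x (r, q)).
  rewrite /UDL ifT; last by rewrite /inb /=; lia.
  rewrite (big_cat_nat (n := q)) ?(ltnW qn)//=; last by lia.
  rewrite big1_seq ?add0r; last by move=> r; rewrite mem_index_iota; lia.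
  rewrite big_ltn_cond//= leqnn andbT ifT; last lia.
  rewrite {2}/L1 eqxx mulr1 /L1 ifF; last lia.
  rewrite [X in _ + X - _](_ : _ = \sum_(q.+1 <= r < n) x (i, r) * b r * x (r, q)); last first.
    rewrite big_nat_cond [RHS]big_nat_cond; apply: eq_big => r; first lia.
    by move=> rq; rewrite !ifF//; lia.
  by rewrite addrK mulrC mulfK.
have E2 x : x (q, i) = (b q)^-1 * (UDL k x (q, i) - \sum_(q.+1 <= r < n) x (q, r) * b r * x (r, i)).
  rewrite /UDL ifT; last by rewrite /inb /=; lia.
  rewrite (big_cat_nat (n := q)) ?(ltnW qn)//=; last by lia.
  rewrite big1_seq ?add0r; last by move=> r; rewrite mem_index_iota; lia.
  rewrite big_ltn_cond//= leqnn ifT; last lia.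
  rewrite {1}/L1 eqxx mul1r /L1 ifF; last lia.
  rewrite [X in _ + X - _](_ : _ = \sum_(q.+1 <= r < n) x (q, r) * b r * x (r, i)); last first.
    rewrite big_nat_cond [RHS]big_nat_cond; apply: eq_big => r; first lia.
    by move=> rq; rewrite !ifF//; lia.
  by rewrite addrK mulKf.
have sub (u v : nat -> sl) :
    (forall r, (q < r < n)%N -> exists p, polyf (fun r => (r \in off k)) p /\ forall x, x (u r) = p (UDL k x)) ->
    (forall r, (q < r < n)%N -> exists p, polyf (fun r => (r \in off k)) p /\ forall x, x (v r) = p (UDL k x)) ->
    exists p, polyf (fun r => (r \in off k)) p /\
      forall x, \sum_(q.+1 <= r < n) x (u r) * b r * x (v r) = p (UDL k x).
  move=> Hu Hv.
  have : forall r, r \in index_iota q.+1 n -> (q < r < n)%N by move=> r; rewrite mem_index_iota.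
  elim: (index_iota q.+1 n) => [|r rs IHs] Hrs.
    by exists (fun=> 0); split=> [|x]; [exact: polyf_cst|rewrite big_nil].
  have qr := Hrs r (mem_head _ _).
  have [pu [Pu Eu]] := Hu r qr; have [pv [Pv Ev]] := Hv r qr.
  have [p [Pp Ep]] := IHs (fun r' r's => Hrs r' (@mem_behead _ (r :: rs) _ r's)).
  exists (fun y => pu y * b r * pv y + p y); split.
    by apply: polyfD => //; apply: polyfM => //; apply: polyfM => //; exact: polyf_cst.
  by move=> x; rewrite big_cons Ep Eu Ev.
have [p1 [P1 H1]] := sub (fun r => (i, r)) (fun r => (r, q))
  (fun r qr => (IH r i ltac:(lia) ltac:(lia) ltac:(lia)).1)
  (fun r qr => (IH r q ltac:(lia) ltac:(lia) ltac:(lia)).2).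
have [p2 [P2 H2]] := sub (fun r => (q, r)) (fun r => (r, i))
  (fun r qr => (IH r q ltac:(lia) ltac:(lia) ltac:(lia)).1)
  (fun r qr => (IH r i ltac:(lia) ltac:(lia) ltac:(lia)).2).
split.
  exists (fun y => (b q)^-1 * (y (i, q) + - p1 y)); split; last by move=> x; rewrite E1 H1.
  apply: polyfM; first exact: polyf_cst.
  apply: polyfD; last exact: polyfN.
  by apply: (@polyf_coord _ _ _ (i, q)); rewrite mem_off /inb /=; lia.
exists (fun y => (b q)^-1 * (y (q, i) + - p2 y)); split; last by move=> x; rewrite E2 H2.
apply: polyfM; first exact: polyf_cst.
apply: polyfD; last exact: polyfN.
by apply: (@polyf_coord _ _ _ (q, i)); rewrite mem_off /inb /=; lia.
Qed.

Lemma UDL_inv_off k p0 : (forall i, (i < n)%N -> b i != 0) -> p0 \in off k ->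
  exists p, polyf (fun r => (r \in off k)) p /\ forall x, x p0 = p (UDL k x).
Proof.
move=> b0; case: p0 => i j; rewrite mem_off /inb /= => H.
have [ij|ij] := ltnP i j; first by apply: (UDL_inv b0 _ _).1; lia.
by apply: (UDL_inv b0 _ _).2; lia.
Qed.

(** [cr] asks for bounds uniform in the variables outside its list, here the diagonal ones, while
    [LDU] stops being invertible where a diagonal entry vanishes. Freezing the diagonal at nonzero
    values restores uniformity. *)
Definition frz (d : nat -> R) x : pt := fun p => if p.1 == p.2 then d p.1 else x p.

Lemma L1_id x p : L1 x p p = 1. Proof. by rewrite /L1 eqxx. Qed.
Lemma frz_diag d x p : frz d x (p, p) = d p. Proof. by rewrite /frz /= eqxx. Qed.
Lemma L1_frz d x p q : p != q -> L1 (frz d x) p q = x (p, q).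
Proof. by move=> pq; rewrite /L1 (negPf pq) /frz /= (negPf pq). Qed.

(** Forward elimination, opposite in direction to [UDL_inv]: the entry [(i, q)] of [LDU] with
    [q < i] is [x (q, i) d_q] plus products of entries having an index [r < q]. *)
Lemma LDU_gb k (d : nat -> R) : (forall i, (k <= i < n)%N -> d i != 0) ->
  forall p0, p0 \in off k -> gb (blk k) (fun x => LDU k (frz d x)) (fun x => x p0).
Proof.
move=> d0.
have H q : forall i, (k <= q < i)%N -> (i < n)%N ->
    gb (blk k) (fun x => LDU k (frz d x)) (fun x => x (q, i)) /\
    gb (blk k) (fun x => LDU k (frz d x)) (fun x => x (i, q)).
  elim/ltn_ind: q => q IH i qi i_n.
  have dq : d q != 0 by apply: d0; lia.
  have E1 x : x (q, i) = (d q)^-1 * (LDU k (frz d x) (i, q) + - \sum_(k <= r < q) x (r, i) * d r * x (q, r)).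
    rewrite /LDU ifT; last by rewrite /inb /=; lia.
    rewrite (big_cat_nat (n := q.+1)) //=; [|lia|lia].
    rewrite [X in _ + X - _]big1_seq ?addr0; last by move=> r; rewrite mem_index_iota; lia.
    rewrite big_mkcond big_nat_recr /=; last lia.
    rewrite ifT; last lia.
    rewrite L1_id frz_diag L1_frz ?mulr1; last lia.
    rewrite [X in X + _ - _](_ : _ = \sum_(k <= r < q) x (r, i) * d r * x (q, r)); last first.
      apply: congr_big_nat => // r rq; rewrite ifT; last lia.
      by rewrite frz_diag !L1_frz//; lia.
    by rewrite addrC addKr mulrC mulfK.
  have E2 x : x (i, q) = (d q)^-1 * (LDU k (frz d x) (q, i) + - \sum_(k <= r < q) x (r, q) * d r * x (i, r)).
    rewrite /LDU ifT; last by rewrite /inb /=; lia.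
    rewrite (big_cat_nat (n := q.+1)) //=; [|lia|lia].
    rewrite [X in _ + X - _]big1_seq ?addr0; last by move=> r; rewrite mem_index_iota; lia.
    rewrite big_mkcond big_nat_recr /=; last lia.
    rewrite ifT; last lia.
    rewrite L1_id frz_diag L1_frz ?mul1r; last lia.
    rewrite [X in X + _ - _](_ : _ = \sum_(k <= r < q) x (r, q) * d r * x (i, r)); last first.
      apply: congr_big_nat => // r rq; rewrite ifT; last lia.
      by rewrite frz_diag !L1_frz//; lia.
    by rewrite addrC addKr mulKf.
  have gsum (u v : nat -> sl) :
    (forall r, (k <= r < q)%N -> gb (blk k) (fun x => LDU k (frz d x)) (fun x => x (u r))) ->
    (forall r, (k <= r < q)%N -> gb (blk k) (fun x => LDU k (frz d x)) (fun x => x (v r))) ->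
    gb (blk k) (fun x => LDU k (frz d x)) (fun x => - \sum_(k <= r < q) x (u r) * d r * x (v r)).
    move=> Hu Hv.
    have -> : (fun x => - \sum_(k <= r < q) x (u r) * d r * x (v r)) =
      (fun x => (-1) * \sum_(k <= r < q) x (u r) * d r * x (v r)).
      by apply/funext => x; rewrite mulN1r.
    apply: gbM; first exact: gb_cst.
    apply: (@gb_sum _ _ _ (index_iota k q) _ _ (fun r x => x (u r) * d r * x (v r))) => r.
    rewrite mem_index_iota => kr.
    by apply: gbM; [apply: gbM; [exact: Hu|exact: gb_cst]|exact: Hv].
  split.
    have -> : (fun x => x (q, i)) = (fun x => (d q)^-1 * (LDU k (frz d x) (i, q) +
        - \sum_(k <= r < q) x (r, i) * d r * x (q, r))).
      by apply/funext => x; exact: E1.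
    apply: gbM; first exact: gb_cst.
    apply: gbD; first by apply: gb_coord; rewrite mem_blk /inb /=; lia.
    by apply: (gsum (fun r => (r, i)) (fun r => (q, r))) => r rq;
      [apply: (IH r _ i _ _).1; lia|apply: (IH r _ q _ _).2; lia].
  have -> : (fun x => x (i, q)) = (fun x => (d q)^-1 * (LDU k (frz d x) (q, i) +
      - \sum_(k <= r < q) x (r, q) * d r * x (i, r))).
    by apply/funext => x; exact: E2.
  apply: gbM; first exact: gb_cst.
  apply: gbD; first by apply: gb_coord; rewrite mem_blk /inb /=; lia.
  by apply: (gsum (fun r => (r, q)) (fun r => (i, r))) => r rq;
    [apply: (IH r _ q _ _).1; lia|apply: (IH r _ i _ _).2; lia].
case=> i j; rewrite mem_off /inb /= => hij.
have [ij|ij] := ltnP i j; first by apply: (H i j _ _).1; lia.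
by apply: (H j i _ _).2; lia.
Qed.

(** The character [f] sees only the neighbour [k + 1] of the pivot. As a sum against this indicator
    its contribution is automatically [0] at the last pivot. *)
Definition dl k (j : nat) : R := (j == k.+1)%:R.
Definition e1 k x : R := \sum_(k.+1 <= j < n) dl k j * (x (k, j) + x (j, k)).
Definition Hk k (a : R) h : pt -> C :=
  IL (row k ++ col k) (fun x => psi (- e1 k x) * h (Yt k a [::] x)).
Definition Gk k (a : R) T F x : C :=
  psi (- e1 k x + a * \sum_(p <- T) x p * (x (k, p.1) * x (p.2, k))) * F (Yt k a T x).

Lemma scR_e1 k : scR (e1 k).
Proof.
apply: scR_sum => j _; apply: scRM; first exact: scR_cst.
by apply: scRD; exact: scR_coord.
Qed.

(** The old variables are recovered from their image under [Yt]: the row and the column on dividing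
    by [a], then the minor by undoing the translation. *)
Lemma cr_Gk k a T F : (k < n)%N -> a != 0 -> {subset T <= blk k.+1} -> cr (blk k) F ->
  cr ((row k ++ col k) ++ blk k.+1) (Gk k a T F).
Proof.
move=> kn a0 TS cF; apply: cr_psiM.
  apply: scRD; first by apply: scRN; exact: scR_e1.
  apply: scRM; first exact: scR_cst.
  apply: scR_sum => p _; apply: scRM; first exact: scR_coord.
  by apply: scRM; exact: scR_coord.
have grow j : (k < j < n)%N -> gb (blk k) (Yt k a T) (fun x => x (k, j)).
  move=> kj; have -> : (fun x => x (k, j)) = (fun x => a^-1 * Yt k a T x (j, k)).
    apply/funext => x; rewrite /Yt ifF; last by rewrite /inb /=; lia.
    by rewrite /= ifF; [rewrite eqxx mulKf|lia].
  apply: gbM; first exact: gb_cst.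
  by apply: gb_coord; rewrite mem_blk /inb /=; lia.
have gcol j : (k < j < n)%N -> gb (blk k) (Yt k a T) (fun x => x (j, k)).
  move=> kj; have -> : (fun x => x (j, k)) = (fun x => a^-1 * Yt k a T x (k, j)).
    apply/funext => x; rewrite /Yt ifF; last by rewrite /inb /=; lia.
    by rewrite /= eqxx ifF; [rewrite mulKf|lia].
  apply: gbM; first exact: gb_cst.
  by apply: gb_coord; rewrite mem_blk /inb /=; lia.
apply: cr_comp cF; first exact: scR_Yt.
case=> i j; rewrite !mem_cat mem_row mem_col mem_blk /=.
have [/andP[/eqP -> kj] _|/= _] := boolP ((i == k) && (k < j < n)%N); first exact: grow.
have [/andP[/eqP -> kj] _|/= _ ij] := boolP ((j == k) && (k < i < n)%N); first exact: gcol.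
have -> : (fun x => x (i, j)) = (fun x => Yt k a T x (i, j) +
    (if (i, j) \in T then 0 else (- a) * x (k, i) * x (j, k))).
  apply/funext => x; rewrite /Yt ifF; last by move: ij; rewrite /inb /=; lia.
  rewrite /= ifF; last by move: ij; rewrite /inb /=; lia.
  rewrite ifF; last by move: ij; rewrite /inb /=; lia.
  by case: ifP => _; ring.
apply: gbD.
  by apply: gb_coord; rewrite mem_blk; move: ij; rewrite /inb /=; lia.
case: ((i, j) \in T); first exact: gb_cst.
apply: gbM; first apply: gbM; first exact: gb_cst.
  by apply: grow; move: ij; rewrite /inb /=; lia.
by apply: gcol; move: ij; rewrite /inb /=; lia.
Qed.

(** One variable of [T] at a time: in the variable [(i, j)] the integrand of [Hk] is translated by
    [a x (k, i) x (j, k)], which does not involve that variable, so the transform turns the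
    translation into the phase recorded in [Gk]. *)
Lemma FTL_Hk k a h T : (k < n)%N -> a != 0 -> good (blk k) h ->
  uniq T -> {subset T <= blk k.+1} ->
  FTL T (Hk k a h) = IL (row k ++ col k) (Gk k a T (FTL T h)).
Proof.
move=> kn a0 gh; elim: T => [|p T IH].
  move=> _ _; rewrite /FTL /= /Hk; congr (IL _ _); apply/funext => x.
  by rewrite /Gk big_nil mulr0 addr0.
rewrite cons_uniq => /andP[pT uT] TS.
have TS' : {subset T <= blk k.+1} by move=> q qT; apply: TS; rewrite inE qT orbT.
have pb : p \in blk k.+1 by apply: TS; rewrite mem_head.
have sb : {subset blk k.+1 <= blk k}.
  by move=> q; rewrite (perm_mem (perm_blk kn)) inE !mem_cat => ->; rewrite !orbT.
have cT : cr (blk k) (FTL T h) by apply: gh => // q /TS' /sb.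
have E (G : pt -> C) : FTL (p :: T) G = FT p (FTL T G) by [].
have prc : p \notin row k ++ col k.
  have := uniq_rcb k; rewrite cat_uniq => /and3P[_ /hasPn /(_ p pb) H _]; exact: H.
rewrite E IH// (FT_IL_comm hbar (uniq_rc k) prc); last first.
  apply: crS (cr_Gk kn a0 TS' cT) => q; rewrite inE => /orP[/eqP ->|qrc].
    by rewrite mem_cat pb orbT.
  by rewrite mem_cat qrc.
congr (IL _ _); apply/funext => x.
move: p pb pT prc E {TS} => -[i j] pb pT prc E.
have ijb : (k < i < n)%N && (k < j < n)%N by move: pb; rewrite mem_blk /inb.
set c := a * x (k, i) * x (j, k).
have EY t : Yt k a T (upd x (i, j) t) = upd (Yt k a ((i, j) :: T) x) (i, j) (1 * t + c).
  apply/funext => -[i' j']; rewrite /Yt /upd !xpair_eqE /=.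
  have nk : (k == i) = false by lia.
  have nk' : (k == j) = false by lia.
  rewrite !nk !nk' !andbF /=.
  have [/andP[/eqP -> /eqP ->]|ne] := boolP ((i' == i) && (j' == j)).
    rewrite ifF; last by rewrite /inb /=; lia.
    by rewrite ifF; [|lia]; rewrite ifF; [|lia]; rewrite (negPf pT) mul1r.
  by rewrite inE xpair_eqE (negPf ne).
have EP t : e1 k (upd x (i, j) t) = e1 k x.
  apply: congr_big_nat => // q kq; congr (_ * (_ + _)); apply: upd_other; rewrite xpair_eqE; lia.
have ES t : \sum_(p <- T) upd x (i, j) t p * (upd x (i, j) t (k, p.1) * upd x (i, j) t (p.2, k)) =
    \sum_(p <- T) x p * (x (k, p.1) * x (p.2, k)).
  apply: eq_big_seq => p pT'; congr (_ * (_ * _)); apply: upd_other.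
  - by apply: contraNneq pT => <-.
  - by rewrite xpair_eqE; lia.
  - by rewrite xpair_eqE; lia.
have [K HK] : exists K, tameC K (fun t => FTL T h (upd (Yt k a ((i, j) :: T) x) (i, j) t)).
  by apply: cr_tame cT; exact: sb.
set P := - e1 k x + a * \sum_(p <- T) x p * (x (k, p.1) * x (p.2, k)).
have YP : Yt k a ((i, j) :: T) x (i, j) = x (i, j).
  rewrite /Yt ifF; last by rewrite /inb /=; lia.
  by rewrite /= ifF; [|lia]; rewrite ifF; [|lia]; rewrite mem_head addr0.
rewrite /FT.
transitivity (intC (fun t => (psi P * psi (x (i, j) * c)) *
   (psi (- x (i, j) * (1 * t + c)) * FTL T h (upd (Yt k a ((i, j) :: T) x) (i, j) (1 * t + c))))).
  congr (intC _); apply/funext => t.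
  rewrite /Gk EP ES EY !mulrA -!psiD; congr (psi _ * _); rewrite /P /c; ring.
have := @intC_affine _ _ _ 1 c (oner_neq0 _) (tameC_cstM (psi P * psi (x (i, j) * c)) (tameC_psiM hbar (- x (i, j)) HK)).
rewrite normr1 mul1r => ->; rewrite (intCZ _ (tameC_psiM hbar (- x (i, j)) HK)).
rewrite /Gk E /FT YP -psiD; congr (psi _ * _).
by rewrite /P big_cons /c; ring.
Qed.

(** By [FTL_Hk] each partial transform is again an integral of a rapidly decreasing function, so the
    elimination can continue with [Hk] in place of [h]. *)
Lemma good_Hk k a h : (k < n)%N -> a != 0 -> good (blk k) h ->
  good (blk k.+1) (Hk k a h).
Proof.
move=> kn a0 gh T uT TS; rewrite FTL_Hk//; apply: (cr_IL hbar); first exact: uniq_rcb.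
apply: cr_Gk => //; apply: gh => // q /TS.
by rewrite (perm_mem (perm_blk kn)) inE !mem_cat => ->; rewrite !orbT.
Qed.

End LDU.

(** * The integral identity *)

Section KeyIdentity.
Variables (R : realType) (hbar : R).
Hypothesis hbar0 : hbar != 0.
Variables (n : nat) (b : nat -> R).
Hypothesis b0 : forall i, (i < n)%N -> b i != 0.
Local Notation C := R[i].
Local Notation sl := (nat * nat)%type.
Local Notation pt := (sl -> R).
Local Notation psi := (@psi R hbar).
Local Notation FT := (@FT R hbar sl).
Local Notation FTL := (@FTL R hbar sl).
Local Notation good := (@good R hbar sl).
Local Notation blk := (blk n).
Local Notation row := (row n).
Local Notation col := (col n).
Local Notation off := (off n).
Local Notation dg := (dg n).
Local Notation inb := (inb n).
Local Notation LDU := (@LDU R n).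
Local Notation UDL := (@UDL R n b).
Local Notation Yt := (@Yt R n).
Local Notation Wt := (@Wt R n b).
Local Notation Hk := (@Hk R hbar n).
Local Notation Gk := (@Gk R hbar n).
Local Notation e1 := (@e1 R n).
Local Notation dl := (@dl R).
Implicit Types (x y z : pt) (F G h : pt -> C) (s S T : seq sl) (k : nat).

(** This is the term [1 / (a b_(k+1))] of the phase, and [0] at the last pivot. *)
Definition kap k (a : R) : R := \sum_(k.+1 <= j < n) dl k j * (a * b j)^-1.
(** The right-hand integrand at a fixed pivot, with [g] already transformed in the minor. The sum
    over [j] is the entry [(k, k)] of [UDL] without its summand [b_k]; it comes from the kernel of
    the Fourier transform in that entry. *)
Definition Qk k (a : R) g y : C :=
  psi (e1 k y - a * \sum_(k.+1 <= j < n) y (k, j) * b j * y (j, k)) *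
  FTL (row k ++ col k) g (Wt k a y).

Lemma WtP k a y : (k < n)%N ->
  [/\ Wt k a y (k, k) = a,
   forall j, (k < j < n)%N -> Wt k a y (k, j) =
     \sum_(k.+1 <= q < n | (j <= q)%N) y (k, q) * b q * L1 y q j,
   forall i, (k < i < n)%N -> Wt k a y (i, k) =
     \sum_(k.+1 <= q < n | (i <= q)%N) L1 y i q * b q * y (q, k),
   forall i j, inb k.+1 (i, j) -> Wt k a y (i, j) = UDL k.+1 y (i, j) &
   forall p, ~~ inb k p -> Wt k a y p = y p].
Proof.
move=> kn; split.
- by rewrite /Wt eqxx.
- move=> j kj; rewrite /Wt ifF; last by rewrite xpair_eqE; lia.
  rewrite /UDL ifT; last by rewrite /inb /=; lia.
  rewrite big_ltn_cond//= ifF; last by lia.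
  rewrite [LHS]big_nat_cond [RHS]big_nat_cond; apply: eq_big => q; first lia.
  by move=> kq; congr (_ * _ * _); rewrite /L1 ifF//; lia.
- move=> i ki; rewrite /Wt ifF; last by rewrite xpair_eqE; lia.
  rewrite /UDL ifT; last by rewrite /inb /=; lia.
  rewrite big_ltn_cond//= ifF; last by lia.
  rewrite [LHS]big_nat_cond [RHS]big_nat_cond; apply: eq_big => q; first lia.
  by move=> kq; congr (_ * _ * _); rewrite /L1 ifF//; lia.
- move=> i j ij; rewrite /Wt ifF; last by move: ij; rewrite xpair_eqE /inb /=; lia.
  rewrite /UDL ij ifT; last by move: ij; rewrite /inb /=; lia.
  rewrite big_ltn_cond//= ifF//; move: ij; rewrite /inb /=; lia.
- move=> p kp; rewrite /Wt ifF; last by apply: contraNF kp => /eqP ->; rewrite /inb /=; lia.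
  by rewrite /UDL (negPf kp).
Qed.

Lemma scR_Wt k a j : scR (fun x => Wt k a x j).
Proof. by rewrite /Wt; case: eqP => _; [exact: scR_cst|exact: scR_UDL]. Qed.

(** [Wt] differs from [UDL] in a diagonal entry only, and the factors are polynomials in the
    off-diagonal ones. *)
Lemma cr_Qk k a g : (k < n)%N -> cr (blk k) (FTL (row k ++ col k) g) ->
  cr (off k) (Qk k a g).
Proof.
move=> kn cg; apply: cr_psiM.
  apply: scRD; first exact: scR_e1.
  apply/scRN/scRM; first exact: scR_cst.
  apply: scR_sum => q _; apply: scRM; last exact: scR_coord.
  by apply: scRM; [exact: scR_coord|exact: scR_cst].
apply: cr_comp cg; first exact: scR_Wt.
move=> p0 /(UDL_inv_off b0) [p [Pp Ep]].
have -> : (fun x => x p0) = (fun x => p (Wt k a x)).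
  apply/funext => x; rewrite Ep; apply: (polyf_agree Pp) => -[i j].
  by rewrite mem_off /Wt => /andP[/= ij _]; rewrite ifF// xpair_eqE; lia.
apply: (polyf_gb _ _ Pp) => q; rewrite mem_off mem_blk => /andP[] //.
Qed.

Lemma upds_map (I J : eqType) (f : J -> I) (r : seq J) (x : I -> R) ts j :
  injective f -> uniq r -> size ts = size r -> j \in r ->
  upds x (map f r) ts (f j) = nth 0 ts (index j r).
Proof.
move=> fi; elim: r x ts => [//|i r IH] x [//|t ts] /= /andP[ir ur] [sr].
rewrite inE eq_sym; have [<- _|ij /= jr] := eqVneq i j.
  rewrite upds_notin ?upd_same//; apply/negP => /mapP[l lr /fi E].
  by move: ir; rewrite E lr.
by rewrite IH.
Qed.

Lemma triangular_row k (g : sl -> pt -> R) m l :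
  (forall j y j' t, (m <= j)%N -> (j <= j')%N -> g (k, j) (upd y (k, j') t) = g (k, j) y) ->
  triangular [seq (k, j) | j <- iota m l] g.
Proof.
elim: l m => [//|l IH] m H; split.
  move=> p y t; rewrite -[_ :: _]/([seq (k, j) | j <- iota m l.+1]) => /mapP[j'].
  by rewrite mem_iota => /andP[mj _] ->; exact: H.
apply: IH => j y j' t mj; apply: H; exact: ltnW.
Qed.

(** The list is reversed because the column substitution [U b l] shifts an entry by those with
    larger row index, which therefore have to come first. *)
Lemma triangular_colr k (g : sl -> pt -> R) m l :
  (forall i y i' t, (i' <= i)%N -> g (i, k) (upd y (i', k) t) = g (i, k) y) ->
  triangular (rev [seq (i, k) | i <- iota m l]) g.
Proof.
move=> H; elim: l => [//|l IH].
rewrite -addn1 iotaD map_cat rev_cat /=; split=> //.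
move=> p y t; rewrite inE mem_rev => /orP[/eqP ->|/mapP[i']]; first exact: H.
by rewrite mem_iota => /andP[_ i'm] ->; apply: H; exact: ltnW.
Qed.

Lemma triangular0 s : triangular s (fun (_ : sl) (_ : pt) => 0 : R).
Proof. by elim: s. Qed.

Lemma dl_sum k (f : nat -> R) : \sum_(k.+1 <= j < n) dl k j * f j =
  if (k.+1 < n)%N then f k.+1 else 0.
Proof.
case: ifPn => kn1; last by rewrite big_geq// leqNgt.
rewrite big_ltn// /dl eqxx mul1r big1_seq ?addr0// => j; rewrite mem_index_iota => kj.
by rewrite (_ : (j == k.+1) = false) ?mul0r//; lia.
Qed.

Lemma rc_notin_inbS k p : p \in row k ++ col k -> forall i j, inb k.+1 (i, j) -> (i, j) != p.
Proof.
rewrite mem_cat mem_row mem_col => pr i j ij; apply/eqP => E; move: ij pr; rewrite -E /inb /=; lia.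
Qed.

(** * One elimination step at a fixed pivot *)

Section Step.
Variables (k : nat) (a : R) (h : pt -> C).
Hypotheses (kn : (k < n)%N) (a0 : a != 0) (gh : good (blk k) h).

Let g := FTL (blk k.+1) h.
Let m := (n - k.+1)%N.
Let sd2 : R := `|hbar| / (2 * pi).

Lemma sub_blkS : {subset blk k.+1 <= blk k}.
Proof. by move=> q; rewrite (perm_mem (perm_blk kn)) inE !mem_cat => ->; rewrite !orbT. Qed.
Lemma sub_rc : {subset row k ++ col k <= blk k}.
Proof. by move=> q qr; rewrite (perm_mem (perm_blk kn)) inE mem_cat qr !orbT. Qed.
Lemma sub_row : {subset row k <= blk k}.
Proof. by move=> q qr; apply: sub_rc; rewrite mem_cat qr. Qed.
Lemma sub_col : {subset col k <= blk k}.
Proof. by move=> q qr; apply: sub_rc; rewrite mem_cat qr orbT. Qed.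

Lemma cr_FTLg T : uniq T -> {subset T <= row k ++ col k} -> cr (blk k) (FTL T g).
Proof.
move=> uT TS; apply: good_FTL => //; [exact: uniq_blk|exact: sub_blkS| |].
  rewrite cat_uniq uT uniq_blk andbT /=; apply/hasPn => q qb.
  apply/negP => /TS; have := uniq_rcb n k; rewrite cat_uniq => /and3P[_ /hasPn /(_ q qb) H _].
  exact/negP.
by move=> q /TS /sub_rc.
Qed.

Definition rowshift (p : sl) (y : pt) : R :=
  dl k p.2 * (a * b p.2)^-1 - \sum_(k.+1 <= i < p.2) y (k, i) * y (i, p.2).

Lemma tri_row y j : (k < j < n)%N ->
  tri (row k) (fun=> -1) rowshift y (k, j) =
  dl k j * (a * b j)^-1 - \sum_(k.+1 <= i < n | (i <= j)%N) y (k, i) * L1 y i j.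
Proof.
move=> kj; rewrite /tri mem_row /= eqxx kj /rowshift /=.
rewrite [X in _ = _ - X](big_cat_nat (n := j.+1)) /=; [|lia|lia].
rewrite [X in _ = _ - (_ + X)]big1_seq ?addr0; last first.
  by move=> i; rewrite mem_index_iota; lia.
rewrite [X in _ = _ - X]big_mkcond big_nat_recr /=; last by lia.
rewrite leqnn L1_id mulr1 mulN1r.
rewrite [X in _ = _ - (X + _)](_ : _ = \sum_(k.+1 <= i < j) y (k, i) * y (i, j)); last first.
  by apply: congr_big_nat => // i ij; rewrite ifT /L1; [rewrite ifF//; lia|lia].
by ring.
Qed.

Lemma tri_row_other y p : p \notin row k -> tri (row k) (fun=> -1) rowshift y p = y p.
Proof. by move=> pr; rewrite /tri (negPf pr). Qed.

(** Arguments of the Fourier transform after the row substitution: for the row variables [u] and the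
    minor [Z] of [UDL], the row becomes [e1 / a - u Z]. In [V1] the column moreover holds [a u], the
    value at which Fourier inversion evaluates. *)
Definition V0 y : pt := fun p => if p == (k, k) then a else
  if p \in row k then dl k p.2 / a - \sum_(k.+1 <= i < n) y (k, i) * UDL k.+1 y (i, p.2)
  else UDL k.+1 y p.
Definition ccol y (p : sl) : R := a * y (k, p.1).
Definition V1 y : pt := fun p => if p \in col k then ccol y p else V0 y p.
Definition colshift y (p : sl) (w : pt) : R :=
  \sum_(p.1.+1 <= q < n) y (p.1, q) * b q * w (q, k).

Lemma UDLS_upd x p t : p \in row k ++ col k -> UDL k.+1 (upd x p t) = upd (UDL k.+1 x) p t.
Proof. by move=> pr; apply: UDL_upd; exact: rc_notin_inbS. Qed.

(* After the substitution [u := e1 / (a b) - u U], the column variables enter only through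
   [U b l]: this is where the Fourier transform in the column gets inverted. *)
Lemma Qk_tri y ts : size ts = size (rev (col k)) ->
  Qk k a g (upds (tri (row k) (fun=> -1) rowshift y) (rev (col k)) ts) =
  psi (kap k a - \sum_(k.+1 <= j < n) dl k j * y (k, j)) *
  (fun v => psi (\sum_(p <- col k) ccol y p * v p) * FTL (col k) (FTL (row k) g) v)
    (tri (rev (col k)) (fun p => b p.1) (colshift y) (upds (V0 y) (rev (col k)) ts)).
Proof.
set z := tri _ _ _ y; move=> sts; set w := upds z _ ts; set w0 := upds (V0 y) _ ts.
set v := tri _ _ _ w0.
have colr p : (p \in rev (col k)) = (p \in col k) by rewrite mem_rev.
have wother p : p \notin col k -> w p = z p.
  by move=> pc; rewrite /w upds_notin// colr.
have w0other p : p \notin col k -> w0 p = V0 y p.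
  by move=> pc; rewrite /w0 upds_notin// colr.
have wcol i : (k < i < n)%N -> w (i, k) = w0 (i, k).
  move=> ki; have inj : injective (fun i => (i, k) : sl) by move=> ? ? [].
  have ir : i \in rev (index_iota k.+1 n) by rewrite mem_rev mem_index_iota.
  rewrite /w /w0 /col -map_rev !(@upds_map _ _ (fun i => (i, k) : sl))// ?rev_uniq ?iota_uniq//.
    by rewrite sts size_rev size_map size_rev.
  by rewrite sts size_rev size_map size_rev.
have zrow j : (k < j < n)%N -> w (k, j) =
    dl k j * (a * b j)^-1 - \sum_(k.+1 <= i < n | (i <= j)%N) y (k, i) * L1 y i j.
  move=> kj; have nc : (k, j) \notin col k by rewrite mem_col /=; lia.
  by rewrite wother// /z tri_row.
have wblk i j : (k < i)%N -> (k < j)%N -> w (i, j) = y (i, j).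
  move=> ki kj; rewrite wother; last by rewrite mem_col /=; lia.
  by rewrite /z tri_row_other// mem_row /=; lia.
have wL1 i j : (k < i)%N -> (k < j)%N -> L1 w i j = L1 y i j.
  by move=> ki kj; rewrite /L1; case: eqP => // _; exact: wblk.
have Zw i j : inb k.+1 (i, j) -> UDL k.+1 w (i, j) = UDL k.+1 y (i, j).
  move=> ij; move: (ij); rewrite {1}/inb /= => ij'.
  by rewrite /UDL ij; apply: eq_bigr => q /= /andP[iq jq]; rewrite !wL1//; lia.
have [W1 W2 W3 W4 W5] := WtP a w kn.
have vcol i : (k < i < n)%N -> v (i, k) = Wt k a w (i, k).
  move=> ki; rewrite W3// /v /tri colr mem_col /= eqxx ki /colshift /=.
  rewrite [RHS](big_cat_nat (n := i)) /=; [|lia|lia].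
  rewrite [X in _ = X + _]big1_seq ?add0r; last by move=> q; rewrite mem_index_iota; lia.
  rewrite [RHS]big_mkcond [RHS]big_ltn /=; last by lia.
  rewrite leqnn L1_id mul1r wcol//; congr (_ + _); apply: congr_big_nat => // q qi.
  rewrite ifT; last by lia.
  rewrite wcol; last by lia.
  by congr (_ * _ * _); rewrite wL1 /L1 ?ifF//; lia.
have dlq q : b q != 0 -> dl k q * (a * b q)^-1 * b q = dl k q / a.
  by move=> bq; field; rewrite a0 bq.
have vrow j : (k < j < n)%N -> V0 y (k, j) = Wt k a w (k, j).
  move=> kj; rewrite W2// /V0 ifF; last by rewrite xpair_eqE; lia.
  rewrite mem_row /= eqxx kj /=.
  (* The substituted row is multiplied by [b] and by the lower factor: [b] cancels against
     [1 / (a b)] in the first term, and an exchange of sums in the second assembles the minor of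
     [UDL]. *)
  transitivity (\sum_(k.+1 <= q < n | (j <= q)%N) (dl k q / a * L1 y q j -
     \sum_(k.+1 <= i < n | (i <= q)%N) y (k, i) * L1 y i q * b q * L1 y q j)); last first.
    rewrite [LHS]big_nat_cond [RHS]big_nat_cond; apply: eq_bigr => q /andP[kq jq].
    rewrite zrow// wL1; [|lia|lia].
    have bq : b q != 0 by apply: b0; lia.
    by rewrite !mulrBl dlq// !mulr_suml.
  rewrite sumrB; congr (_ - _).
    rewrite big_mkcond /=.
    have -> : \sum_(k.+1 <= q < n) (if (j <= q)%N then dl k q / a * L1 y q j else 0) =
      \sum_(k.+1 <= q < n) dl k q * (if (j <= q)%N then L1 y q j / a else 0).
      by apply: eq_bigr => q _; case: ifP => _; rewrite ?mulr0// mulrAC mulrA.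
    rewrite dl_sum ifT; last by lia.
    rewrite /dl; have [jk|jk] := eqVneq j k.+1; first by rewrite jk leqnn L1_id.
    by rewrite ifF ?mul0r//; lia.
  rewrite [RHS](exchange_big_dep predT) //= ; apply: congr_big_nat => // i ki.
  rewrite /UDL ifT; last by rewrite /inb /=; lia.
  rewrite mulr_sumr /= big_mkcond [RHS]big_mkcond; apply: eq_bigr => q _ /=.
  by rewrite andbC; case: ifP => // _; rewrite !mulrA.
have vE : v = Wt k a w.
  apply/funext => -[i j]; have [|nc] := boolP ((i, j) \in col k).
    by rewrite mem_col /= => /andP[/eqP -> ki]; exact: vcol.
  rewrite /v /tri colr (negPf nc) w0other//.
  have [/eqP [-> ->]|ne] := boolP ((i, j) == (k, k)); first by rewrite W1 /V0 eqxx.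
  have [|nr] := boolP ((i, j) \in row k).
    by rewrite mem_row /= => /andP[/eqP -> kj]; exact: vrow.
  rewrite /V0 (negPf ne) (negPf nr).
  have [ijb|nb] := boolP (inb k.+1 (i, j)); first by rewrite W4// Zw.
  rewrite W5; last by move: nb nc nr ne; rewrite mem_col mem_row /inb xpair_eqE /=; lia.
  by rewrite wother// /z tri_row_other// /UDL (negPf nb).
rewrite vE /Qk.
have -> : FTL (row k ++ col k) g = FTL (col k) (FTL (row k) g).
  rewrite -FTL_cat; apply: FTL_perm; [by rewrite perm_catC|exact: uniq_rc|].
  by apply: crS sub_rc _; apply: (@cr_FTLg [::]).
rewrite mulrA -psiD; congr (psi _ * _).
rewrite /e1; under eq_bigr do rewrite mulrDr.
rewrite big_split /=.
have E1 : \sum_(k.+1 <= i < n) dl k i * w (k, i) = kap k a - \sum_(k.+1 <= j < n) dl k j * y (k, j).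
  rewrite /kap -sumrB; under [RHS]eq_bigr do rewrite -mulrBr.
  rewrite !dl_sum; case: ifP => // kn1; rewrite zrow; last by lia.
  rewrite /dl eqxx mul1r big_ltn_cond//= leqnn L1_id mulr1 big1_seq ?addr0//.
  by move=> i; rewrite mem_index_iota; lia.
rewrite -[LHS]addrA E1; congr (_ + _).
rewrite mulr_sumr -sumrB.
(* The part [e1 / (a b)] of the substituted row cancels the character on the column; what is left is
   the pairing of [a u] with [U b l]. *)
transitivity (\sum_(k.+1 <= j < n) \sum_(k.+1 <= i < n | (i <= j)%N)
    (a * y (k, i)) * (L1 y i j * b j * w (j, k))).
  apply: congr_big_nat => // j kj; rewrite zrow//.
  have bj : b j != 0 by apply: b0; lia.
  transitivity (w (j, k) * (a * b j) * \sum_(k.+1 <= i < n | (i <= j)%N) y (k, i) * L1 y i j).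
    have : dl k j * (a * b j)^-1 * (a * b j) = dl k j by rewrite divfK// mulf_neq0.
    set Sg := \sum_(_ <= _ < _ | _) _; set D := _^-1 => E.
    transitivity (w (j, k) * (dl k j - dl k j * D * (a * b j)) + w (j, k) * (a * b j) * Sg); first by ring.
    by rewrite E subrr mulr0 add0r.
  by rewrite mulr_sumr; apply: eq_bigr => i _; ring.
rewrite (exchange_big_dep predT)//= /col big_map.
apply: congr_big_nat => // i ki; rewrite /ccol /= -vE vcol// W3// mulr_sumr.
rewrite [LHS]big_nat_cond [RHS]big_nat_cond; apply: eq_bigr => j /andP[kj _].
by rewrite wL1//; lia.
Qed.

(** Passing from the column [l] to [U b l] has Jacobian [prod |b_j|]. The column integral is then a
    Fourier inversion in [m] variables, which accounts for [sd2 ^+ m]. *)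
Lemma IL_Qk_tri y :
  (sd2 ^+ m * \prod_(k.+1 <= j < n) `|b j|)%:C *
    IL (col k) (Qk k a g) (tri (row k) (fun=> -1) rowshift y) =
  psi (kap k a - \sum_(k.+1 <= j < n) dl k j * y (k, j)) * FTL (row k) g (V1 y).
Proof.
set z := tri _ _ _ y; set cst := psi _.
pose F v := psi (\sum_(p <- col k) ccol y p * v p) * FTL (col k) (FTL (row k) g) v.
have crr : cr (blk k) (FTL (col k) (FTL (row k) g)).
  rewrite -FTL_cat; apply: cr_FTLg => [|q]; first by rewrite uniq_catC uniq_rc.
  by rewrite !mem_cat orbC.
have cF : cr (col k) F.
  apply: cr_psiM; last exact: crS sub_col _.
  by apply: scR_sum => p _; apply: scRM; [exact: scR_cst|exact: scR_coord].
have cQ : cr (col k) (Qk k a g).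
  apply: (@crS _ _ (off k)); last by apply: cr_Qk => //; exact: cr_FTLg (uniq_rc _ _) _.
  by move=> -[i j]; rewrite mem_col mem_off /inb /=; lia.
have pc : perm_eq (col k) (rev (col k)) by rewrite perm_sym perm_rev.
have -> : IL (col k) (Qk k a g) z =
    IL (rev (col k)) (fun w => (fun v => cst * F v) (tri (rev (col k)) (fun p => b p.1) (colshift y) w)) (V0 y).
  rewrite (IL_perm hbar pc (uniq_col _ _) cQ); apply: IL_eq => // ts sts.
  by rewrite /z Qk_tri.
have T : IL (rev (col k)) (fun v => cst * F v) (V0 y) =
   (\prod_(p <- rev (col k)) `|b p.1|)%:C * IL (rev (col k))
     (fun w => (fun v => cst * F v) (tri (rev (col k)) (fun p => b p.1) (colshift y) w)) (V0 y).
  apply: (IL_tri hbar).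
  - by rewrite rev_uniq uniq_col.
  - by move=> p; rewrite mem_rev mem_col => /andP[_ /andP[_]]; exact: b0.
  - move=> p _; apply: scR_sum => q _; apply: scRM; last exact: scR_coord.
    exact: scR_cst.
  - rewrite /col; apply: triangular_colr => i w i' t ii'; rewrite /colshift /=.
    apply: congr_big_nat => // q iq; rewrite upd_other// xpair_eqE; lia.
  - by apply: cr_cstM; apply: crS cF => q; rewrite mem_rev.
have PE : \prod_(k.+1 <= j < n) `|b j| = \prod_(p <- rev (col k)) `|b p.1|.
  by rewrite -(perm_big _ pc) /= /col big_map.
rewrite PE rmorphM -mulrA -T -(IL_perm hbar pc (uniq_col _ _)); last exact: cr_cstM.
rewrite (ILZ hbar (c := fun=> cst) (uniq_col _ _) cF)// mulrCA; congr (_ * _).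
have sc : size (col k) = m by rewrite size_map size_iota.
rewrite -sc; apply: FTL_inv => //; first exact: uniq_col.
move=> T' uT' TS'; apply: crS sub_col _; rewrite -FTL_cat; apply: cr_FTLg.
  rewrite cat_uniq uT' uniq_row andbT /=; apply/hasPn => q qr; apply/negP => /TS'.
  by move: qr; rewrite mem_col mem_row; case: q => i j /=; lia.
by move=> q; rewrite !mem_cat => /orP[/TS' ->|->]; rewrite ?orbT.
Qed.

(** The remaining transform in the row is written as an integral and rescaled by [a], whence
    [|a|^m]. Since [Yt] builds the row of the matrix from the stored column, renaming the row
    variables as column variables yields the column integral of [Gk]. *)
Lemma FTL_row_unfold y :
  psi (kap k a - \sum_(k.+1 <= j < n) dl k j * y (k, j)) * FTL (row k) g (V1 y) =
  (psi (kap k a) * (`|a| ^+ m)%:C) * IL (col k) (Gk k a (blk k.+1) g) (UDL k.+1 y).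
Proof.
have cg : cr (row k) g by apply: crS sub_row _; apply: (@cr_FTLg [::]).
rewrite psiD -!mulrA; congr (_ * _).
set D := - _; rewrite FTL_IL//; last exact: uniq_row.
pose Fr w := psi D * (psi (- \sum_(p <- row k) V1 y p * w p) * g w).
have cFr0 : cr (row k) (fun w => psi (- \sum_(p <- row k) V1 y p * w p) * g w).
  apply: cr_psiM => //; apply/scRN/scR_sum => p _.
  by apply: scRM; [exact: scR_cst|exact: scR_coord].
have -> : psi D * IL (row k) (fun w => psi (- \sum_(p <- row k) V1 y p * w p) * g w) (V1 y) =
    IL (row k) Fr (V1 y).
  by rewrite (ILZ hbar (c := fun=> psi D) (uniq_row _ _) cFr0).
have -> : IL (row k) Fr (V1 y) = (\prod_(p <- row k) `|a|)%:C *
    IL (row k) (fun w => Fr (tri (row k) (fun=> a) (fun _ _ => 0) w)) (V1 y).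
  apply: (IL_tri hbar) => //; [exact: uniq_row| |exact: triangular0|exact: cr_cstM].
  by move=> p _; exact: scR_cst.
have -> : \prod_(p <- row k) `|a| = `|a| ^+ m.
  by rewrite big_const_seq count_predT size_map size_iota iter_mulr_1.
congr (_ * _); apply: IL_eq; first by rewrite !size_map.
move=> ts sts; set w := upds (V1 y) _ ts; set w' := upds (UDL k.+1 y) _ ts.
have sts' : size ts = size (index_iota k.+1 n) by rewrite sts size_map.
have wrow j : (k < j < n)%N -> w (k, j) = w' (j, k).
  move=> kj; have jJ : j \in index_iota k.+1 n by rewrite mem_index_iota.
  rewrite /w /w' /row /col (@upds_map _ _ (fun j => (k, j) : sl))//; [|by move=> ? ? []|exact: iota_uniq].
  by rewrite (@upds_map _ _ (fun j => (j, k) : sl))//; [move=> ? ? []|exact: iota_uniq].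
have wo p : p \notin row k -> w p = V1 y p by move=> pr; rewrite /w upds_notin.
have wo' p : p \notin col k -> w' p = UDL k.+1 y p by move=> pr; rewrite /w' upds_notin.
have w'row j : (k < j < n)%N -> w' (k, j) = y (k, j).
  move=> kj; rewrite wo'; last by rewrite mem_col /=; lia.
  by rewrite /UDL ifF// /inb /=; lia.
have V1row j : (k < j < n)%N -> V1 y (k, j) =
    dl k j / a - \sum_(k.+1 <= i < n) y (k, i) * UDL k.+1 y (i, j).
  move=> kj; rewrite /V1 ifF; last by rewrite mem_col /=; lia.
  rewrite /V0 ifF; last by rewrite xpair_eqE; lia.
  by rewrite mem_row /= eqxx kj.
rewrite /Fr /Gk mulrA -psiD.
have -> : tri (row k) (fun=> a) (fun _ _ => 0) w = Yt k a (blk k.+1) w'.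
  apply/funext => -[i j]; rewrite /tri /Yt.
  have [|nr] := boolP ((i, j) \in row k).
    rewrite mem_row /= => /andP[/eqP -> kj]; rewrite ifF; last by rewrite /inb /=; lia.
    rewrite eqxx ifF; last by lia.
    by rewrite addr0 wrow.
  rewrite wo// /V1; have [|nc] := boolP ((i, j) \in col k).
    rewrite mem_col /= => /andP[/eqP -> ki]; rewrite ifF; last by rewrite /inb /=; lia.
    rewrite ifF; last by lia.
    by rewrite eqxx /ccol /= w'row.
  rewrite /V0 (negPf nr); have [/eqP [-> ->]|ne] := boolP ((i, j) == (k, k)).
    by rewrite ifF ?eqxx// /inb /=; lia.
  have [ijb|nb] := boolP (inb k.+1 (i, j)).
    rewrite ifF; last by move: ijb; rewrite /inb /=; lia.
    rewrite /= ifF; last by move: ijb; rewrite /inb /=; lia.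
    rewrite ifF; last by move: ijb; rewrite /inb /=; lia.
    by rewrite mem_blk ijb addr0 wo'.
  rewrite ifT ?wo'//.
  by move: nb nc nr ne; rewrite mem_col mem_row /inb xpair_eqE /=; lia.
congr (psi _ * _).
rewrite /row big_map /D.
have -> : \sum_(k.+1 <= j < n) V1 y (k, j) * Yt k a (blk k.+1) w' (k, j) =
   \sum_(k.+1 <= j < n) (dl k j * w' (j, k) -
     a * \sum_(k.+1 <= i < n) y (k, i) * UDL k.+1 y (i, j) * w' (j, k)).
  apply: congr_big_nat => // j kj; rewrite V1row// /Yt ifF; last by rewrite /inb /=; lia.
  rewrite /= eqxx ifF; last by lia.
  by rewrite -mulr_suml; set Sg := \sum_(_ <= _ < _) _; field; exact: a0.
rewrite sumrB -mulr_sumr /e1.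
under [X in _ = - X + _]eq_bigr do rewrite mulrDr.
rewrite big_split /=.
have -> : \sum_(k.+1 <= j < n) dl k j * w' (k, j) = \sum_(k.+1 <= j < n) dl k j * y (k, j).
  by apply: congr_big_nat => // j kj; rewrite w'row.
have -> : \sum_(p <- blk k.+1) w' p * (w' (k, p.1) * w' (p.2, k)) =
  \sum_(k.+1 <= j < n) \sum_(k.+1 <= i < n) y (k, i) * UDL k.+1 y (i, j) * w' (j, k).
  rewrite exchange_big /= /blk big_allpairs; apply: congr_big_nat => // i ki.
  apply: congr_big_nat => // j kj; rewrite /= w'row// wo'; last by rewrite mem_col /=; lia.
  by ring.
by ring.
Qed.

(** Both sides are integrals over the row variables. After the row substitution, whose Jacobian is
    [1], the integrands agree pointwise: the column integral is inverted on one side and the row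
    transform unfolded on the other. *)
Lemma key_identity x :
  (psi (kap k a) * (`|a| ^+ m)%:C) * FTL (blk k.+1) (Hk k a h) (UDL k.+1 x) =
  (sd2 ^+ m * \prod_(k.+1 <= j < n) `|b j|)%:C * IL (row k ++ col k) (Qk k a g) x.
Proof.
rewrite FTL_Hk//; [|exact: uniq_blk] => //; rewrite -/g !IL_cat.
have crg : cr (blk k) g by apply: (@cr_FTLg [::]).
have cGk := cr_Gk hbar kn a0 (fun q qb => qb : q \in blk k.+1) crg.
have cQ : cr (off k) (Qk k a g).
  by apply: cr_Qk => //; exact: cr_FTLg (uniq_rc _ _) _.
have cE : cr (row k) (IL (col k) (Qk k a g)).
  apply: (cr_IL hbar); first by rewrite uniq_catC uniq_rc.
  apply: crS cQ => -[i j]; rewrite mem_cat mem_col mem_row mem_off /inb /=; lia.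
have cG2 : cr (row k) (IL (col k) (Gk k a (blk k.+1) g)).
  apply: (cr_IL hbar); first by rewrite uniq_catC uniq_rc.
  by apply: crS cGk => q; rewrite !mem_cat orbC => ->.
have cG3 : cr (row k) (fun y => IL (col k) (Gk k a (blk k.+1) g) (UDL k.+1 y)).
  apply: cr_comp cG2 => [j|p pr]; first exact: scR_UDL.
  exists 1, 1%N => y; rewrite mul1r expr1; apply: le_trans (nrm_coord _ pr).
  rewrite /UDL ifF//; move: pr; case: p => i j; rewrite mem_row /inb /=; lia.
rewrite IL_comm_map; last first.
  by move=> y p t pr; apply: UDLS_upd; rewrite mem_cat pr.
set A := _ * _%:C; set B := _%:C.
transitivity (IL (row k) (fun y => A * IL (col k) (Gk k a (blk k.+1) g) (UDL k.+1 y)) x).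
  by rewrite (ILZ hbar (c := fun=> A) (uniq_row _ _) cG3).
transitivity (IL (row k) (fun y => B * IL (col k) (Qk k a g) y) x); last first.
  by rewrite (ILZ hbar (c := fun=> B) (uniq_row _ _) cE).
rewrite [RHS](IL_tri hbar (c := fun=> -1) (g := rowshift)).
- rewrite big1 ?mul1r; last by move=> *; rewrite normrN1.
  congr (IL _ _ _); apply/funext => y.
  by rewrite IL_Qk_tri FTL_row_unfold.
- exact: uniq_row.
- by move=> *; rewrite oppr_eq0 oner_eq0.
- move=> p _; apply: scRD; first exact: scR_cst.
  by apply/scRN/scR_sum => i _; apply: scRM; exact: scR_coord.
- apply: triangular_row => j y j' t kj jj'; rewrite /rowshift /=; congr (_ - _).
  by apply: congr_big_nat => // i ij; rewrite !upd_other// xpair_eqE; lia.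
- exact: cr_cstM.
Qed.

End Step.

(** For [k = 0] this is minus the primitive of the connection form at the slice point, see
    [prim_h_J]; likewise [wt] below is the square root of the orbit Jacobian [jac_v]. *)
Definition ph k x : R := - (\sum_(k <= i < n) x (i, i) * b i) +
  \sum_(k <= i < n.-1) (x (i, i) * b i.+1)^-1.
Definition fs k x : R := \sum_(k <= i < n.-1) (x (i, i.+1) + x (i.+1, i)).
Definition wt k x : R := \prod_(k <= i < n) `|x (i, i)| ^+ (n.-1 - i).
Definition tor k x := all (fun i => x (i, i) != 0) (index_iota k n).

(** The value [0] off the torus matches the extension by [0] in [coord_int]. *)
Definition lhs_int k h x : C := if tor k x then psi (ph k x) * (wt k x)%:C *
  IL (off k) (fun y => psi (- fs k y) * h (LDU k y)) x else 0.

Lemma e1_fs k x : (k < n)%N -> fs k x = e1 k x + fs k.+1 x.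
Proof.
move=> kn; rewrite /e1 dl_sum /fs; case: ifPn => kn1.
  by rewrite big_ltn//; lia.
by rewrite !big_geq ?addr0//; lia.
Qed.

Lemma ph_step k x a : (k < n)%N -> x (k, k) = a ->
  ph k x = - (a * b k) + kap k a + ph k.+1 x.
Proof.
move=> kn xa; rewrite /ph /kap dl_sum big_ltn//; case: ifPn => kn1.
  rewrite [X in _ + X = _]big_ltn ?xa; last by lia.
  by ring.
rewrite xa [X in _ + X = _]big_geq; last by lia.
rewrite [X in _ = _ + (_ + X)]big_geq; last by lia.
by ring.
Qed.

Lemma wt_step k x a : (k < n)%N -> x (k, k) = a ->
  wt k x = `|a| ^+ (n - k.+1) * wt k.+1 x.
Proof.
by move=> kn xa; rewrite /wt big_ltn// xa; congr (_ ^+ _ * _); lia.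
Qed.

Lemma LDU_step k x : (k < n)%N -> LDU k x = Yt k (x (k, k)) [::] (LDU k.+1 x).
Proof.
move=> kn; apply/funext => -[i j]; rewrite /Yt.
have [ijb /=|nb] := boolP (inb k (i, j)); last first.
  rewrite /LDU (negPf nb) ifF//; apply: contraNF nb; rewrite /inb /=; lia.
have L y i' j' : ~~ inb k.+1 (i', j') -> LDU k.+1 y (i', j') = y (i', j').
  by move=> H; rewrite /LDU (negPf H).
have s0 (f : nat -> R) : ((i == k) || (j == k))%N ->
    \sum_(k.+1 <= q < n | ((q <= i) && (q <= j))%N) f q = 0.
  by move=> ijk; rewrite big1_seq// => q; rewrite mem_index_iota; lia.
rewrite {1}/LDU ijb big_ltn_cond//= ifT; last by move: ijb; rewrite /inb /=; lia.
have [ik|ik] := eqVneq i k.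
  rewrite s0 ?ik ?eqxx// addr0; have [jk|jk] := eqVneq j k.
    by rewrite jk !L1_id mulr1 mul1r.
  by rewrite L1_id mul1r /L1 (negPf jk) L// /inb /=; lia.
have [jk|jk] := eqVneq j k.
  rewrite s0 ?jk ?eqxx ?orbT// addr0 L1_id mulr1 /L1 eq_sym (negPf ik) mulrC L// /inb /=; lia.
rewrite [LDU k.+1 x (k, i)]L; last by rewrite /inb /=; lia.
rewrite [LDU k.+1 x (j, k)]L; last by rewrite /inb /=; lia.
rewrite /LDU ifT; last by move: ijb; rewrite /inb /=; lia.
have -> : L1 x k i = x (k, i) by rewrite /L1 eq_sym (negPf ik).
have -> : L1 x j k = x (j, k) by rewrite /L1 (negPf jk).
by rewrite addrC /=; congr (_ + _); rewrite [x (k, i) * _]mulrC.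
Qed.

Lemma Hk_LDU k a h x : (k < n)%N -> x (k, k) = a ->
  Hk k a h (LDU k.+1 x) = IL (row k ++ col k) (fun y => psi (- e1 k y) * h (LDU k y)) x.
Proof.
move=> kn xa; rewrite /Hk IL_comm_map; last first.
  by move=> y p t pr; apply: LDU_upd; exact: rc_notin_inbS.
apply: IL_ext => ts _; set y := upds x _ ts.
have yk : y (k, k) = a by rewrite /y upds_notin// mem_cat mem_row mem_col /=; lia.
rewrite (LDU_step _ kn) yk; congr (psi (- _) * _).
apply: congr_big_nat => // j kj; congr (_ * (_ + _)); rewrite /LDU ifF// /inb /=; lia.
Qed.

Lemma upds_diag k x ts i : upds x (off k) ts (i, i) = x (i, i).
Proof. by rewrite upds_notin// mem_off /= eqxx. Qed.

Lemma cr_LDU_frz k (d : nat -> R) h : (forall i, (k <= i < n)%N -> d i != 0) ->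
  cr (blk k) h -> cr (off k) (fun y => psi (- fs k y) * h (LDU k (frz d y))).
Proof.
move=> d0 ch; apply: cr_psiM.
  by apply/scRN/scR_sum => i _; apply: scRD; exact: scR_coord.
apply: cr_comp ch => [j|p pk]; last exact: LDU_gb.
apply: (@scR_comp _ _ (fun y => LDU k y j)); last exact: scR_LDU.
by move=> p; rewrite /frz; case: eqP => _; [exact: scR_cst|exact: scR_coord].
Qed.

(** The variables in the row and column of the pivot are integrated innermost, which produces [Hk].
    Reordering is justified for the integrand with frozen diagonal, which coincides with the given
    one on the points visited. *)
Lemma IL_off_step k a h x : (k < n)%N -> good (blk k) h -> tor k x -> x (k, k) = a -> a != 0 ->
  IL (off k) (fun y => psi (- fs k y) * h (LDU k y)) x =
  IL (off k.+1) (fun y => psi (- fs k.+1 y) * Hk k a h (LDU k.+1 y)) x.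
Proof.
move=> kn gh tx xa a0.
pose d i := x (i, i).
have d0 i : (k <= i < n)%N -> d i != 0.
  by move=> ki; apply: (allP tx); rewrite mem_index_iota.
have cF := cr_LDU_frz d0 (good_cr gh).
have frzE y : (forall i, y (i, i) = x (i, i)) -> frz d y = y.
  by move=> yx; apply/funext => -[i j]; rewrite /frz /=; case: eqP => // ->; rewrite yx.
rewrite (@IL_ext _ _ _ _ (fun y => psi (- fs k y) * h (LDU k (frz d y)))); last first.
  by move=> ts _; rewrite frzE// => i; rewrite upds_diag.
rewrite (IL_perm hbar (perm_off kn) (uniq_off _ _) cF) IL_cat.
apply: IL_ext => ts _; set y := upds x _ ts.
have yd i : y (i, i) = x (i, i) by rewrite /y upds_diag.
rewrite Hk_LDU//; last by rewrite yd.
have rcd us i : upds y (row k ++ col k) us (i, i) = x (i, i).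
  by rewrite upds_notin ?yd// mem_cat mem_row mem_col /=; lia.
have cF2 : cr (row k ++ col k) (fun w => psi (- e1 k w) * h (LDU k (frz d w))).
  apply: (@crS _ _ (off k)).
    by move=> -[i j]; rewrite mem_cat mem_row mem_col mem_off /inb /=; lia.
  have H : scR (fs k.+1) by apply: scR_sum => i _; apply: scRD; exact: scR_coord.
  have := cr_psiM hbar H cF; congr cr; apply/funext => w; rewrite mulrA -psiD (e1_fs _ kn).
  by congr (psi _ * _); ring.
rewrite (@IL_ext _ _ _ (fun w => psi (- e1 k w) * h (LDU k w)) (fun w => psi (- e1 k w) * h (LDU k (frz d w)))); last first.
  by move=> us _; rewrite frzE// => i; rewrite rcd.
have inv w p t : p \in row k ++ col k -> psi (- fs k.+1 (upd w p t)) = psi (- fs k.+1 w).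
  rewrite mem_cat mem_row mem_col => pr; congr (psi (- _)).
  apply: congr_big_nat => // i ki; case: p pr => u v /= pr.
  by congr (_ + _); apply: upd_other; rewrite xpair_eqE; lia.
rewrite -[RHS](congr1 (fun f => f y) (ILZ hbar (uniq_rc n k) cF2 inv)).
congr (IL _ _ _); apply/funext => w; rewrite mulrA -psiD (e1_fs _ kn).
by congr (psi _ * _); ring.
Qed.

Lemma good_cstM S c h : uniq S -> good S h -> good S (fun x => c * h x).
Proof.
move=> uS gh T uT TS; rewrite FTLZ//; first exact/cr_cstM/gh.
by apply: crS (good_cr gh).
Qed.

Lemma tor_step k x : (k < n)%N -> tor k x = (x (k, k) != 0) && tor k.+1 x.
Proof. by move=> kn; rewrite /tor /index_iota -{1}(subnSK kn). Qed.

Definition kap' k a : C := psi (- (a * b k)) * (psi (kap k a) * (`|a| ^+ (n - k.+1))%:C).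

Lemma lhs_step k a h x : (k < n)%N -> good (blk k) h -> x (k, k) = a -> a != 0 ->
  IL (dg k.+1) (lhs_int k h) x =
  IL (dg k.+1) (lhs_int k.+1 (fun y => kap' k a * Hk k a h y)) x.
Proof.
move=> kn gh xa a0; apply: IL_ext => ts _; set y := upds x _ ts.
have ya : y (k, k) = a by rewrite /y upds_notin// mem_dg /=; lia.
rewrite /lhs_int; case: ifPn; last first.
  by rewrite tor_step// ya a0 /= => /negPf ->.
move=> tk; move: (tk); rewrite tor_step// => /andP[_ tk1]; rewrite tk1.
rewrite (ph_step kn ya) (wt_step kn ya) (IL_off_step kn gh tk ya a0).
pose d i := y (i, i).
have d0 i : (k.+1 <= i < n)%N -> d i != 0.
  by move=> ki; apply: (allP tk1); rewrite mem_index_iota.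
have cF := cr_LDU_frz d0 (good_cr (good_Hk kn a0 gh)).
have frzE z : (forall i, z (i, i) = y (i, i)) -> frz d z = z.
  by move=> yx; apply/funext => -[i j]; rewrite /frz /=; case: eqP => // ->; rewrite yx.
have E1 : IL (off k.+1) (fun z => psi (- fs k.+1 z) * Hk k a h (LDU k.+1 z)) y =
   IL (off k.+1) (fun z => psi (- fs k.+1 z) * Hk k a h (LDU k.+1 (frz d z))) y.
  by apply: IL_ext => us _; rewrite (frzE _ (upds_diag _ _ _)).
have E2 : IL (off k.+1) (fun z => psi (- fs k.+1 z) * (kap' k a * Hk k a h (LDU k.+1 z))) y =
   kap' k a * IL (off k.+1) (fun z => psi (- fs k.+1 z) * Hk k a h (LDU k.+1 (frz d z))) y.
  rewrite -(congr1 (fun f => f y) (ILZ hbar (c := fun=> kap' k a) (uniq_off n k.+1) cF (fun _ _ _ _ => erefl))).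
  apply: IL_ext => us _; rewrite (frzE _ (upds_diag _ _ _)); exact: mulrCA.
rewrite E1 E2; set J := IL _ _ _; rewrite rmorphM !psiD /kap'.
set u1 := psi _; set u2 := psi _; set u3 := psi _; set v1 := _%:C; set v2 := _%:C.
by ring.
Qed.

Lemma UDL_upd_diag k y t p : p != (k, k) -> UDL k (upd y (k, k) t) p = UDL k y p.
Proof.
move=> pk; rewrite /UDL; case: ifP => // _; last by rewrite upd_other.
apply: eq_bigr => q _; congr (_ * _ * _); rewrite /L1; case: eqP => // qp;
  by rewrite upd_other// xpair_eqE; apply/negP => /andP[/eqP ? /eqP ?]; apply: qp; subst.
Qed.

Lemma fs_upd_diag k y q t : fs k (upd y (q, q) t) = fs k y.
Proof.
by apply: eq_bigr => i _; congr (_ + _); apply: upd_other; rewrite xpair_eqE; lia.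
Qed.

Lemma e1_upd_diag k y t : e1 k (upd y (k, k) t) = e1 k y.
Proof.
apply: congr_big_nat => // i ki.
by congr (_ * (_ + _)); apply: upd_other; rewrite xpair_eqE; lia.
Qed.

Lemma UDL_kk k y : (k < n)%N -> UDL k y (k, k) = b k + \sum_(k.+1 <= j < n) y (k, j) * b j * y (j, k).
Proof.
move=> kn; rewrite /UDL ifT; last by rewrite /inb /=; lia.
rewrite big_ltn_cond//= leqnn /= L1_id mulr1 mul1r; congr (_ + _).
rewrite [LHS]big_nat_cond [RHS]big_nat_cond; apply: eq_big => q; first lia.
by move=> kq; congr (_ * _ * _); rewrite /L1 ifF//; lia.
Qed.

Lemma prod_step k : (k < n)%N -> \prod_(k <= i < n) `|b i| ^+ (i - k) =
  \prod_(k.+1 <= i < n) `|b i| ^+ (i - k.+1) * \prod_(k.+1 <= i < n) `|b i|.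
Proof.
move=> kn; rewrite big_ltn// subnn expr0 mul1r -big_split /=.
by apply: congr_big_nat => // i ki; rewrite -exprSr; congr (_ ^+ _); lia.
Qed.

(* Induction on the size of the block: peeling off the pivot [a = x (k, k)] replaces [h] by a
   multiple of [Hk k a h], and [key_identity] evaluates its Fourier transform. *)
Theorem lhs_rhs m k h x : (n = k + m)%N -> good (blk k) h ->
  IL (dg k) (lhs_int k h) x =
  ((`|hbar| / (2 * pi)) ^+ 'C(m, 2) * \prod_(k <= i < n) `|b i| ^+ (i - k))%:C *
  IL (off k) (fun y => psi (fs k y) * FTL (blk k) h (UDL k y)) x.
Proof.
elim: m k h x => [|m IH] k h x nk gh.
  have nE : n = k by lia.
  have ie m' : index_iota m' n = [::] \/ (m' < n)%N.
    by case: (leqP n m') => H; [left; rewrite /index_iota (_ : n - m' = 0)%N//; lia|right].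
  have i0 : index_iota k n = [::] by case: (ie k) => //; lia.
  have i1 : index_iota k n.-1 = [::] by rewrite /index_iota (_ : n.-1 - k = 0)%N//; lia.
  rewrite /dg /lhs_int /tor /off /blk /ph /wt /fs i0 i1 /= /IL /FTL /=.
  rewrite !big_nil !addr0 oppr0 psi0 expr0 !mulr1 !mul1r; congr h.
  by apply/funext => p; rewrite /LDU /UDL; have -> : inb k p = false by rewrite /inb; lia.
have kn : (k < n)%N by lia.
rewrite (dg_cons kn) IL_cons.
set Ck := (_ * _)%:C.
pose g := FTL (blk k.+1) h.
(* The right-hand integrand with the pivot as one more variable: the slot [(k, k)] now carries the
   integration variable of the Fourier transform in that entry. *)
pose Q y := psi (fs k.+1 y - y (k, k) * b k) * Qk k (y (k, k)) g y.
have crc := @cr_FTLg k h kn gh _ (uniq_rc n k) (fun _ qrc => qrc).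
have kkb : (k, k) \in blk k by rewrite mem_blk /inb /=; lia.
have sfs j : scR (fs j) by apply: scR_sum => i _; apply: scRD; exact: scR_coord.
have cQ : cr ((k, k) :: off k) Q.
  rewrite /Q /Qk; have -> : (fun y => psi (fs k.+1 y - y (k, k) * b k) *
      (psi (e1 k y - y (k, k) * (\sum_(k.+1 <= j < n) y (k, j) * b j * y (j, k))) *
         FTL (row k ++ col k) g (Wt k (y (k, k)) y))) =
     (fun y => psi (fs k.+1 y - y (k, k) * b k + (e1 k y - y (k, k) * (\sum_(k.+1 <= j < n) y (k, j) * b j * y (j, k)))) *
         FTL (row k ++ col k) g (Wt k (y (k, k)) y)).
    by apply/funext => y; rewrite mulrA -psiD.
  apply: cr_psiM.
    apply: scRD; apply: scRD.
    - exact: sfs.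
    - by apply/scRN/scRM; [exact: scR_coord|exact: scR_cst].
    - exact: scR_e1.
    - apply/scRN/scRM; first exact: scR_coord.
      apply: scR_sum => j _; apply: scRM; last exact: scR_coord.
      by apply: scRM; [exact: scR_coord|exact: scR_cst].
  apply: cr_comp crc => [j|p].
    by rewrite /Wt; case: eqP => _; [exact: scR_coord|exact: scR_UDL].
  rewrite inE => /orP[/eqP ->|].
    exists 1, 1%N => y; rewrite mul1r expr1.
    by apply: le_trans (nrm_coord _ kkb); rewrite /Wt eqxx.
  move=> /(UDL_inv_off b0) [q [Pq Eq]].
  have -> : (fun y => y p) = (fun y => q (Wt k (y (k, k)) y)).
    apply/funext => y; rewrite Eq; apply: (polyf_agree Pq) => -[i j].
    by rewrite mem_off /Wt => /andP[/= ij _]; rewrite ifF// xpair_eqE; lia.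
  apply: (polyf_gb _ _ Pq) => r; rewrite mem_off mem_blk => /andP[] //.
have kko : (k, k) \notin off k by rewrite mem_off /= eqxx.
(* The transform in the entry [(k, k)] is unfolded and its variable moved outermost; [cQ] provides
   decay in this variable and the off-diagonal ones together. *)
have RE : IL (off k) (fun y => psi (fs k y) * FTL (blk k) h (UDL k y)) x =
    intC (fun a => IL (off k) Q (upd x (k, k) a)).
  rewrite -IL_cons -(IL_perm hbar (s := off k ++ [:: (k, k)]) (s' := (k, k) :: off k)).
  - rewrite IL_cat; congr (IL _ _ _); apply/funext => y.
    have -> : FTL (blk k) h = FT (k, k) (FTL (row k ++ col k) g).
      rewrite /g -FTL_cat -[RHS]/(FTL ((k, k) :: _) h).
      by apply: FTL_perm (perm_blk kn) (uniq_blk _ _) (good_cr gh).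
    rewrite /FT IL_cons.
    have [K HK] := cr_tame (UDL k y) kkb crc.
    have HK' := tameC_psiM hbar (- UDL k y (k, k)) HK.
    rewrite -(intCZ _ HK'); congr intC; apply/funext => t.
    rewrite /Q /Qk /IL /= upd_same fs_upd_diag e1_upd_diag.
    have -> : Wt k t (upd y (k, k) t) = upd (UDL k y) (k, k) t.
      by apply/funext => p; rewrite /Wt [RHS]/upd; case: eqP => // /eqP pk; rewrite UDL_upd_diag.
    rewrite !mulrA -!psiD; congr (psi _ * _); rewrite UDL_kk// (e1_fs _ kn).
    have -> : \sum_(k.+1 <= j < n) upd y (k, k) t (k, j) * b j * upd y (k, k) t (j, k) =
        \sum_(k.+1 <= j < n) y (k, j) * b j * y (j, k).
      by apply: congr_big_nat => // j kj; rewrite !upd_other// xpair_eqE; lia.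
    by ring.
  - by rewrite perm_catC.
  - by rewrite cat_uniq uniq_off /= orbF kko.
  - by apply: crS cQ => q; rewrite mem_cat !inE orbC.
rewrite RE.
have cIQ : cr [:: (k, k)] (IL (off k) Q).
  apply: (cr_IL hbar); first by rewrite cat_uniq uniq_off /= orbF kko.
  by apply: crS cQ => q; rewrite mem_cat !inE orbC.
have [K HK] := cr_tame x (mem_head _ _) cIQ.
(* From here the pivot is a fixed nonzero number, as division by [a] requires. *)
rewrite -(intCZ Ck HK); apply: (intC_eq_off0 (tameC_cstM Ck HK)) => a a0.
set x' := upd x (k, k) a.
have xa : x' (k, k) = a by rewrite /x' upd_same.
have gH := good_Hk kn a0 gh.
have crH : cr (blk k.+1) (Hk k a h) := good_cr gH.
rewrite (lhs_step kn gh xa a0) IH; [|lia|by apply: good_cstM => //; exact: uniq_blk].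
rewrite FTLZ//; last exact: uniq_blk.
pose Q' y := psi (fs k.+1 y - a * b k) * Qk k a g y.
have cQk := cr_Qk a kn crc.
have cQ' : cr (off k) Q' by apply: cr_psiM => //; apply: scRD => //; apply/scRN/scR_cst.
pose D : C := ((`|hbar| / (2 * pi)) ^+ (n - k.+1) * \prod_(k.+1 <= j < n) `|b j|)%:C.
have rcoff : {subset row k ++ col k <= off k}.
  by move=> q qr; rewrite (perm_mem (perm_off kn)) mem_cat qr orbT.
have inv w p t : p \in row k ++ col k ->
    psi (fs k.+1 (upd w p t) - a * b k) = psi (fs k.+1 w - a * b k).
  rewrite mem_cat mem_row mem_col => pr; congr (psi (_ - _)).
  apply: congr_big_nat => // i ki; case: p pr => u v /= pr.
  by congr (_ + _); apply: upd_other; rewrite xpair_eqE; lia.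
have E y : psi (fs k.+1 y) * (kap' k a * FTL (blk k.+1) (Hk k a h) (UDL k.+1 y)) =
    D * IL (row k ++ col k) Q' y.
  have -> : psi (fs k.+1 y) * (kap' k a * FTL (blk k.+1) (Hk k a h) (UDL k.+1 y)) =
     psi (fs k.+1 y - a * b k) * ((psi (kap k a) * (`|a| ^+ (n - k.+1))%:C) *
       FTL (blk k.+1) (Hk k a h) (UDL k.+1 y)) by rewrite /kap' psiD !mulrA.
  rewrite key_identity// -/g mulrCA; congr (_ * _).
  by rewrite (ILZ hbar (uniq_rc n k) (crS rcoff cQk) inv).
rewrite (_ : (fun y => _ * _) = (fun y => D * IL (row k ++ col k) Q' y)); last exact/funext.
have cI : cr (off k.+1) (IL (row k ++ col k) Q').
  apply: (cr_IL hbar).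
    by rewrite uniq_catC -(perm_uniq (perm_off kn)) uniq_off.
  by apply: crS cQ' => q; rewrite (perm_mem (perm_off kn)) !mem_cat orbC.
rewrite (ILZ hbar (c := fun=> D) (uniq_off n k.+1) cI)// -IL_cat.
rewrite -(IL_perm hbar (perm_off kn) (uniq_off _ _) cQ') mulrA; congr (_ * _).
  have nm : (n - k.+1 = m)%N by lia.
  (* The [m] inversions of this step add [m] to the exponent. *)
  have bE : 'C(m.+1, 2) = ('C(m, 2) + m)%N by rewrite binS bin1.
  rewrite /D /Ck nm (prod_step kn) bE exprD mulrACA; exact: esym (rmorphM _ _ _).
apply: IL_ext => ts _; rewrite /Q /Q' upds_notin// xa.
by [].
Qed.

End KeyIdentity.

(** * Schwartz functions *)

Section SmoothGood.
Variables (R : realType) (hbar : R) (I : eqType).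
Hypothesis hbar0 : hbar != 0.
Local Notation C := R[i].
Local Notation Re := complex.Re.
Local Notation Im := complex.Im.
Local Notation pt := (I -> R).
Local Notation psi := (@psi R hbar).
Local Notation FT := (@FT R hbar I).
Local Notation FTL := (@FTL R hbar I).
Implicit Types (x : pt) (F : pt -> C) (s S T : seq I).

Lemma tameC_mono K K' (f : R -> C) : K <= K' -> tameC K f -> tameC K' f.
Proof.
move=> KK [h1 h2 h3]; split=> // t; apply: le_trans (h3 t) _.
by apply: ler_wpM2r => //; rewrite invr_ge0 ltW// oneDsqr_gt0.
Qed.

Lemma N1_imM (a : R) (z : C) : N1 ((0 +i* a) * z) = `|a| * N1 z.
Proof.
rewrite /N1 ReM ImM /= !mul0r sub0r add0r normrN !normrM.
by rewrite [RHS]mulrDr addrC.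
Qed.

Variables (S : seq I) (D : seq I -> pt -> C).
Hypotheses (uS : uniq S) (crD : forall s, cr S (D s)).
Hypothesis dD : forall s q x (t : R), q \in S ->
  is_derive t 1 (fun u => Re (D s (upd x q u))) (Re (D (q :: s) (upd x q t))) /\
  is_derive t 1 (fun u => Im (D s (upd x q u))) (Im (D (q :: s) (upd x q t))).

Lemma FT_D s q x : q \in S -> FT q (D (q :: s)) x = (0 +i* (hbar * x q)) * FT q (D s) x.
Proof.
move=> qS; have [K HK] := cr_tame x qS (crD (q :: s)).
have [K' HK'] := cr_tame x qS (crD s).
have HM : tameC (Num.max K K') (fun t => D (q :: s) (upd x q t)).
  by apply: tameC_mono HK; rewrite le_max lexx.
have HM' : tameC (Num.max K K') (fun t => D s (upd x q t)).
  by apply: tameC_mono HK'; rewrite le_max lexx orbT.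
rewrite /FT; apply: (@FT_derive _ hbar _ _ _ (x q) HM' HM) => t.
  exact: (dD s x t qS).1.
exact: (dD s x t qS).2.
Qed.

(** Each derivative in [q] becomes a factor [i hbar x_q], so boundedness of the transforms of all
    derivatives means decay of every order in the transformed variables. *)
Lemma N1_FTL_D T s q k x : uniq T -> {subset T <= S} -> q \in T ->
  N1 (FTL T (D (nseq k q ++ s)) x) = `|hbar * x q| ^+ k * N1 (FTL T (D s) x).
Proof.
move=> uT TS qT; elim: k => [|k IH]; first by rewrite expr0 mul1r.
rewrite exprS -mulrA -IH -N1_imM; congr N1.
have pT : perm_eq T (rem q T ++ [:: q]) by rewrite perm_sym perm_catC /= perm_sym perm_to_rem.
have ur : uniq (rem q T ++ [:: q]) by rewrite -(perm_uniq pT).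
have cT s' : cr T (D s') by apply: crS (crD s').
rewrite !(FTL_perm hbar pT uT (cT _)) !FTL_cat /=.
have -> : FTL [:: q] (D (q :: (nseq k q ++ s))) =
    fun x => (0 +i* (hbar * x q)) * FTL [:: q] (D (nseq k q ++ s)) x.
  by apply/funext => y; apply: FT_D; exact: TS.
move: (ur); rewrite cat_uniq => /and3P[u1 /hasPn nq _].
rewrite FTL_inv_mul// => [|y i t ir].
  apply: cr_FTL; first by rewrite uniq_catC.
  by apply: crS (crD _) => j; rewrite mem_cat orbC -mem_cat -(perm_mem pT) => /TS.
rewrite upd_other//; have := nq q (mem_head _ _).
by move=> nr; apply: contraNneq nr => qi; rewrite {1}qi.
Qed.

Lemma FTL_D_bounded T s : uniq T -> {subset T <= S} ->
  exists K, forall x, N1 (FTL T (D s) x) <= K.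
Proof.
move=> uT TS.
have [_ /(_ 0%N) [K HK]] : cr [::] (FTL T (D s)).
  by apply: cr_FTL; rewrite cats0//; apply: crS (crD s).
by exists K => x; have := HK x; rewrite expr0 mulr1.
Qed.

(** Decay in a transformed variable comes from the derivatives, in any other variable from the decay
    of [D [::]] itself. *)
Lemma smooth_good : good hbar S (D [::]).
Proof.
move=> T uT TS.
have cT : cr [seq q <- S | q \notin T] (FTL T (D [::])).
  apply: cr_FTL.
    rewrite cat_uniq uT filter_uniq// andbT /=; apply/hasPn => q.
    by rewrite mem_filter => /andP[].
  apply: crS (crD _) => q; rewrite mem_cat mem_filter => /orP[/TS //|/andP[]//].
split; first exact: cT.1.
apply: rd_of_coords; first exact: FTL_D_bounded.
move=> q k qS; have [qT|qT] := boolP (q \in T).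
  have [K HK] := FTL_D_bounded (nseq k q ++ [::]) uT TS.
  have hk : 0 < `|hbar| ^+ k by rewrite exprn_gt0// normr_gt0.
  exists (K / `|hbar| ^+ k) => x; rewrite ler_pdivlMr//.
  by have := HK x; rewrite N1_FTL_D// normrM exprMn mulrC mulrA mulrAC.
have [K HK] := cT.2 k; exists K => x; apply: le_trans (HK x).
apply: ler_wpM2l; first exact: N1_ge0.
apply: lerXn2r; rewrite ?nnegrE ?normr_ge0//; first exact: ltW (nrm_gt0 _ _).
by apply: nrm_coord; rewrite mem_filter qT.
Qed.

End SmoothGood.

(** * Joint continuity from coordinatewise Lipschitz bounds *)

Section Lipschitz.
Variables (R : realType) (I : eqType).
Implicit Types x y : I -> R.

Lemma lipschitz_slots (S : seq I) (g : (I -> R) -> R) (K : R) x y : 0 <= K ->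
  (forall x i t u, i \in S -> `|g (upd x i t) - g (upd x i u)| <= K * `|t - u|) ->
  (forall j, j \notin S -> x j = y j) ->
  `|g x - g y| <= K * \sum_(i <- S) `|x i - y i|.
Proof.
move=> K0; elim: S y => [|i S IH] y L xy.
  by have -> : x = y by [apply/funext => j; exact: xy]; rewrite subrr normr0 big_nil mulr0.
rewrite big_cons mulrDr; pose z := upd y i (x i).
have -> : g x - g y = (g z - g y) + (g x - g z) by ring.
apply: le_trans (ler_normD _ _) _; apply: lerD.
  by have := L y i (x i) (y i) (mem_head _ _); rewrite upd_id.
apply: le_trans (IH z _ _) _.
- by move=> x' j t u jS; apply: L; rewrite inE jS orbT.
- move=> j jS; rewrite /z /upd; case: eqP => [->//|/eqP ji].
  by apply: xy; rewrite inE negb_or ji.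
apply: ler_wpM2l => //; apply: ler_sum => j _; rewrite /z /upd.
by case: eqP => // ->; rewrite subrr normr0.
Qed.

(** [schwartzR] speaks of derivatives in coordinate directions only; bounded partial derivatives
    give these Lipschitz bounds by the mean value theorem, and they give joint continuity. *)
Lemma lipschitz_scR (S : seq I) (g : (I -> R) -> R) (K : R) : 0 <= K ->
  (forall x i t u, i \in S -> `|g (upd x i t) - g (upd x i u)| <= K * `|t - u|) ->
  (forall x y, (forall j, j \in S -> x j = y j) -> g x = g y) -> scR g.
Proof.
move=> K0 L dep x_ x cx.
(* Outside [S] the sequence is replaced by its limit, which does not change [g]; the points then
   differ in finitely many coordinates. *)
pose y_ m j := if j \in S then x_ m j else x j.
have gE m : g (x_ m) = g (y_ m) by apply: dep => j jS; rewrite /y_ jS.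
under eq_cvg do rewrite gE.
apply/cvgrPdist_le => e e0.
have : (K * \sum_(i <- S) `|x_ m i - x i|) @[m --> \oo] --> K * \sum_(i <- S) `|x i - x i|.
  have H : scR (fun z : I -> R => K * \sum_(i <- S) `|z i - x i|).
    apply: scRM; first exact: scR_cst.
    apply: scR_sum => i _ z_ z cz; apply: cvg_norm; apply: cvgB; [exact: cz|exact: cvg_cst].
  exact: H.
rewrite [X in _ --> X](_ : _ = 0); last first.
  by rewrite big1 ?mulr0// => i _; rewrite subrr normr0.
move/cvgrPdist_le => /(_ e e0); apply: filterS => m.
rewrite sub0r normrN => H; apply: le_trans (le_trans _ (ler_norm _)) H.
rewrite distrC; apply: le_trans (lipschitz_slots K0 L _) _.
  by move=> j jS; rewrite /y_ (negPf jS).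
apply: ler_wpM2l => //; rewrite le_eqVlt; apply/orP; left; apply/eqP.
by rewrite [LHS]big_seq [RHS]big_seq; apply: eq_bigr => j jS; rewrite /y_ jS.
Qed.

End Lipschitz.

Section SchwartzGood.
Variables (R : realType) (hbar : R) (n : nat).
Hypothesis hbar0 : hbar != 0.
Local Notation C := R[i].
Local Notation Re := complex.Re.
Local Notation Im := complex.Im.
Local Notation sl := (nat * nat)%type.
Local Notation pt := (sl -> R).

(* The rows are reversed: [wslots x = w X] for the matrix [X] with entries [x (i, j)]. *)
Definition wslots (x : pt) : 'M[R]_n := \matrix_(i, j) x (rev_ord i : nat, j : nat).
Definition wslot (q : sl) : option ('I_n * 'I_n) :=
  if insub q.1 is Some i then if insub q.2 is Some j then Some (rev_ord i, j) else None else None.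

Lemma wslotP (q : sl) : q \in blk n 0 -> exists i j : 'I_n,
  wslot q = Some (i, j) /\ q = (rev_ord i : nat, j : nat).
Proof.
rewrite mem_blk /inb => /andP[/andP[_ q1] /andP[_ q2]].
exists (rev_ord (Ordinal q1)), (Ordinal q2); rewrite /wslot !insubT; split=> //.
by rewrite rev_ordK; case: q q1 q2.
Qed.

Lemma wslots_upd x (i j : 'I_n) t u :
  wslots (upd x (rev_ord i : nat, j : nat) (u + t)) =
  u *: delta_mx i j + wslots (upd x (rev_ord i : nat, j : nat) t).
Proof.
apply/matrixP => k l; rewrite !mxE /upd xpair_eqE.
rewrite !(inj_eq val_inj) (inj_eq rev_ord_inj) [k == i]eq_sym [l == j]eq_sym.
rewrite [i == k]eq_sym [j == l]eq_sym.
by case: ifP => _ /=; rewrite ?mulr1 ?mulr0 ?add0r.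
Qed.

Lemma is_derive_slice (f : 'M[R]_n -> R) x (i j : 'I_n) (t : R) :
  derivable f (wslots (upd x (rev_ord i : nat, j : nat) t)) (delta_mx i j) ->
  is_derive t 1 (fun u => f (wslots (upd x (rev_ord i : nat, j : nat) u)))
    ('D_(delta_mx i j) f (wslots (upd x (rev_ord i : nat, j : nat) t))).
Proof.
move=> df; set A := wslots _.
have E : (fun u : R => u^-1 *: (((fun v => f (wslots (upd x (rev_ord i : nat, j : nat) v))) \o shift t) (u *: 1)
     - f A)) = (fun u : R => u^-1 *: ((f \o shift A) (u *: delta_mx i j) - f A)).
  by apply/funext => u /=; rewrite wslots_upd /A [u *: 1]mulr1.
have dr : derivable (fun u => f (wslots (upd x (rev_ord i : nat, j : nat) u))) t 1.
  by rewrite /derivable E.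
by apply: DeriveDef => //; rewrite /derive E.
Qed.

Lemma entry_le_norm (A : 'M[R]_n) i j : `|A i j| <= `|A|.
Proof. by rewrite [leRHS]/Num.Def.normr/= mx_normrE; exact: (le_bigmax _ (fun ij => `|A ij.1 ij.2|) (i, j)). Qed.

Lemma schwartzR_bounded (f : 'M[R]_n -> R) s : schwartzR f ->
  exists2 K, 0 <= K & forall A, `|iter_partial s f A| <= K.
Proof.
move=> /(_ s) [_ /(_ 0%N) [K HK]]; exists K => [|A].
  by apply: le_trans (HK 0); rewrite mulr_ge0// exprn_ge0// addr_ge0.
by have := HK A; rewrite expr0 mul1r.
Qed.

Lemma schwartzR_scR (f : 'M[R]_n -> R) s : schwartzR f ->
  scR (fun x => iter_partial s f (wslots x)).
Proof.
move=> sf.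
have /choice [B HB] : forall ij : 'I_n * 'I_n, exists K, 0 <= K /\ forall A, `|iter_partial (ij :: s) f A| <= K.
  by move=> ij; have [K K0 HK] := schwartzR_bounded (ij :: s) sf; exists K.
pose K := \sum_ij B ij.
have K0 : 0 <= K by apply: sumr_ge0 => ij _; exact: (HB ij).1.
apply: (@lipschitz_scR _ _ (blk n 0) _ K) => //; last first.
  move=> x y xy; congr iter_partial; apply/matrixP => i j; rewrite !mxE; apply: xy.
  by rewrite mem_blk /inb /=; have := ltn_ord j; have := ltn_ord (rev_ord i); rewrite /=; lia.
move=> x q t u /wslotP [i [j [_ ->]]].
pose g v := iter_partial s f (wslots (upd x (rev_ord i : nat, j : nat) v)).
pose dg v := iter_partial ((i, j) :: s) f (wslots (upd x (rev_ord i : nat, j : nat) v)).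
have dgP (v : R) : is_derive v 1 g (dg v) by apply: is_derive_slice; exact: (sf s).1.
have cg : continuous g.
  by move=> v; apply/differentiable_continuous/derivable1_diffP; exact: ex_derive.
have dgK v : `|dg v| <= K.
  apply: le_trans ((HB (i, j)).2 _) _; rewrite /K (bigD1 (i, j))//= lerDl.
  by apply: sumr_ge0 => ij _; exact: (HB ij).1.
wlog tu : t u / t <= u.
  by move=> H; case: (leP t u) => [/H //|/ltW /H]; rewrite distrC [`|u - t|]distrC.
have [v _ E] := MVT_segment tu (fun v _ => dgP v) (continuous_subspaceT cg).
by rewrite distrC -/(g t) -/(g u) E normrM distrC; apply: ler_wpM2r.
Qed.

Variable h : 'M[R]_n -> C.
Hypothesis sh : schwartz h.

Let D (s : seq sl) (x : pt) : C :=
  iter_partial (pmap wslot s) (fun A => Re (h A)) (wslots x) +i*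
  iter_partial (pmap wslot s) (fun A => Im (h A)) (wslots x).

Lemma cr_D s : cr (blk n 0) (D s).
Proof.
split.
  have S1 := @schwartzR_scR _ (pmap wslot s) sh.1.
  have S2 := @schwartzR_scR _ (pmap wslot s) sh.2.
  by move=> x_ x cx; split; [exact: (S1 _ _ cx)|exact: (S2 _ _ cx)].
have H q k (f : 'M[R]_n -> R) : schwartzR f -> q \in blk n 0 -> exists K, forall x,
    `|iter_partial (pmap wslot s) f (wslots x)| * `|x q| ^+ k <= K.
  move=> sf /wslotP [i [j [_ ->]]]; have [_ /(_ k) [K HK]] := sf (pmap wslot s).
  exists K => x; apply: le_trans (HK (wslots x)); rewrite mulrC; apply: ler_wpM2r => //.
  apply: lerXn2r; rewrite ?nnegrE ?normr_ge0 ?addr_ge0//.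
  apply: le_trans (_ : `|wslots x| <= _); last by rewrite lerDr.
  by have := entry_le_norm (wslots x) i j; rewrite mxE.
apply: rd_of_coords.
  have [K _ HK] := schwartzR_bounded (pmap wslot s) sh.1.
  have [K' _ HK'] := schwartzR_bounded (pmap wslot s) sh.2.
  by exists (K + K') => x; apply: lerD; [exact: HK|exact: HK'].
move=> q k qS; have [K HK] := H q k _ sh.1 qS; have [K' HK'] := H q k _ sh.2 qS.
by exists (K + K') => x; rewrite /N1 mulrDl; apply: lerD; [exact: HK|exact: HK'].
Qed.

Lemma schwartz_good : good hbar (blk n 0) (fun x => h (wslots x)).
Proof.
have -> : (fun x => h (wslots x)) = D [::].
  by apply/funext => x; rewrite /D /=; case: (h _).
apply: smooth_good => //; [exact: uniq_blk|exact: cr_D|].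
move=> s q x t /wslotP [i [j [E ->]]]; rewrite /D /=.
have -> : wslot (rev_ord i : nat, j : nat) = Some (i, j).
  have [|i' [j' [E' []]]] := @wslotP (rev_ord i : nat, j : nat).
    by rewrite mem_blk /inb /=; have := ltn_ord j; have := ltn_ord (rev_ord i); rewrite /=; lia.
  move=> e1 e2; have /rev_ord_inj ei : rev_ord i = rev_ord i' by apply: val_inj.
  by rewrite E' ei; have -> : j = j' by apply: val_inj.
by split; apply: is_derive_slice; [exact: (sh.1 _).1|exact: (sh.2 _).1].
Qed.

End SchwartzGood.

(** * Parallel transport *)

Section MxDerive.
Variable R : realType.

Definition dmx m k (P : R -> 'M[R]_(m, k)) (t : R) (P' : 'M[R]_(m, k)) :=
  forall i j, is_derive t 1 (fun s => P s i j) (P' i j).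

Lemma is_derive_unique (f : R -> R) (t a b : R) :
  is_derive t 1 f a -> is_derive t 1 f b -> a = b.
Proof. by move=> [_ <-] [_ <-]. Qed.

Lemma is_derive_bigsum (J : Type) (r : seq J) (Q : pred J) (f : J -> R -> R) (df : J -> R) (t : R) :
  (forall j, Q j -> is_derive t 1 (f j) (df j)) ->
  is_derive t 1 (fun s => \sum_(j <- r | Q j) f j s) (\sum_(j <- r | Q j) df j).
Proof.
move=> H; elim: r => [|j r IH].
  rewrite big_nil; have -> : (fun s : R => \sum_(j <- [::] | Q j) f j s) = cst 0.
    by apply/funext => s; rewrite big_nil.
  exact: is_derive_cst.
rewrite big_cons; have -> : (fun s : R => \sum_(j0 <- j :: r | Q j0) f j0 s) =
    (fun s => if Q j then f j s + \sum_(j <- r | Q j) f j s else \sum_(j <- r | Q j) f j s).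
  by apply/funext => s; rewrite big_cons.
by case: ifP => [Qj|_//]; have ? := H _ Qj; exact: is_deriveD.
Qed.

Lemma dmx_unique m k (P : R -> 'M[R]_(m, k)) t P1 P2 : dmx P t P1 -> dmx P t P2 -> P1 = P2.
Proof. by move=> d1 d2; apply/matrixP => i j; exact: is_derive_unique (d1 i j) (d2 i j). Qed.

Lemma dmx_cst m k (A : 'M[R]_(m, k)) t : dmx (fun=> A) t 0.
Proof. by move=> i j; rewrite mxE; exact: is_derive_cst. Qed.

Lemma dmxM m k l (P : R -> 'M[R]_(m, k)) (Q : R -> 'M[R]_(k, l)) t P' Q' :
  dmx P t P' -> dmx Q t Q' -> dmx (fun s => P s *m Q s) t (P' *m Q t + P t *m Q').
Proof.
move=> dP dQ i j; rewrite !mxE -big_split /=.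
have -> : (fun s => (P s *m Q s) i j) = (fun s => \sum_q P s i q * Q s q j).
  by apply/funext => s; rewrite mxE.
apply: is_derive_bigsum => q _; have ? := dP i q; have ? := dQ q j.
by apply: is_derive_eq; rewrite /GRing.scale /=; ring.
Qed.

Lemma dmx_tr m (P : R -> 'M[R]_m) t P' : dmx P t P' -> is_derive t 1 (fun s => \tr (P s)) (\tr P').
Proof. by move=> dP; apply: is_derive_bigsum => i _; exact: dP. Qed.

Lemma dmx_fchar m (P : R -> 'M[R]_m) t P' : dmx P t P' ->
  is_derive t 1 (fun s => fchar (P s)) (fchar P').
Proof. by move=> dP; apply: is_derive_bigsum => i _; apply: is_derive_bigsum => j _; exact: dP. Qed.

Lemma dmx_near m k (P Q : R -> 'M[R]_(m, k)) t P' : (\forall s \near t, P s = Q s) ->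
  dmx P t P' -> dmx Q t P'.
Proof.
move=> PQ dP i j; have := dP i j; apply: near_eq_is_derive.
by apply: filterS PQ => s ->.
Qed.

Lemma dmx_pair n (gamma : R -> 'M[R]_n * 'M[R]_n) t : derivable gamma t 1 ->
  dmx (fun s => (gamma s).1) t (derive1 gamma t).1 /\
  dmx (fun s => (gamma s).2) t (derive1 gamma t).2.
Proof.
move=> dg; rewrite derive1E.
have cg : h^-1 *: ((gamma \o shift t) (h *: 1) - gamma t) @[h --> 0^'] --> 'D_1 gamma t by exact: dg.
have H (pr : 'M[R]_n * 'M[R]_n -> 'M[R]_n) i j : continuous (fun z => pr z i j) ->
    (forall z z', pr (z - z') = pr z - pr z') -> (forall h z, pr (h *: z) = h *: pr z) ->
    is_derive t 1 (fun s => pr (gamma s) i j) (pr ('D_1 gamma t) i j).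
  move=> cp prB prZ.
  have := cvg_comp _ _ cg (cp _).
  have -> : (fun z => pr z i j) \o (fun h : R => h^-1 *: ((gamma \o shift t) (h *: 1) - gamma t)) =
    (fun h : R => h^-1 *: (((fun s => pr (gamma s) i j) \o shift t) (h *: 1) - pr (gamma t) i j)).
    by apply/funext => h /=; rewrite prZ prB !mxE.
  move=> c; apply: DeriveDef; first by apply/cvg_ex; eexists; exact: c.
  exact: cvg_lim c.
split=> i j.
  apply: (H fst) => //; move=> z.
  by apply: (@continuous_comp _ _ _ fst (fun A : 'M[R]_n => A i j)); [exact: cvg_fst|exact: coord_continuous].
apply: (H snd) => // z.
by apply: (@continuous_comp _ _ _ snd (fun A : 'M[R]_n => A i j)); [exact: cvg_snd|exact: coord_continuous].
Qed.

Lemma derivable_pair_mx n (P Q : R -> 'M[R]_n) (t : R) P' Q' : dmx P t P' -> dmx Q t Q' ->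
  derivable (fun s => (P s, Q s)) t 1 /\ derive1 (fun s => (P s, Q s)) t = (P', Q').
Proof.
move=> dP dQ.
have H (S : R -> 'M[R]_n) S' : dmx S t S' ->
    h^-1 *: ((S \o shift t) (h *: 1) - S t) @[h --> 0^'] --> S'.
  move=> dS; have dS' : derivable S t 1 by apply/derivable_mxP => i j; have [] := dS i j.
  suff <- : 'D_1 S t = S' by exact: dS'.
  by rewrite derive_mx//; apply/matrixP => i j; rewrite mxE; have [_ ->] := dS i j.
have c : h^-1 *: (((fun s => (P s, Q s)) \o shift t) (h *: 1) - (P t, Q t)) @[h --> 0^'] --> (P', Q').
  have -> : (fun h : R => h^-1 *: (((fun s => (P s, Q s)) \o shift t) (h *: 1) - (P t, Q t))) =
    (fun h : R => (h^-1 *: ((P \o shift t) (h *: 1) - P t), h^-1 *: ((Q \o shift t) (h *: 1) - Q t))) by [].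
  exact: cvg_pair (H _ _ dP) (H _ _ dQ).
split; first by apply/cvg_ex; exists (P', Q').
by rewrite derive1E; exact: cvg_lim c.
Qed.

(** Explicit paths are given by matrices of polynomials, whose C^1 regularity comes from formal
    derivation. *)
Definition pv m k (P : 'M[{poly R}]_(m, k)) (t : R) : 'M[R]_(m, k) := map_mx (horner_eval t) P.

Lemma dmx_pv m k (P : 'M[{poly R}]_(m, k)) t : dmx (pv P) t (pv (map_mx (@deriv R) P) t).
Proof.
move=> i j; have -> : (fun s => pv P s i j) = horner (P i j) by apply/funext => s; rewrite mxE.
by rewrite !mxE; exact: is_derive_poly.
Qed.

Lemma C1_path_pv n (P Q : 'M[{poly R}]_n) : C1_path (fun t => (pv P t, pv Q t)).
Proof.
split=> [t|]; first by have [] := derivable_pair_mx (dmx_pv P t) (dmx_pv Q t).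
have -> : derive1 (fun t => (pv P t, pv Q t)) =
    (fun t => (pv (map_mx (@deriv R) P) t, pv (map_mx (@deriv R) Q) t)).
  by apply/funext => t; have [] := derivable_pair_mx (dmx_pv P t) (dmx_pv Q t).
move=> t; apply: differentiable_continuous; apply/derivable1_diffP.
by have [] := derivable_pair_mx (dmx_pv (map_mx (@deriv R) P) t) (dmx_pv (map_mx (@deriv R) Q) t).
Qed.

End MxDerive.

Section Transport.
Variables (R : realType) (hbar : R) (n : nat).
Local Notation pt := (phase_space R n).
Local Notation psi := (@psi R hbar).

(** A transport path is known to lie in [S] on [[0, 1]] only. Derivability is therefore required
    along all paths, for continuity at the two end points, and the value of the derivative only
    where the path stays in [S]. *)
Definition primitive (S : set pt) (g : pt -> R) := forall gamma : R -> pt,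
  (forall t : R, derivable gamma t 1) -> forall t : R,
  derivable (fun s => g (gamma s)) t 1 /\
  ((\forall s \near t, S (gamma s)) ->
   is_derive t 1 (fun s => g (gamma s)) (\tr ((gamma t).2 *m (derive1 gamma t).1))).

Lemma constant_of_derive0 (f : R -> R) : continuous f ->
  (forall t : R, 0 < t < 1 -> is_derive t 1 f 0) -> f 1 = f 0.
Proof.
move=> cf df; apply/eqP; rewrite -subr_eq0; apply/eqP.
have df' (t : R) : t \in `]0, 1[%R -> is_derive t 1 f 0.
  by rewrite in_itv /= => t01; exact: df.
have [_ _ ->] := @MVT_segment R f (fun=> 0) 0 1 ler01 df' (continuous_subspaceT cf).
by rewrite mul0r.
Qed.

(** The product of [u] with the conjugate of [psi (g (gamma t) - g z)] has real and imaginary parts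
    with derivative [0] on []0, 1[], so it keeps its initial value [1]. *)
Lemma is_transport_psi (S : set pt) g x z c : primitive S g ->
  is_transport hbar S x z c -> c = psi (g x - g z).
Proof.
move=> pg [gamma [u [[dga _] Sg [g0 g1] hu [u0 u1]]]].
pose G (t : R) := g (gamma t) - g z.
have dG (t : R) : derivable G t 1.
  by apply: derivableB; [exact: (pg gamma dga t).1|exact: derivable_cst].
have cG : continuous G.
  by move=> t; apply/differentiable_continuous/derivable1_diffP.
pose ru t := complex.Re (u t); pose iu t := complex.Im (u t).
have cru : continuous ru.
  by move=> t; apply/differentiable_continuous/derivable1_diffP; have [[]] := hu t.
have ciu : continuous iu.
  by move=> t; apply/differentiable_continuous/derivable1_diffP; have [_ []] := hu t.
pose co t := cos (hbar * G t); pose si t := sin (hbar * G t).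
have cco : continuous co.
  move=> t; apply: (@continuous_comp _ _ _ (fun t => hbar * G t) cos); last exact: continuous_cos.
  by apply: cvgM; [exact: cvg_cst|exact: cG].
have csi : continuous si.
  move=> t; apply: (@continuous_comp _ _ _ (fun t => hbar * G t) sin); last exact: continuous_sin.
  by apply: cvgM; [exact: cvg_cst|exact: cG].
have D (t : R) : 0 < t < 1 -> let tau := \tr ((gamma t).2 *m (derive1 gamma t).1) in
   [/\ is_derive t 1 ru (- (hbar * tau * iu t)), is_derive t 1 iu (hbar * tau * ru t),
    is_derive t 1 co (- (hbar * tau * si t)) & is_derive t 1 si (hbar * tau * co t)].
  move=> /andP[t0 t1] tau.
  have near01 : \forall s \near t, S (gamma s).
    have : \forall s \near t, s \in `]0, 1[%R by apply: near_in_itvoo; rewrite in_itv /= t0.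
    by apply: filterS => s; rewrite in_itv /= => /andP[s0 s1]; apply: Sg; rewrite !ltW.
  have dg := (pg gamma dga t).2 near01.
  have dG' : is_derive t 1 G tau.
    by rewrite /G; apply: is_derive_eq; rewrite subr0.
  have [h1 h2] := hu t; rewrite ReM ImM /= !mul0r sub0r add0r in h1 h2.
  split=> //.
    by rewrite /co; apply: is_derive_eq; rewrite /GRing.scale /= /si; ring.
  by rewrite /si; apply: is_derive_eq; rewrite /GRing.scale /= /co; ring.
have E1 : ru 1 * co 1 + iu 1 * si 1 = ru 0 * co 0 + iu 0 * si 0.
  apply: (constant_of_derive0 (f := fun t => ru t * co t + iu t * si t)).
    by move=> t; apply: cvgD; apply: cvgM; [exact: cru|exact: cco|exact: ciu|exact: csi].
  move=> t t01; have [? ? ? ?] := D t t01; apply: is_derive_eq; rewrite /GRing.scale /=; ring.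
have E2 : iu 1 * co 1 - ru 1 * si 1 = iu 0 * co 0 - ru 0 * si 0.
  apply: (constant_of_derive0 (f := fun t => iu t * co t - ru t * si t)).
    by move=> t; apply: cvgB; apply: cvgM; [exact: ciu|exact: cco|exact: cru|exact: csi].
  move=> t t01; have [? ? ? ?] := D t t01; apply: is_derive_eq; rewrite /GRing.scale /=; ring.
have G0 : G 0 = 0 by rewrite /G g0 subrr.
have G1 : G 1 = g x - g z by rewrite /G g1.
have uc : u 1 * psi (- (g x - g z)) = 1.
  rewrite -G1; apply: complex_ext.
    rewrite ReM /= mulrN cosN sinN mulrN opprK -/(ru 1) -/(iu 1) E1.
    by rewrite /ru /iu u0 /co /si G0 mulr0 cos0 sin0 /= !mulr1 mulr0 addr0.
  rewrite ImM /= mulrN cosN sinN mulrN addrC -/(ru 1) -/(iu 1) E2.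
  by rewrite /ru /iu u0 /co /si G0 mulr0 cos0 sin0 /= !mulr0 mul0r subrr.
by rewrite -u1 -[LHS]mulr1 -(psiN hbar (g x - g z)) mulrCA uc mulr1.
Qed.

Lemma is_transport_path (S : set pt) g x z (gamma : R -> pt) : primitive S g ->
  C1_path gamma -> (forall t, S (gamma t)) -> gamma 0 = z -> gamma 1 = x ->
  is_transport hbar S x z (psi (g x - g z)).
Proof.
move=> pg Cg Sg g0 g1; exists gamma, (fun t => psi (g (gamma t) - g z)); split=> //.
  move=> t /=; set tau := \tr _.
  have dg : is_derive t 1 (fun s => g (gamma s)) tau.
    by apply: (pg gamma Cg.1 t).2; apply: filterE.
  split; rewrite ?ReM ?ImM /= !mul0r ?sub0r ?add0r; apply: is_derive_eq;
    rewrite /GRing.scale /=; ring.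
by rewrite g0 g1 subrr psi0.
Qed.

Lemma transport_psi (S : set pt) g x z (gamma : R -> pt) : primitive S g ->
  C1_path gamma -> (forall t, S (gamma t)) -> gamma 0 = z -> gamma 1 = x ->
  transport hbar S x z = psi (g x - g z).
Proof.
move=> pg Cg Sg g0 g1; apply: (is_transport_psi pg).
exact: (xgetPex 0 (ex_intro (is_transport hbar S x z) _ (is_transport_path pg Cg Sg g0 g1))).
Qed.

End Transport.

(** * Unipotent matrices and the moment map *)

Section Unipotent.
Variables (R : realType) (n : nat).
Local Notation M := 'M[R]_n.
Implicit Types (u v X : M).

Lemma NgroupP u : Ngroup u <-> (forall i j : 'I_n, (j < i)%N -> u i j = 0) /\ forall i, u i i = 1.
Proof.
split=> [H|[H1 H2] i j ji].
  split=> [i j ji|i].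
    have := H i j (ltnW ji); rewrite !mxE (_ : (i == j) = false) ?subr0//.
    by apply/negbTE; rewrite neq_ltn ji orbT.
  by have /eqP := H i i (leqnn _); rewrite !mxE eqxx subr_eq0 => /eqP.
rewrite !mxE; case: eqP => [<-|/eqP ij]; first by rewrite H2 subrr.
by rewrite H1 ?subr0// ltn_neqAle ji andbT eq_sym.
Qed.

Lemma Ngroup1 : Ngroup (1%:M : M).
Proof. by move=> i j _; rewrite subrr mxE. Qed.

Lemma NgroupD X : strict_upper X -> Ngroup (1%:M + X).
Proof. by move=> sX i j ji; rewrite addrC addKr; exact: sX. Qed.

Lemma mulmx_N (X : M) u i j : Ngroup u ->
  (X *m u) i j = X i j + \sum_(k < n | (k < j)%N) X i k * u k j.
Proof.
move=> /NgroupP [u0 u1]; rewrite mxE (bigD1 j)//= u1 mulr1; congr (_ + _).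
rewrite (bigID (fun k : 'I_n => (k < j)%N)) /= [X in _ + X]big1 ?addr0; last first.
  move=> k /andP[kj]; rewrite -leqNgt => jk; rewrite u0 ?mulr0// ltn_neqAle jk andbT eq_sym; exact: kj.
by apply: eq_bigl => k; case: (ltnP k j) => kj; rewrite ?andbF// andbT neq_ltn kj.
Qed.

Lemma N_mulmx u (X : M) i j : Ngroup u ->
  (u *m X) i j = X i j + \sum_(k < n | (i < k)%N) u i k * X k j.
Proof.
move=> /NgroupP [u0 u1]; rewrite mxE (bigD1 i)//= u1 mul1r; congr (_ + _).
rewrite (bigID (fun k : 'I_n => (i < k)%N)) /= [X in _ + X]big1 ?addr0; last first.
  move=> k /andP[ki]; rewrite -leqNgt => ik; rewrite u0 ?mul0r// ltn_neqAle ik andbT; exact: ki.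
by apply: eq_bigl => k; case: (ltnP i k) => kj; rewrite ?andbF// andbT neq_ltn kj orbT.
Qed.

Lemma NgroupM u v : Ngroup u -> Ngroup v -> Ngroup (u *m v).
Proof.
move=> Nu Nv; have [u0 u1] := (NgroupP u).1 Nu; have [v0 v1] := (NgroupP v).1 Nv.
apply/NgroupP; split=> [i j ji|i]; rewrite mulmx_N//.
  rewrite u0// add0r big1// => k kj; rewrite u0 ?mul0r//; exact: ltn_trans ji.
by rewrite u1 big1 ?addr0// => k ki; rewrite u0 ?mul0r.
Qed.

Lemma det_N u : Ngroup u -> \det u = 1.
Proof.
move=> /NgroupP [u0 u1]; rewrite -det_tr det_trig; last first.
  by apply/is_trig_mxP => i j ij; rewrite mxE u0.
by rewrite big1// => i _; rewrite mxE u1.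
Qed.

Lemma unit_N u : Ngroup u -> u \in unitmx.
Proof. by move=> Nu; rewrite unitmxE det_N// unitr1. Qed.

Lemma invmx_N u : Ngroup u -> invmx u = \adj u.
Proof. by move=> Nu; rewrite /invmx unit_N// det_N// invr1 scale1r. Qed.

Lemma NgroupV u : Ngroup u -> Ngroup (invmx u).
Proof.
move=> Nu; have W : invmx u *m u = 1%:M by rewrite mulVmx// unit_N.
have E i j : (invmx u) i j = (i == j)%:R - \sum_(k < n | (k < j)%N) (invmx u) i k * u k j.
  by have := congr1 (fun A : M => A i j) W; rewrite mulmx_N// mxE => <-; rewrite addrK.
have W0 m (i j : 'I_n) : (j < m)%N -> (j < i)%N -> (invmx u) i j = 0.
  elim: m i j => [//|m IH] i j jm ji; rewrite E big1 ?subr0; last first.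
    by move=> k kj; rewrite IH ?mul0r//; [apply: leq_trans kj _|exact: ltn_trans ji].
  by rewrite (_ : (i == j) = false)//; apply/negbTE; rewrite neq_ltn ji orbT.
apply/NgroupP; split=> [i j ji|i]; first exact: W0 (ltnSn j) ji.
by rewrite E eqxx big1 ?subr0// => k ki; rewrite (W0 k.+1) ?mul0r.
Qed.

Lemma su_mulN X u : strict_upper X -> Ngroup u -> strict_upper (X *m u).
Proof.
move=> sX Nu i j ji; rewrite mulmx_N// sX// add0r big1// => k kj.
by rewrite sX ?mul0r//; apply: ltnW; exact: leq_trans ji.
Qed.

Lemma su_Nmul X u : strict_upper X -> Ngroup u -> strict_upper (u *m X).
Proof.
move=> sX Nu i j ji; rewrite N_mulmx// sX// add0r big1// => k ik.
by rewrite sX ?mulr0//; apply: ltnW; exact: leq_ltn_trans ik.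
Qed.

Lemma fcharZ c X : fchar (c *: X) = c * fchar X.
Proof.
rewrite /fchar mulr_sumr; apply: eq_bigr => i _; rewrite mulr_sumr.
by apply: eq_bigr => j _; rewrite mxE.
Qed.

Lemma fchar1 : fchar (1%:M : M) = 0.
Proof.
rewrite /fchar big1// => i _; rewrite big1// => j /eqP ji; rewrite mxE.
by case: eqP => // ij; move: ji; rewrite ij => /eqP; rewrite -[X in X == _]addn0 -addn1 eqn_add2l.
Qed.

Lemma fchar_mulN X u : strict_upper X -> Ngroup u -> fchar (X *m u) = fchar X.
Proof.
move=> sX Nu; apply: eq_bigr => i _; apply: eq_bigr => j /eqP ji.
rewrite mulmx_N// big1 ?addr0// => k kj; rewrite sX ?mul0r//.
by move: kj; rewrite ji ltnS.
Qed.

Lemma fchar_Nmul X u : strict_upper X -> Ngroup u -> fchar (u *m X) = fchar X.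
Proof.
move=> sX Nu; apply: eq_bigr => i _; apply: eq_bigr => j /eqP ji.
rewrite N_mulmx// big1 ?addr0// => k ik; rewrite sX ?mulr0//.
by rewrite ji.
Qed.

Lemma mxtraceB (A B : M) : \tr (A - B) = \tr A - \tr B.
Proof. exact: raddfB. Qed.

(** Setting one of [X1], [X2] to [0] separates the conditions. They are affine in the first
    component, so the points of [M_ff] over a given second component form an affine space. *)
Lemma M_ffP (z : phase_space R n) : M_ff z <->
  (forall X, strict_upper X -> \tr (z.2 *m z.1 *m X) = fchar X) /\
  (forall X, strict_upper X -> \tr (z.1 *m z.2 *m X) = fchar X).
Proof.
have s0 : strict_upper (0 : M) by move=> i j _; rewrite mxE.
have f0 : fchar (0 : M) = 0 by rewrite -[0](scale0r 0) fcharZ mul0r.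
have E X1 X2 : moment z X1 X2 = \tr (z.2 *m z.1 *m X2) - \tr (z.1 *m z.2 *m X1).
  rewrite /moment mulmxBr mxtraceB !mulmxA; congr (_ - _).
  by rewrite mxtrace_mulC mulmxA.
split=> [H|[H1 H2] X1 X2 s1 s2]; last by rewrite E H1// H2// addrC.
split=> X sX.
  by have := H 0 X s0 sX; rewrite E !mulmx0 mxtrace0 f0 subr0 oppr0 add0r.
by have := H X 0 sX s0; rewrite E !mulmx0 mxtrace0 f0 sub0r addr0 => /oppr_inj.
Qed.

Lemma tr_conj (A u X : M) : \tr (invmx u *m A *m u *m X) = \tr (A *m (u *m X *m invmx u)).
Proof. by rewrite -!mulmxA mxtrace_mulC !mulmxA. Qed.

Lemma su_conj u X : Ngroup u -> strict_upper X -> strict_upper (u *m X *m invmx u).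
Proof. by move=> Nu sX; apply: su_mulN; [exact: su_Nmul|exact: NgroupV]. Qed.

Lemma fchar_conj u X : Ngroup u -> strict_upper X -> fchar (u *m X *m invmx u) = fchar X.
Proof.
by move=> Nu sX; rewrite fchar_mulN ?fchar_Nmul//; [exact: su_Nmul|exact: NgroupV].
Qed.

Lemma M_ff_act (z : phase_space R n) u v : Ngroup u -> Ngroup v -> M_ff z -> M_ff (act z (u, v)).
Proof.
move=> Nu Nv /M_ffP [H1 H2]; apply/M_ffP; split=> X sX; rewrite /act /=.
  have -> : invmx v *m z.2 *m u *m (invmx u *m z.1 *m v) = invmx v *m (z.2 *m z.1) *m v.
    by rewrite !mulmxA mulmxK ?unit_N.
  by rewrite tr_conj H1 ?fchar_conj//; exact: su_conj.
have -> : invmx u *m z.1 *m v *m (invmx v *m z.2 *m u) = invmx u *m (z.1 *m z.2) *m u.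
  by rewrite !mulmxA mulmxK ?unit_N.
by rewrite tr_conj H2 ?fchar_conj//; exact: su_conj.
Qed.

Lemma M_ff_affine (A0 A1 B : M) t : M_ff (A0, B) -> M_ff (A1, B) -> M_ff (A0 + t *: (A1 - A0), B).
Proof.
move=> /M_ffP [/= H1 H2] /M_ffP [/= H3 H4]; apply/M_ffP; split=> X sX /=.
  rewrite mulmxDr mulmxDl mxtraceD -scalemxAr -scalemxAl mxtraceZ mulmxBr mulmxBl mxtraceB.
  by rewrite H1// H3// subrr mulr0 addr0.
rewrite !mulmxDl mxtraceD -!scalemxAl mxtraceZ !mulmxBl mxtraceB.
by rewrite H2// H4// subrr mulr0 addr0.
Qed.

Lemma act1 (z : phase_space R n) : act z (1%:M, 1%:M) = z.
Proof. by case: z => A B; rewrite /act /= invmx1 !mul1mx !mulmx1. Qed.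

Lemma actK (z : phase_space R n) u v : Ngroup u -> Ngroup v ->
  act (act z (u, v)) (invmx u, invmx v) = z.
Proof.
case: z => A B Nu Nv; rewrite /act /= !invmxK !mulmxA.
by rewrite !mulmxV ?unit_N// !mul1mx !mulmxK ?unit_N.
Qed.

(** The unipotent matrices form an affine space; the segment runs from [u] at time [0] to the
    identity at time [1]. *)
Definition seg u (t : R) : M := 1%:M + (1 - t) *: (u - 1%:M).

Lemma seg0 u : seg u 0 = u.
Proof. by rewrite /seg subr0 scale1r addrC subrK. Qed.
Lemma seg1 u : seg u 1 = 1%:M.
Proof. by rewrite /seg subrr scale0r addr0. Qed.
Lemma Ngroup_seg u t : Ngroup u -> Ngroup (seg u t).
Proof. by move=> Nu; apply: NgroupD => i j ji; rewrite mxE Nu// mulr0. Qed.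

(** The path is polynomial in [t] because the inverse of a unipotent matrix is its adjugate. It
    moves affinely from [A0] to [A1] and along the orbit at the same time, and so can join points
    lying over different components of the torus. *)
Lemma C1_act_path (A0 A1 B u v : M) : Ngroup u -> Ngroup v ->
  C1_path (fun t => act (A0 + t *: (A1 - A0), B) (seg u t, seg v t) : phase_space R n).
Proof.
move=> Nu Nv.
pose sp (u : M) : 'M[{poly R}]_n := 1%:M + (1 - 'X) *: map_mx polyC (u - 1%:M).
pose cp (A : M) : 'M[{poly R}]_n := map_mx polyC A.
have spE u' t : pv (sp u') t = seg u' t.
  apply/matrixP => i j; rewrite !mxE /horner_eval !hornerE.
  by case: (i == j); rewrite !hornerE.
have cpE A t : pv (cp A) t = A by apply/matrixP => i j; rewrite !mxE /horner_eval hornerC.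
have pvM (P Q : 'M[{poly R}]_n) t : pv (P *m Q) t = pv P t *m pv Q t by rewrite /pv map_mxM.
have pvA (P : 'M[{poly R}]_n) t : pv (\adj P) t = \adj (pv P t) by rewrite /pv map_mx_adj.
have := C1_path_pv (\adj (sp u) *m (cp A0 + 'X *: cp (A1 - A0)) *m sp v) (\adj (sp v) *m cp B *m sp u).
congr C1_path; apply/funext => t.
rewrite !pvM !pvA !spE cpE /act /= !invmx_N; [|exact: Ngroup_seg|exact: Ngroup_seg].
congr (_ *m _ *m _, _); apply/matrixP => i j; rewrite !mxE /horner_eval.
by rewrite !hornerE.
Qed.

End Unipotent.

(** * Coordinates on the orbits and primitives of the connection form *)

Section OrbitCoordinates.
Variables (R : realType) (n : nat).
Local Notation M := 'M[R]_n.
Local Notation sl := (nat * nat)%type.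
Local Notation pt := (sl -> R).
Implicit Types (U V A B X : M) (a b : 'rV[R]_n) (x : pt).

Definition mxe A (i j : nat) : R :=
  if insub i is Some i' then if insub j is Some j' then A i' j' else 0 else 0.
Definition rve a (i : nat) : R := if insub i is Some i' then a 0 i' else 0.

Lemma mxeE A (i j : 'I_n) : mxe A i j = A i j.
Proof. by rewrite /mxe !valK. Qed.
Lemma rveE a (i : 'I_n) : rve a i = a 0 i.
Proof. by rewrite /rve valK. Qed.

(* [U] is stored below the diagonal and [w V w] above it, both transposed, so that [V w a U] and
   [U b w V] become [LDU] and [UDL] ([VwaU], [UbwV]). *)
Definition Uof x : M := \matrix_(i, j) if i == j then 1 else if (i < j)%N then x (j : nat, i : nat) else 0.
Definition Vof x : M := \matrix_(i, j) if i == j then 1 else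
  if (i < j)%N then x (rev_ord j : nat, rev_ord i : nat) else 0.
Definition slUV U V : pt := fun p => if (p.2 < p.1)%N then mxe U p.2 p.1 else
  if (p.1 < p.2)%N then mxe V (n - p.2.+1) (n - p.1.+1) else 0.

Lemma Ngroup_Uof x : Ngroup (Uof x).
Proof.
apply/NgroupP; split=> [i j ji|i]; rewrite mxE ?eqxx//.
by rewrite ifF ?ifF//; [apply/negbTE; rewrite -leqNgt ltnW|apply/negbTE; rewrite neq_ltn ji orbT].
Qed.

Lemma Ngroup_Vof x : Ngroup (Vof x).
Proof.
apply/NgroupP; split=> [i j ji|i]; rewrite mxE ?eqxx//.
by rewrite ifF ?ifF//; [apply/negbTE; rewrite -leqNgt ltnW|apply/negbTE; rewrite neq_ltn ji orbT].
Qed.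

Lemma ltn_rev (i j : 'I_n) : (rev_ord i < rev_ord j)%N = (j < i)%N.
Proof. by rewrite /=; have := ltn_ord i; have := ltn_ord j; lia. Qed.

Lemma Uof_slUV U V : Ngroup U -> Uof (slUV U V) = U.
Proof.
move=> /NgroupP [u0 u1]; apply/matrixP => i j; rewrite mxE.
case: eqP => [->|/eqP ij]; first by rewrite u1.
case: ltnP => ij'; first by rewrite /slUV /= ij' mxeE.
by rewrite u0// ltn_neqAle ij' andbT eq_sym.
Qed.

Lemma Vof_slUV U V : Ngroup V -> Vof (slUV U V) = V.
Proof.
move=> /NgroupP [u0 u1]; apply/matrixP => i j; rewrite mxE.
case: eqP => [->|/eqP ij]; first by rewrite u1.
case: ltnP => ij'; last by rewrite u0// ltn_neqAle ij' andbT eq_sym.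
rewrite /slUV ifF; last by apply/negbTE; rewrite -leqNgt ltnW// ltn_rev.
rewrite ifT ?ltn_rev//.
have r (k : 'I_n) : (n - (rev_ord k).+1 = k)%N by rewrite -[RHS](congr1 val (rev_ordK k)).
by rewrite !r mxeE.
Qed.

Lemma mul_slice_h A b i k : (A *m slice_h b) i k = A i (rev_ord k) * b 0 (rev_ord k).
Proof.
rewrite /slice_h mulmxA mxE (bigD1 (rev_ord k))//= big1 ?addr0; last first.
  move=> j jk; rewrite [wmx _ _ _ _]mxE (_ : (k == rev_ord j) = false) ?mulr0//.
  by apply: contraNF jk => /eqP ->; rewrite rev_ordK.
by rewrite [wmx _ _ _ _]mxE rev_ordK eqxx mulr1 mul_mx_diag mxE.
Qed.

Lemma slice_vE a : slice_v a = slice_h (\row_i a 0 (rev_ord i)).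
Proof.
apply/matrixP => i j; rewrite /slice_v /slice_h mul_mx_diag mul_diag_mx !mxE.
case: eqP => [->|_]; last by rewrite mul0r mulr0.
by rewrite mul1r mulr1.
Qed.

Lemma mul_slice_v A a i k : (A *m slice_v a) i k = A i (rev_ord k) * a 0 k.
Proof. by rewrite slice_vE mul_slice_h mxE rev_ordK. Qed.

Lemma UbwV x b i j : (Uof x *m slice_h b *m Vof x) i j = UDL n (rve b) 0 x (rev_ord j : nat, i : nat).
Proof.
rewrite /UDL ifT; last by rewrite /inb; have := ltn_ord i; have := ltn_ord (rev_ord j); rewrite /=; lia.
rewrite mxE (reindex_inj rev_ord_inj) /= big_mkord [RHS]big_mkcond /=.
apply: eq_bigr => q _; rewrite mul_slice_h rev_ordK rveE.
rewrite !mxE rev_ordK /L1.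
have -> : (rev_ord q == j) = (rev_ord j == q) by rewrite -(inj_eq rev_ord_inj) rev_ordK eq_sym.
have -> : (rev_ord q < j)%N = (rev_ord j < q)%N by rewrite -[q in RHS]rev_ordK ltn_rev.
rewrite -!val_eqE /=.
by case: (ltngtP q i) => _; case: (ltngtP (n - j.+1)%N q) => _ /=; ring.
Qed.

Lemma VwaU x a i j : (forall k : 'I_n, x (k : nat, k : nat) = a 0 k) ->
  (Vof x *m slice_v a *m Uof x) i j = LDU n 0 x (rev_ord i : nat, j : nat).
Proof.
move=> xa.
rewrite /LDU ifT; last by rewrite /inb; have := ltn_ord j; have := ltn_ord (rev_ord i); rewrite /=; lia.
rewrite mxE big_mkord [RHS]big_mkcond /=.
apply: eq_bigr => q _; rewrite mul_slice_v xa.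
rewrite !mxE rev_ordK /L1.
have -> : (i == rev_ord q) = (q == rev_ord i) by rewrite -(inj_eq rev_ord_inj) rev_ordK eq_sym.
have -> : (i < rev_ord q)%N = (q < rev_ord i)%N by rewrite -[i in LHS]rev_ordK ltn_rev.
rewrite -!val_eqE /=.
by case: (ltngtP q (n - i.+1)%N) => _; case: (ltngtP q j) => _ /=; ring.
Qed.

Section Leaf.
Variable b : 'rV[R]_n.
Hypothesis tb : torus b.

Lemma rve_neq0 i : (i < n)%N -> rve b i != 0.
Proof. by move=> im; have := tb (Ordinal im); rewrite -rveE. Qed.

(** Polynomials recovering the triangular factors are fixed once for all. Being defined on all
    matrices they extend the factors beyond the orbit, which [primitive] needs along arbitrary
    paths. *)
Lemma slot_poly_ex : exists pf : sl -> pt -> R, forall p, p \in off n 0 ->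
  polyf (fun r => r \in off n 0) (pf p) /\ forall x, x p = pf p (UDL n (rve b) 0 x).
Proof.
have H (p : sl) : exists f : pt -> R, p \in off n 0 ->
    polyf (fun r => r \in off n 0) f /\ forall x, x p = f (UDL n (rve b) 0 x).
  have [po|_] := boolP (p \in off n 0); last by exists (fun=> 0).
  by have [f Hf] := UDL_inv_off rve_neq0 po; exists f.
by have [pf Hpf] := choice H; exists pf.
Qed.

Definition slot_poly : sl -> pt -> R := projT1 (cid slot_poly_ex).
Lemma slot_polyP p : p \in off n 0 ->
  polyf (fun r => r \in off n 0) (slot_poly p) /\ forall x, x p = slot_poly p (UDL n (rve b) 0 x).
Proof. by rewrite /slot_poly; case: cid => /= f; apply. Qed.

(** The transpose of [B w]. In these coordinates [U b w V] is [UDL], and [tr (B A)] is the plain sum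
    of products with the slots of [A] ([sum_slB]). *)
Definition slB B : pt := fun p => mxe B p.2 (n - p.1.+1).
Definition Uf B : M := Uof (fun p => slot_poly p (slB B)).
Definition Vf B : M := Vof (fun p => slot_poly p (slB B)).

Lemma off_ord (i j : 'I_n) : i != j -> (i : nat, j : nat) \in off n 0.
Proof. by move=> ij; rewrite mem_off /inb /= !ltn_ord !andbT; exact: ij. Qed.

Lemma offP p : p \in off n 0 -> exists i j : 'I_n, p = (i : nat, j : nat) /\ i != j.
Proof.
rewrite mem_off /inb => /andP[p12 /andP[/andP[_ p1] /andP[_ p2]]].
by exists (Ordinal p1), (Ordinal p2); case: p p12 p1 p2.
Qed.

Lemma slB_UDL x p : p \in off n 0 ->
  slB (Uof x *m slice_h b *m Vof x) p = UDL n (rve b) 0 x p.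
Proof.
move=> /offP [i [j [-> ij]]]; rewrite /slB /= -[(n - i.+1)%N]/(nat_of_ord (rev_ord i)) mxeE UbwV.
by rewrite rev_ordK.
Qed.

Lemma slot_poly_slB x p : p \in off n 0 ->
  slot_poly p (slB (Uof x *m slice_h b *m Vof x)) = x p.
Proof.
move=> po; have [Pp ->] := slot_polyP po; apply: (polyf_agree Pp) => q qo.
exact: slB_UDL.
Qed.

Lemma UfVf_of x : Uf (Uof x *m slice_h b *m Vof x) = Uof x /\ Vf (Uof x *m slice_h b *m Vof x) = Vof x.
Proof.
split; apply/matrixP => i j; rewrite /Uf /Vf [LHS]mxE [RHS]mxE; case: eqP => // /eqP ij; case: ifP => // _.
  by rewrite slot_poly_slB// off_ord// eq_sym.
by rewrite slot_poly_slB// off_ord// (inj_eq rev_ord_inj) eq_sym.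
Qed.

Lemma UfVf U V : Ngroup U -> Ngroup V ->
  Uf (U *m slice_h b *m V) = U /\ Vf (U *m slice_h b *m V) = V.
Proof.
move=> NU NV; have := UfVf_of (slUV U V).
by rewrite (Uof_slUV _ NU) (Vof_slUV _ NV).
Qed.

Lemma derivable_entries (W : R -> M) (t : R) :
  (forall i j, derivable (fun s => W s i j) t 1) -> exists W', dmx W t W'.
Proof.
move=> dW; exists (\matrix_(i, j) 'D_1 (fun s => W s i j) t) => i j.
by rewrite mxE; apply/derivableP.
Qed.

Lemma derivable_UfVf (B : R -> M) (t : R) B' : dmx B t B' ->
  (exists U', dmx (fun s => Uf (B s)) t U') /\ (exists V', dmx (fun s => Vf (B s)) t V').
Proof.
move=> dB.
have H p : p \in off n 0 -> derivable (fun s => slot_poly p (slB (B s))) t 1.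
  move=> po; have [Pp _] := slot_polyP po; apply: (polyf_derivable Pp) => q /offP [i [j [-> _]]].
  rewrite /slB /= -[(n - i.+1)%N]/(nat_of_ord (rev_ord i)).
  by under eq_fun do rewrite mxeE; have [] := dB j (rev_ord i).
split; apply: derivable_entries => i j; rewrite /Uf /Vf.
  under eq_fun do rewrite mxE; case: eqP => [_|/eqP ij]; first exact: derivable_cst.
  case: ifP => _; last exact: derivable_cst.
  by apply: H; rewrite off_ord// eq_sym.
under eq_fun do rewrite mxE; case: eqP => [_|/eqP ij]; first exact: derivable_cst.
case: ifP => _; last exact: derivable_cst.
by apply: H; rewrite off_ord// (inj_eq rev_ord_inj) eq_sym.
Qed.

Lemma su_derive (W : R -> M) t W' : (forall s, Ngroup (W s)) -> dmx W t W' -> strict_upper W'.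
Proof.
move=> NW dW i j ji; apply: is_derive_unique (dW i j) _.
have -> : (fun s => W s i j) = cst ((i == j)%:R).
  apply/funext => s; have [w0 w1] := (NgroupP _).1 (NW s); case: eqP => [<-|/eqP ij]; first by rewrite w1.
  by rewrite w0// ltn_neqAle ji andbT eq_sym.
exact: is_derive_cst.
Qed.

(** From [B = U b w V] one gets [B' = (U' U^-1) B + B (V^-1 V')], and [f] is unchanged when a
    strictly upper triangular matrix is multiplied by a unipotent one. *)
Lemma orbit_derive (B : R -> M) (t : R) B' : dmx B t B' ->
  (\forall s \near t, same_orbit (slice_h b) (B s)) ->
  exists X1 X2, [/\ strict_upper X1, strict_upper X2, B' = X1 *m B t + B t *m X2,
    is_derive t 1 (fun s => fchar (Uf (B s))) (fchar X1) &
    is_derive t 1 (fun s => fchar (Vf (B s))) (fchar X2)].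
Proof.
move=> dB orb; have [[U' dU] [V' dV]] := derivable_UfVf dB.
have NU s : Ngroup (Uf (B s)) by exact: Ngroup_Uof.
have NV s : Ngroup (Vf (B s)) by exact: Ngroup_Vof.
have sU := su_derive NU dU; have sV := su_derive NV dV.
have fac s : same_orbit (slice_h b) (B s) -> B s = Uf (B s) *m slice_h b *m Vf (B s).
  by move=> [U [V [hU hV E]]]; rewrite {2 3}E; have [-> ->] := UfVf hU hV.
have facE : \forall s \near t, Uf (B s) *m slice_h b *m Vf (B s) = B s.
  by apply: filterS orb => s /fac.
have dB2 := dmx_near facE (dmxM (dmxM dU (dmx_cst (slice_h b) t)) dV).
have Et := fac t (nbhs_singleton orb).
exists (U' *m invmx (Uf (B t))), (invmx (Vf (B t)) *m V'); split.
- by apply: su_mulN => //; exact: NgroupV.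
- by apply: su_Nmul => //; exact: NgroupV.
- rewrite (dmx_unique dB dB2) mulmx0 addr0; congr (_ + _).
    by rewrite {3}Et !mulmxA mulmxKV ?unit_N.
  by rewrite [X in _ = X *m _]Et !mulmxA mulmxK ?unit_N.
- by rewrite fchar_mulN//; [exact: dmx_fchar|exact: NgroupV].
- by rewrite fchar_Nmul//; [exact: dmx_fchar|exact: NgroupV].
Qed.

Definition prim_v (z : phase_space R n) : R := fchar (Uf z.1) + fchar (Vf z.1).
Definition prim_h (z : phase_space R n) : R := \tr (z.2 *m z.1) - fchar (Uf z.2) - fchar (Vf z.2).

Lemma same_orbit_trans A B C : same_orbit A B -> same_orbit B C -> same_orbit A C.
Proof.
move=> [u1 [u2 [N1 N2 ->]]] [v1 [v2 [N3 N4 ->]]]; exists (v1 *m u1), (u2 *m v2).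
by split; [exact: NgroupM|exact: NgroupM|rewrite !mulmxA].
Qed.

Lemma derivable_fchar_UfVf (B : R -> M) (t : R) B' : dmx B t B' ->
  derivable (fun s => fchar (Uf (B s))) t 1 /\ derivable (fun s => fchar (Vf (B s))) t 1.
Proof.
move=> dB; have [[U' dU] [V' dV]] := derivable_UfVf dB.
by split; [have [] := dmx_fchar dU|have [] := dmx_fchar dV].
Qed.

(** For [A' = X1 A + A X2] the connection form is [tr (A B X1) + tr (B A X2)], and the moment
    condition evaluates it to [f X1 + f X2]. *)
Lemma primitive_Gv (x : phase_space R n) : same_orbit (slice_h b) x.1 -> primitive (leaf_Gv x) prim_v.
Proof.
move=> ox gamma dg t; have [d1 d2] := dmx_pair (dg t).
split; first by have [? ?] := derivable_fchar_UfVf d1; exact: derivableD.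
move=> near_leaf.
have [|X1 [X2 [s1 s2 E e1 e2]]] := orbit_derive d1.
  by apply: filterS near_leaf => s [_]; exact: same_orbit_trans.
have [/M_ffP [H1 H2] _] := nbhs_singleton near_leaf.
apply: is_derive_eq; rewrite E mulmxDr mxtraceD !mulmxA H1// -(H2 X1)//; congr (_ + _).
by rewrite [RHS]mxtrace_mulC mulmxA.
Qed.

(** [tr (B A')] is the derivative of [tr (B A)] minus [tr (B' A)]; for [B' = X1 B + B X2] the moment
    condition evaluates the latter to [f X1 + f X2]. *)
Lemma primitive_Gh (x : phase_space R n) : same_orbit (slice_h b) x.2 -> primitive (leaf_Gh x) prim_h.
Proof.
move=> ox gamma dg t; have [d1 d2] := dmx_pair (dg t).
have dtr := dmx_tr (dmxM d2 d1).
split.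
  have [dU dV] := derivable_fchar_UfVf d2; have [dt _] := dtr.
  by apply: derivableB dV; exact: derivableB dt dU.
move=> near_leaf.
have [|X1 [X2 [s1 s2 E e1 e2]]] := orbit_derive d2.
  by apply: filterS near_leaf => s [_]; exact: same_orbit_trans.
have [/M_ffP [H1 H2] _] := nbhs_singleton near_leaf.
apply: is_derive_eq; rewrite E mxtraceD mulmxDl mxtraceD.
have -> : \tr (X1 *m (gamma t).2 *m (gamma t).1) = fchar X1.
  by rewrite -mulmxA mxtrace_mulC H1.
have -> : \tr ((gamma t).2 *m X2 *m (gamma t).1) = fchar X2.
  by rewrite mxtrace_mulC mulmxA H2.
by ring.
Qed.

End Leaf.

Lemma primitive_Fh (x : phase_space R n) : primitive (leaf_Fh x) (fun z => \tr (z.2 *m z.1)).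
Proof.
move=> gamma dg t; have [d1 d2] := dmx_pair (dg t).
have dtr := dmx_tr (dmxM d2 d1); split; first by have [] := dtr.
move=> near_leaf.
have E : (derive1 gamma t).2 = 0.
  apply: dmx_unique d2 _; apply: dmx_near (dmx_cst x.2 t).
  by apply: filterS near_leaf => s ->.
by apply: is_derive_eq; rewrite E mul0mx add0r.
Qed.

End OrbitCoordinates.

(** * Liouville and orbit measures *)

Section TransportLeaves.
Variables (R : realType) (hbar : R) (n : nat).
Local Notation M := 'M[R]_n.
Local Notation psi := (@psi R hbar).

Lemma transport_Gh_seg b (x : phase_space R n) (A0 u v : M) (tb : torus b) :
  same_orbit (slice_h b) x.2 -> M_ff x -> M_ff (A0, x.2) -> Ngroup u -> Ngroup v ->
  transport hbar (leaf_Gh x) x (act (A0, x.2) (u, v)) =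
  psi (prim_h tb x - prim_h tb (act (A0, x.2) (u, v))).
Proof.
case: x => A1 B /= ob mx m0 Nu Nv.
apply: (@transport_psi _ _ _ _ _ _ _ (fun t => act (A0 + t *: (A1 - A0), B) (seg u t, seg v t))).
- exact: primitive_Gh.
- exact: C1_act_path.
- move=> t; split; first by apply: M_ff_act; [exact: Ngroup_seg|exact: Ngroup_seg|exact: M_ff_affine].
  by exists (invmx (seg v t)), (seg u t); split; [apply: NgroupV; exact: Ngroup_seg|exact: Ngroup_seg|].
- by rewrite !seg0 scale0r addr0.
- by rewrite !seg1 scale1r addrC subrK act1.
Qed.

Lemma transport_Gv_seg b (x : phase_space R n) (u v : M) (tb : torus b) :
  same_orbit (slice_h b) x.1 -> M_ff x -> Ngroup u -> Ngroup v ->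
  transport hbar (leaf_Gv x) x (act x (u, v)) = psi (prim_v tb x - prim_v tb (act x (u, v))).
Proof.
case: x => A B /= ob mx Nu Nv.
apply: (@transport_psi _ _ _ _ _ _ _ (fun t => act (A + t *: (A - A), B) (seg u t, seg v t))).
- exact: primitive_Gv.
- exact: C1_act_path.
- move=> t; rewrite subrr scaler0 addr0.
  split; first by apply: M_ff_act; [exact: Ngroup_seg|exact: Ngroup_seg|].
  by exists (invmx (seg u t)), (seg v t); split; [apply: NgroupV; exact: Ngroup_seg|exact: Ngroup_seg|].
- by rewrite !seg0 scale0r addr0.
- by rewrite !seg1 subrr scaler0 addr0 act1.
Qed.

Lemma transport_Fh (x : phase_space R n) (Y : M) :
  transport hbar (leaf_Fh x) x (Y, x.2) = psi (\tr (x.2 *m x.1) - \tr (x.2 *m Y)).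
Proof.
case: x => A B /=.
have s1 (t : R) : seg (1%:M : M) t = 1%:M by rewrite /seg subrr scaler0 addr0.
apply: (@transport_psi _ _ _ _ (fun z => \tr (z.2 *m z.1)) _ _
  (fun t => act (Y + t *: (A - Y), B) (seg 1%:M t, seg 1%:M t))).
- exact: primitive_Fh.
- by apply: C1_act_path; exact: Ngroup1.
- by move=> t; rewrite s1 act1.
- by rewrite s1 act1 scale0r addr0.
- by rewrite s1 act1 scale1r addrC subrK.
Qed.

(** On a leaf of [F_v] the first component is constant, so the connection form vanishes and
    horizontal sections are constant. *)
Lemma flat_Fv (phi : phase_space R n -> R[i]) (A B : M) :
  flat_along hbar (@leaf_Fv R n) phi -> phi (A, B) = phi (A, 0).
Proof.
move=> fl; rewrite (fl (A, B) (A, 0) 1) ?mul1r//.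
pose cp (A : M) : 'M[{poly R}]_n := map_mx polyC A.
have cpE (A' : M) t : pv (cp A') t = A' by apply/matrixP => i j; rewrite !mxE /horner_eval hornerC.
have XE t : pv ('X *: cp B) t = t *: B by apply/matrixP => i j; rewrite !mxE /horner_eval !hornerE.
have C1 : C1_path (fun t => (A, t *: B) : phase_space R n).
  have := C1_path_pv (cp A) ('X *: cp B); congr C1_path.
  by apply/funext => t; rewrite cpE XE.
exists (fun t => (A, t *: B)), (fun=> 1); split=> //.
  by rewrite scale0r scale1r.
move=> t /=; have [d1 _] := dmx_pair (C1.1 t).
have -> : (derive1 (fun t => (A, t *: B)) t).1 = 0 by exact: dmx_unique d1 (dmx_cst A t).
rewrite mulmx0 mxtrace0 mulr0 mulr1 /=.
by split; apply: is_derive_eq; ring.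
Qed.

End TransportLeaves.

(** * Liouville densities of Lagrangian splittings *)

Section LiouvilleBlock.
Variable R : realType.

Lemma det_antiblock d (P Q : 'M[R]_d) : `|\det (block_mx 0 P Q 0)| = `|\det P| * `|\det Q|.
Proof.
pose S : 'M[R]_(d + d) := block_mx 0 1%:M 1%:M 0.
have SS : S *m S = 1%:M.
  by rewrite mulmx_block !mul0mx !mulmx0 !mulmx1 !addr0 !add0r -scalar_mx_block.
have S1 : `|\det S| = 1.
  have : `|\det S| ^+ 2 = 1 by rewrite expr2 -normrM -det_mulmx SS det1 normr1.
  by move/eqP; rewrite sqrp_eq1// => /eqP.
have E : block_mx 0 P Q 0 *m S = block_mx P 0 0 Q.
  by rewrite mulmx_block !mul0mx !mulmx0 !mulmx1 !addr0 !add0r.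
have := congr1 (fun A => `|\det A|) E; rewrite det_mulmx det_ublock normrM S1 mulr1 => ->.
by rewrite normrM.
Qed.

Lemma liouville_block n d (sigma : 'rV[R]_d -> 'rV[R]_d -> phase_space R n) y1 y2 (P : 'M[R]_d) :
  `|\det P| = 1 ->
  (forall i j, omegaM (dsigma1 sigma y1 y2 i) (dsigma1 sigma y1 y2 j) = 0) ->
  (forall i j, omegaM (dsigma1 sigma y1 y2 i) (dsigma2 sigma y1 y2 j) = P i j) ->
  (forall i j, omegaM (dsigma2 sigma y1 y2 i) (dsigma2 sigma y1 y2 j) = 0) ->
  liouville sigma y1 y2 = 1.
Proof.
move=> dP H11 H12 H22; rewrite /liouville.
have -> : omega_mx sigma y1 y2 = block_mx 0 P (- P^T) 0.
  rewrite /omega_mx; congr block_mx; apply/matrixP => i j; rewrite !mxE.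
  - exact: H11.
  - exact: H12.
  - by rewrite -H12 /omegaM opprB.
  - exact: H22.
by rewrite det_antiblock dP -scaleN1r detZ det_tr normrM normrX normrN1 expr1n !mul1r dP sqrtr1.
Qed.

End LiouvilleBlock.

Section LiouvilleFourier.
Variables (R : realType) (n : nat).

Lemma liouville_fourier (y1 y2 : 'rV[R]_(n * n)) :
  liouville (fun y1 y2 => (vec_mx y1, vec_mx y2) : phase_space R n) y1 y2 = 1.
Proof.
have D1 i : dsigma1 (fun y1 y2 => (vec_mx y1, vec_mx y2) : phase_space R n) y1 y2 i =
    (vec_mx (delta_mx 0 i), 0).
  rewrite /dsigma1.
  have d : dmx (fun t : R => vec_mx (y1 + t *: delta_mx 0 i) : 'M[R]_n) 0 (vec_mx (delta_mx 0 i)).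
    move=> k l; have -> : (fun t : R => vec_mx (y1 + t *: delta_mx 0 i) k l) =
      (fun t : R => vec_mx y1 k l + t * vec_mx (delta_mx 0 i) k l).
      by apply/funext => t; rewrite linearD linearZ /= !mxE.
    by apply: is_derive_eq; rewrite /GRing.scale /=; ring.
  by have [_ ->] := derivable_pair_mx d (dmx_cst (vec_mx y2) 0).
have D2 i : dsigma2 (fun y1 y2 => (vec_mx y1, vec_mx y2) : phase_space R n) y1 y2 i =
    (0, vec_mx (delta_mx 0 i)).
  rewrite /dsigma2.
  have d : dmx (fun t : R => vec_mx (y2 + t *: delta_mx 0 i) : 'M[R]_n) 0 (vec_mx (delta_mx 0 i)).
    move=> k l; have -> : (fun t : R => vec_mx (y2 + t *: delta_mx 0 i) k l) =
      (fun t : R => vec_mx y2 k l + t * vec_mx (delta_mx 0 i) k l).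
      by apply/funext => t; rewrite linearD linearZ /= !mxE.
    by apply: is_derive_eq; rewrite /GRing.scale /=; ring.
  by have [_ ->] := derivable_pair_mx (dmx_cst (vec_mx y1) 0) d.
(* [tr (A B)] pairs the entry [(i, j)] of [A] with the entry [(j, i)] of [B], so the mixed block is
   the matrix of transposition. *)
pose T : 'M[R]_(n * n) := lin_mx (@trmx R n n).
have TT : T *m T = 1%:M.
  apply/row_matrixP => i; rewrite !rowE mulmxA mulmx1.
  by rewrite -[delta_mx 0 i]vec_mxK /T !mul_vec_lin /= trmxK.
have dT : `|\det T| = 1.
  have : `|\det T| ^+ 2 = 1 by rewrite expr2 -normrM -det_mulmx TT det1 normr1.
  by move/eqP; rewrite sqrp_eq1// => /eqP.
apply: (liouville_block dT) => i j; rewrite ?D1 ?D2 /omegaM /= ?mul0mx ?mulmx0 ?mxtrace0 ?subrr//.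
rewrite subr0 /T.
case/mxvec_indexP: i => a b; case/mxvec_indexP: j => c d.
have E : lin_mx (@trmx R n n) (mxvec_index a b) (mxvec_index c d) =
    (mxvec (delta_mx a b : 'M[R]_n)^T) 0 (mxvec_index c d).
  by rewrite -mul_vec_lin mxvec_delta -rowE [in RHS]mxE.
rewrite E !vec_mx_delta mxvecE !mxE.
rewrite mul_delta_mx_cond.
case: (eqVneq b c) => _; last by rewrite mulr0n mxtrace0 andbF.
rewrite mulr1n andbT /mxtrace (bigD1 a)//= mxE eqxx /= big1 ?addr0 1?[d == a]eq_sym//.
by move=> k ka; rewrite mxE (negPf ka).
Qed.

End LiouvilleFourier.

(** * Jacobians of the orbit parametrizations *)

Section OrbitJac.
Variables (R : realType) (n : nat).
Local Notation M := 'M[R]_n.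

(** The frame consists of multiples of distinct matrix units, so [L L^T] is diagonal with entries
    [c^2]. This gives [|det L|] without the sign of a permutation. *)
Lemma orbit_jac_monomial (A : M) (v : 'I_n -> M) (c : 'I_n -> 'I_n -> R)
    (tau : 'I_n * 'I_n -> 'I_n * 'I_n) : injective tau ->
  (forall i j, orbit_frame A v i j = c i j *: delta_mx (tau (i, j)).1 (tau (i, j)).2) ->
  orbit_jac A v = \prod_(i < n) \prod_(j < n) `|c i j|.
Proof.
move=> tau_inj fr; rewrite /orbit_jac; set f := fun X : M => _; set L := lin_mx f.
have Lrow i j q : L (mxvec_index i j) q = c i j * (q == mxvec_index (tau (i, j)).1 (tau (i, j)).2)%:R.
  have -> : L (mxvec_index i j) q = mxvec (f (delta_mx i j)) 0 q.
    by rewrite mxE /= vec_mx_delta.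
  have -> : f (delta_mx i j) = orbit_frame A v i j.
    rewrite /f (bigD1 i)//= (bigD1 j)//= mxE !eqxx scale1r.
    rewrite big1 ?addr0 => [|l lj]; last by rewrite mxE (negPf lj) andbF scale0r.
    rewrite big1 ?addr0// => k ki; rewrite big1// => l _; by rewrite mxE (negPf ki) scale0r.
  by rewrite fr linearZ /= mxvec_delta !mxE eqxx.
pose D : 'rV[R]_(n * n) := mxvec (\matrix_(i, j) (c i j) ^+ 2).
have inj (p q : 'I_n * 'I_n) : mxvec_index p.1 p.2 = mxvec_index q.1 q.2 -> p = q.
  have [g gK _] := curry_mxvec_bij n n.
  move=> e; rewrite -[p]gK// -[q]gK//.
  by case: p q e => p1 p2 [q1 q2] /= ->.
have LL : L *m L^T = diag_mx D.
  apply/matrixP => p q; case/mxvec_indexP: p => i j; case/mxvec_indexP: q => k l.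
  rewrite [LHS]mxE [RHS]mxE mxvecE [X in _ = X *+ _]mxE.
  rewrite (bigD1 (mxvec_index (tau (i, j)).1 (tau (i, j)).2))//= big1 ?addr0; last first.
    by move=> q qt; rewrite Lrow (negPf qt) mulr0 mul0r.
  rewrite [L^T _ _]mxE !Lrow eqxx mulr1.
  have -> : (mxvec_index (tau (i, j)).1 (tau (i, j)).2 == mxvec_index (tau (k, l)).1 (tau (k, l)).2) =
     (mxvec_index i j == mxvec_index k l).
    have E (p q : 'I_n * 'I_n) : (mxvec_index p.1 p.2 == mxvec_index q.1 q.2) = (p == q).
      by apply/eqP/eqP => [/inj//|->].
    by rewrite E (inj_eq tau_inj) -E.
  case: eqP => [/(inj (i, j) (k, l))[-> ->]|_]; last by rewrite !mulr0 mulr0n.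
  by rewrite mulr1 mulr1n -expr2.
have dd : `|\det L| ^+ 2 = (\prod_(i < n) \prod_(j < n) `|c i j|) ^+ 2.
  rewrite expr2 -normrM -{2}det_tr -det_mulmx LL det_diag.
  rewrite (reindex _ (curry_mxvec_bij n n)) /= normr_prod.
  rewrite (pair_bigA _ (fun i j => `|c i j|)) /= -prodrXl; apply: eq_bigr => -[i j] _ /=.
  by rewrite mxvecE mxE normrX.
apply/eqP; rewrite -(@eqrXn2 _ 2)//; first by rewrite dd.
by apply: prodr_ge0 => i _; apply: prodr_ge0.
Qed.

(** [E_ij b w = b_j E_(i, rev j)] for [i < j], so [b_j] occurs [j] times. In the right multiples
    [b_(rev j)] occurs once for each [i > j], that is [rev j] times, whence the square. *)
Lemma orbit_jac_slice (b : 'rV[R]_n) (v : 'I_n -> M) (rho : 'I_n -> 'I_n) : injective rho ->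
  (forall i, v i = delta_mx (rho i) (rev_ord (rho i))) ->
  orbit_jac (slice_h b) v = (\prod_(k < n) `|b 0 k| ^+ k) ^+ 2.
Proof.
move=> rho_inj vE.
pose c (i j : 'I_n) : R := if (i < j)%N then b 0 j else if (j < i)%N then b 0 (rev_ord j) else 1.
pose tau (p : 'I_n * 'I_n) := if (p.1 < p.2)%N then (p.1, rev_ord p.2) else
  if (p.2 < p.1)%N then (rev_ord p.2, p.1) else (rho p.1, rev_ord (rho p.1)).
have sE : slice_h b = \sum_k b 0 k *: delta_mx k (rev_ord k).
  apply/matrixP => i j; rewrite /slice_h mul_diag_mx !mxE summxE (bigD1 i)//= big1 ?addr0.
    by rewrite !mxE eqxx.
  by move=> k ki; rewrite !mxE eq_sym (negPf ki) mulr0.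
rewrite (@orbit_jac_monomial _ _ c tau).
- have E1 : \prod_(i < n) \prod_(j < n) `|c i j| =
    (\prod_(i < n) \prod_(j < n) if (i < j)%N then `|b 0 j| else 1) *
    (\prod_(i < n) \prod_(j < n) if (j < i)%N then `|b 0 (rev_ord j)| else 1).
    rewrite -big_split; apply: eq_bigr => i _; rewrite -big_split; apply: eq_bigr => j _ /=.
    by rewrite /c; case: ltngtP => _; rewrite ?mulr1 ?mul1r ?normr1.
  rewrite E1 expr2; congr (_ * _).
    rewrite exchange_big; apply: eq_bigr => j _ /=; rewrite -big_mkcond prodr_const /=.
    by congr (_ ^+ _); rewrite -sum1_card big_mkcond /= -[RHS](card_ord j) -sum1_card (big_ord_widen n (fun=> 1%N)) ?[RHS]big_mkcond// ltnW.
  rewrite exchange_big (reindex_inj rev_ord_inj); apply: eq_bigr => j _ /=.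
  rewrite rev_ordK -big_mkcond prodr_const; congr (_ ^+ _).
  rewrite -sum1_card (reindex_inj rev_ord_inj) /=.
  rewrite (eq_bigl (fun i : 'I_n => (i < j)%N)); last first.
    by move=> i; rewrite unfold_in /=; have := ltn_ord i; have := ltn_ord j; lia.
  by rewrite -[RHS](card_ord j) -[RHS]sum1_card (big_ord_widen n (fun=> 1%N)) // ltnW.
- move=> [i j] [k l]; rewrite /tau /=.
  have := ltn_ord i; have := ltn_ord j; have := ltn_ord k; have := ltn_ord l.
  have := ltn_ord (rho i); have := ltn_ord (rho k).
  move=> rk ri ln kn jn im.
  case: (ltngtP i j) => ij; case: (ltngtP k l) => kl E;
    move: (congr1 (fun p : 'I_n * 'I_n => val p.1) E) (congr1 (fun p : 'I_n * 'I_n => val p.2) E)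
      => /= e1 e2; try by (exfalso; lia).
  + by congr (_, _); apply: val_inj => /=; lia.
  + by congr (_, _); apply: val_inj => /=; lia.
  + have ik : i = k by apply: rho_inj; exact: val_inj.
    by rewrite ik in ij *; congr (_, _); apply: val_inj; rewrite /= -ij -kl.
move=> i j; rewrite /orbit_frame /c /tau /=; case: (ltngtP i j) => ij /=.
- rewrite sE mulmx_sumr (bigD1 j)//= -scalemxAr mul_delta_mx big1 ?addr0// => k kj.
  by rewrite -scalemxAr mul_delta_mx_0 ?scaler0// eq_sym.
- rewrite sE mulmx_suml (bigD1 (rev_ord j))//= -scalemxAl rev_ordK mul_delta_mx big1 ?addr0// => k kj.
  rewrite -scalemxAl mul_delta_mx_0 ?scaler0//; apply: contraNneq kj => <-.
  by rewrite rev_ordK.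
- by rewrite vE scale1r.
Qed.

Lemma jac_hE (b : 'rV[R]_n) : jac_h b = (\prod_(k < n) `|b 0 k| ^+ k) ^+ 2.
Proof.
apply: (@orbit_jac_slice _ _ id) => // i; apply/matrixP => k l; rewrite /slice_h mul_diag_mx !mxE eqxx /=.
have [->|ki] := eqVneq k i; first by rewrite mul1r.
by rewrite mul0r.
Qed.

Lemma jac_vE (a : 'rV[R]_n) : jac_v a = (\prod_(k < n) `|a 0 k| ^+ (n.-1 - k)) ^+ 2.
Proof.
rewrite /jac_v slice_vE (@orbit_jac_slice _ _ (@rev_ord n)).
- congr (_ ^+ 2); rewrite (reindex_inj rev_ord_inj); apply: eq_bigr => k _ /=.
  by rewrite mxE rev_ordK; congr (_ ^+ _); have := ltn_ord k; lia.
- exact: rev_ord_inj.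
move=> i; rewrite rev_ordK; apply/matrixP => k l; rewrite /slice_v mul_mx_diag !mxE eqxx /=.
have [->|li] := eqVneq l i; last by rewrite mulr0 andbF.
by rewrite mulr1 andbT -(inj_eq rev_ord_inj) rev_ordK eq_sym.
Qed.

End OrbitJac.

(** * The slice of the reduced space *)

Section SigmaJ.
Variables (R : realType) (n : nat).
Local Notation M := 'M[R]_n.
Local Notation sl := (nat * nat)%type.
Local Notation pt := (sl -> R).
Local Notation Uof := (@Uof R n).
Local Notation Vof := (@Vof R n).
Implicit Types (a b : 'rV[R]_n) (B X : M).

Definition adj (i j : nat) : bool := (i == j.+1) || (j == i.+1).

(* On the slice [A = w a] the moment map conditions prescribe the off-diagonal entries of [B w]. *)
Definition offJ a (p : sl) : R := if adj p.1 p.2 then (rve a (minn p.1 p.2))^-1 else 0.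

Lemma mul_slice_vl a X i j : (slice_v a *m X) i j = a 0 (rev_ord i) * X (rev_ord i) j.
Proof.
rewrite /slice_v -mulmxA mxE (bigD1 (rev_ord i))//= big1 ?addr0; last first.
  by move=> k ki; rewrite mxE (negPf ki) mul0r.
by rewrite mxE eqxx mul1r mul_diag_mx mxE.
Qed.

Lemma su_delta (r i : 'I_n) : (r < i)%N -> strict_upper (delta_mx r i : M).
Proof.
move=> ri k l lk; rewrite mxE; case: eqP => [kr|]; case: eqP => [li|] //=.
by exfalso; move: lk; rewrite kr li; lia.
Qed.

Lemma tr_mul2 (X Y : M) : \tr (X *m Y) = \sum_k \sum_i X i k * Y k i.
Proof. by rewrite exchange_big; apply: eq_bigr => i _; rewrite mxE. Qed.

Lemma tr_delta X (r i : 'I_n) : \tr (X *m delta_mx r i) = X i r.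
Proof.
rewrite tr_mul2 (bigD1 r)//= [X in _ + X]big1 ?addr0; last first.
  by move=> k kr; rewrite big1// => l _; rewrite mxE (negPf kr) mulr0.
rewrite (bigD1 i)//= big1 ?addr0; first by rewrite mxE !eqxx mulr1.
by move=> k ki; rewrite [delta_mx _ _ _ _]mxE (negPf ki) andbF mulr0.
Qed.

Lemma fchar_delta (r i : 'I_n) : fchar (delta_mx r i : M) = (i == r.+1 :> nat)%:R.
Proof.
rewrite /fchar (bigD1 r)//= [X in _ + X]big1 ?addr0; last first.
  by move=> k kr; rewrite big1// => l _; rewrite mxE (negPf kr).
case: eqP => ir.
  rewrite (bigD1 i)//=; last exact/eqP.
  by rewrite mxE !eqxx big1 ?addr0// => k /andP[_ ki]; rewrite mxE (negPf ki) andbF.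
rewrite big1// => k /eqP kr; rewrite mxE (_ : (k == i) = false) ?andbF//.
by apply/eqP => ki; apply: ir; rewrite -ki kr.
Qed.

(** Tested on matrix units, the condition on [B A] prescribes the slots [(r, i)] with [r < i], that
    on [A B] those with [i < r]; the diagonal remains free and carries the coordinates [b]. *)
Lemma M_ff_slice a B : torus a ->
  M_ff (slice_v a, B) <-> forall p, p \in off n 0 -> slB B p = offJ a p.
Proof.
move=> ta.
have slE (r i : 'I_n) : slB B (r : nat, i : nat) = B i (rev_ord r).
  by rewrite /slB /= -[(n - r.+1)%N]/(nat_of_ord (rev_ord r)) mxeE.
have offE (r i : 'I_n) : (r < i)%N -> offJ a (r : nat, i : nat) = (i == r.+1 :> nat)%:R / a 0 r.
  move=> ri; rewrite /offJ /adj /= (_ : (r == i.+1 :> nat) = false) /=; last by lia.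
  by rewrite (minn_idPl (ltnW ri)) rveE; case: eqP => _; rewrite ?mul1r ?mul0r.
have offE' (r i : 'I_n) : (i < r)%N -> offJ a (r : nat, i : nat) = (r == i.+1 :> nat)%:R / a 0 i.
  move=> ri; rewrite /offJ /adj /= (_ : (i == r.+1 :> nat) = false) ?orbF /=; last by lia.
  by rewrite (minn_idPr (ltnW ri)) rveE; case: eqP => _; rewrite ?mul1r ?mul0r.
split=> [/M_ffP [/= H1 H2] p /offP [r [i [-> ri]]]|H].
  rewrite slE; case: (ltngtP r i) => [lt|gt|/val_inj e]; last by rewrite e eqxx in ri.
  - have sX : strict_upper (delta_mx r i : M).
      exact: su_delta.
    have := H1 _ sX; rewrite tr_delta fchar_delta mul_slice_v offE// => <-.
    by rewrite mulfK.
  - clear p; set p := rev_ord i; set q := rev_ord r.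
    have qp : (q < p)%N by rewrite ltn_rev.
    have sX : strict_upper (delta_mx q p : M).
      exact: su_delta.
    have := H2 _ sX; rewrite tr_delta fchar_delta mul_slice_vl rev_ordK offE'//.
    have -> : (r == i.+1 :> nat) = (p == q.+1 :> nat).
      by rewrite /p /q /=; have := ltn_ord i; have := ltn_ord r; lia.
    by move=> <-; rewrite mulrAC divff ?mul1r//; exact: ta.
have BE (r i : 'I_n) : r != i -> B i (rev_ord r) = offJ a (r : nat, i : nat).
  by move=> ri; rewrite -slE H// off_ord.
apply/M_ffP; split=> X sX /=.
  rewrite tr_mul2 /fchar; apply: eq_bigr => k _; rewrite [RHS]big_mkcond; apply: eq_bigr => i _.
  rewrite mul_slice_v; case: (ltnP k i) => ki; last first.
    by rewrite sX// mulr0; case: eqP => // e; lia.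
  rewrite BE; last by apply/eqP => e; move: ki; rewrite e ltnn.
  by rewrite offE// divfK ?ta//; case: eqP => _; rewrite ?mul1r ?mul0r.
rewrite tr_mul2 /fchar; apply: eq_bigr => k _; rewrite [RHS]big_mkcond; apply: eq_bigr => i _.
rewrite mul_slice_vl; case: (ltnP k i) => ki; last first.
  by rewrite sX// mulr0; case: eqP => // e; lia.
rewrite -[k in X in X * _ = _]rev_ordK BE; last first.
  by rewrite (inj_eq rev_ord_inj); apply/eqP => e; move: ki; rewrite e ltnn.
rewrite offE' ?ltn_rev// [a 0 _ * _]mulrC divfK ?ta//.
have -> : (rev_ord k == (rev_ord i).+1 :> nat) = (i == k.+1 :> nat).
  by rewrite /=; have := ltn_ord i; have := ltn_ord k; lia.
by case: eqP => _; rewrite ?mul1r ?mul0r.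
Qed.

(** Triangular factors of the slice point: the prescribed neighbours [1 / a_i] of the diagonal force
    bidiagonal factors with entries [1 / (a_i b_(i+1))], and [dgJ] is the resulting diagonal. *)
Definition xJ a b : pt := fun p =>
  if adj p.1 p.2 then (rve a (minn p.1 p.2) * rve b (maxn p.1 p.2))^-1 else 0.
Definition BJ a b : M := Uof (xJ a b) *m slice_h b *m Vof (xJ a b).
Definition dgJ a b (i : nat) : R := rve b i +
  (if (i.+1 < n)%N then ((rve a i) ^+ 2 * rve b i.+1)^-1 else 0).

Lemma UDL_xJ_far a b i q : (i.+1 < q)%N -> L1 (xJ a b) i q = 0 /\ L1 (xJ a b) q i = 0.
Proof.
move=> iq; rewrite /L1 /xJ /adj /=; split; rewrite ifF ?ifF//; lia.
Qed.

Lemma UDL_xJ a b (r i : nat) : torus a -> torus b -> (r < n)%N -> (i < n)%N ->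
  UDL n (rve b) 0 (xJ a b) (r, i) = if r == i then dgJ a b i else offJ a (r, i).
Proof.
move=> ta tb rn im.
have a0 k : (k < n)%N -> rve a k != 0 by exact: rve_neq0.
have b0 k : (k < n)%N -> rve b k != 0 by exact: rve_neq0.
rewrite /UDL ifT; last by rewrite /inb /=; lia.
(* The factors vanish at distance two or more from the diagonal, so with [m = min (r, i)] only the
   indices [m] and [m + 1] can contribute. *)
have trunc (m m' : nat) : m = minn r i -> (m <= m' <= m.+2)%N -> (m' <= n)%N -> (maxn r i < m')%N || (m' == n) ->
    m' = n \/ m' = m.+2 ->
    \sum_(0 <= q < n | (r <= q)%N && (i <= q)%N) L1 (xJ a b) r q * rve b q * L1 (xJ a b) q i =
    \sum_(maxn r i <= q < m') L1 (xJ a b) r q * rve b q * L1 (xJ a b) q i.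
  move=> mE mm mn mx mor.
  rewrite (big_cat_nat (n := maxn r i)) /=; [|lia|lia].
  rewrite big1_seq ?add0r; last by move=> q; rewrite mem_index_iota; lia.
  transitivity (\sum_(maxn r i <= q < n) L1 (xJ a b) r q * rve b q * L1 (xJ a b) q i).
    by rewrite [LHS]big_nat_cond [RHS]big_nat_cond; apply: eq_bigl => q; lia.
  have [->|m2] := mor; first by [].
  case: (leqP (maxn r i) m') => h.
    rewrite (big_cat_nat (n := m')) /=; [|lia|lia].
    rewrite [X in _ + X]big1_seq ?addr0// => q; rewrite mem_index_iota => /andP[_ qm].
    have mq : (m.+1 < q)%N by lia.
    have [z1 z2] := UDL_xJ_far a b mq.
    have [mr|mi] : m = r \/ m = i by lia.
      by rewrite -mr z1 !mul0r.
    by rewrite -mi z2 !mulr0.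
  rewrite [RHS]big_geq; last by lia.
  rewrite big1_seq// => q; rewrite mem_index_iota => /andP[_ qm].
  have mq : (m.+1 < q)%N by lia.
  have [z1 z2] := UDL_xJ_far a b mq.
  have [mr|mi] : m = r \/ m = i by lia.
    by rewrite -mr z1 !mul0r.
  by rewrite -mi z2 !mulr0.
have nSn k : (k == k.+1) = false by lia.
have nSn' k : (k.+1 == k) = false by lia.
have mS k : minn k k.+1 = k by lia.
have mS' k : minn k.+1 k = k by lia.
have MS k : maxn k k.+1 = k.+1 by lia.
have MS' k : maxn k.+1 k = k.+1 by lia.
have [ri|ri] := eqVneq r i.
  rewrite /dgJ; case: ltnP => i1.
    rewrite (trunc i i.+2); [|lia|lia|lia|lia|lia].
    rewrite ri maxnn big_ltn; last by lia.
    rewrite big_ltn; last by lia.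
    rewrite big_geq ?addr0; last by lia.
    rewrite L1_id mul1r mulr1 /L1 /xJ /adj /= eqxx orbT.
    rewrite nSn nSn' /= mS MS mS' MS'.
    by field; rewrite a0 ?b0.
  rewrite (trunc i n); [|lia|lia|lia|lia|lia].
  rewrite ri maxnn big_ltn; last by lia.
  rewrite big_geq ?addr0; last by lia.
  by rewrite L1_id mul1r mulr1.
rewrite /offJ /=; case: ifPn => rai; last first.
  pose m := minn r i.
  have far : (m.+1 < maxn r i)%N by move: rai ri; rewrite /adj /m; lia.
  rewrite (big_cat_nat (n := maxn r i)) /=; [|lia|lia].
  rewrite !big1_seq ?addr0//; last by move=> q; rewrite mem_index_iota; lia.
  move=> q; rewrite mem_index_iota => /andP[_ qm].
  have mq : (m.+1 < q)%N by lia.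
  have [z1 z2] := UDL_xJ_far a b mq.
  have [mr|mi] : m = r \/ m = i by rewrite /m; lia.
    by rewrite -mr z1 !mul0r.
  by rewrite -mi z2 !mulr0.
move: rai; rewrite /adj => /orP[/eqP e|/eqP e].
  rewrite (trunc i i.+2); [|lia|lia|lia|lia|lia].
  have -> : maxn r i = i.+1 by lia.
  have -> : minn r i = i by lia.
  rewrite big_ltn; last by lia.
  rewrite big_geq ?addr0; last by lia.
  rewrite e L1_id mul1r /L1 /xJ /adj /= eqxx /=.
  rewrite nSn' mS' MS'.
  by field; rewrite a0 ?b0//; lia.
rewrite (trunc r r.+2); [|lia|lia|lia|lia|lia].
have -> : maxn r i = r.+1 by lia.
have -> : minn r i = r by lia.
rewrite big_ltn; last by lia.
rewrite big_geq ?addr0; last by lia.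
rewrite e L1_id mulr1 /L1 /xJ /adj /= eqxx orbT.
rewrite nSn mS MS.
by field; rewrite a0 ?b0//; lia.
Qed.

Lemma BJE a b (i j : 'I_n) : torus a -> torus b -> BJ a b i j =
  if rev_ord j == i then dgJ a b i else offJ a (rev_ord j : nat, i : nat).
Proof. by move=> ta tb; rewrite /BJ UbwV UDL_xJ. Qed.

Lemma slB_BJ a b p : torus a -> torus b -> p \in off n 0 -> slB (BJ a b) p = offJ a p.
Proof.
move=> ta tb po; rewrite slB_UDL//; move: po => /offP [r [i [-> ri]]].
by rewrite UDL_xJ// ifF//; apply: negbTE; exact: ri.
Qed.

Lemma M_ff_BJ a b : torus a -> torus b -> M_ff (slice_v a, BJ a b).
Proof. by move=> ta tb; apply/M_ff_slice => // p po; exact: slB_BJ. Qed.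

(** [BJ] shows existence. For uniqueness, the moment condition fixes the off-diagonal slots of [B],
    and for given [b] these determine both unipotent factors through [slot_poly]. *)
Lemma sigma_JE a b : torus a -> torus b -> sigma_J a b = (slice_v a, BJ a b).
Proof.
move=> ta tb.
have ex : [set z : phase_space R n | [/\ M_ff z, z.1 = slice_v a & same_orbit (slice_h b) z.2]] (slice_v a, BJ a b).
  split=> //=; first exact: M_ff_BJ.
  by exists (Uof (xJ a b)), (Vof (xJ a b)); split; [exact: Ngroup_Uof|exact: Ngroup_Vof|].
rewrite /sigma_J; have [] := xgetPex (0, 0) (ex_intro _ _ ex).
case: (xget _ _) => A B /= mf EA [U [V [NU NV E]]]; rewrite EA in mf *; congr (_, _).
have sB p : p \in off n 0 -> slB B p = slB (BJ a b) p.
  by move=> po; rewrite slB_BJ//; exact: (M_ff_slice B ta).1 mf p po.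
have [UE VE] := UfVf tb NU NV.
have [UJ VJ] := UfVf_of tb (xJ a b).
have pE p : p \in off n 0 -> slot_poly tb p (slB B) = slot_poly tb p (slB (BJ a b)).
  by move=> po; have [Pp _] := slot_polyP tb po; apply: (polyf_agree Pp) => q /sB.
have -> : B = Uf tb B *m slice_h b *m Vf tb B by rewrite {2 3}E UE VE.
have -> : Uf tb B = Uf tb (BJ a b).
  apply/matrixP => i j; rewrite [LHS]mxE [RHS]mxE; case: eqP => // /eqP ij; case: ifP => // _.
  by rewrite pE// off_ord// eq_sym.
have -> : Vf tb B = Vf tb (BJ a b).
  apply/matrixP => i j; rewrite [LHS]mxE [RHS]mxE; case: eqP => // /eqP ij; case: ifP => // _.
  by rewrite pE// off_ord// (inj_eq rev_ord_inj) eq_sym.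
by rewrite UJ VJ.
Qed.

(** Uniqueness in the Bruhat decomposition: slices have vanishing off-diagonal slots, so the factors
    carrying one slice to another have all coordinates [0] and are trivial. *)
Lemma coord_A1_slice a : torus a -> coord_A1 (slice_v a) = a.
Proof.
move=> ta.
have ex : [set a' | torus a' /\ same_orbit (slice_v a') (slice_v a)] a.
  split=> //; exists 1%:M, 1%:M; split; [exact: Ngroup1|exact: Ngroup1|by rewrite mul1mx mulmx1].
rewrite /coord_A1; have [] := xgetPex 0 (ex_intro _ _ ex).
set a' := xget _ _ => ta' [U [V [NU NV]]]; rewrite !slice_vE.
pose r (c : 'rV[R]_n) : 'rV[R]_n := \row_i c 0 (rev_ord i).
rewrite -/(r a) -/(r a') => E.
have tr' : torus (r a') by move=> i; rewrite mxE.
pose x := slUV U V.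
have xE : Uof x *m slice_h (r a') *m Vof x = slice_h (r a) by rewrite Uof_slUV// Vof_slUV.
have sd (c : 'rV[R]_n) (i k : 'I_n) : slice_h c i k = (k == rev_ord i)%:R * c 0 i.
  by rewrite /slice_h mul_diag_mx !mxE mulrC.
have x0 : Uof (fun=> 0) *m slice_h (r a') *m Vof (fun=> 0) = slice_h (r a').
  have -> : Uof (fun=> 0) = 1%:M :> M.
    by apply/matrixP => i j; rewrite !mxE; case: eqP => // _; case: ifP.
  have -> : Vof (fun=> 0) = 1%:M :> M.
    by apply/matrixP => i j; rewrite !mxE; case: eqP => // _; case: ifP.
  by rewrite mul1mx mulmx1.
have off0 (c : 'rV[R]_n) p : p \in off n 0 -> slB (slice_h c) p = 0.
  move=> /offP [k [i [-> ki]]]; rewrite /slB /= -[(n - k.+1)%N]/(nat_of_ord (rev_ord k)) mxeE sd.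
  by rewrite (inj_eq rev_ord_inj) (negPf ki) mul0r.
have xoff p : p \in off n 0 -> x p = 0.
  move=> po; rewrite -(slot_poly_slB tr' x po) xE -[RHS](slot_poly_slB tr' (fun=> 0) po) x0.
  have [Pp _] := slot_polyP tr' po; apply: (polyf_agree Pp) => q qo.
  by rewrite !off0.
have : Uof x *m slice_h (r a') *m Vof x = slice_h (r a').
  rewrite -[RHS]x0; congr (_ *m _ *m _); apply/matrixP => i j; rewrite !mxE;
   case: eqP => // /eqP ij; case: ifP => // _; apply: xoff; rewrite off_ord//.
    by rewrite eq_sym.
  by rewrite (inj_eq rev_ord_inj) eq_sym.
rewrite xE => e; apply/matrixP => k j; rewrite ord1.
have := congr1 (fun A : M => A (rev_ord j) j) e; rewrite !sd rev_ordK eqxx !mul1r !mxE rev_ordK.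
by move=> ->.
Qed.

Lemma tr_slice_delta (X : M) i : \tr (slice_v (delta_mx 0 i) *m X) = X i (rev_ord i).
Proof.
rewrite /mxtrace (bigD1 (rev_ord i))//= big1 ?addr0; last first.
  move=> k ki; rewrite mul_slice_vl mxE eqxx /= (_ : (rev_ord k == i) = false) ?mul0r//.
  by apply: contraNF ki => /eqP <-; rewrite rev_ordK.
by rewrite mul_slice_vl rev_ordK mxE !eqxx mul1r.
Qed.

Lemma near_torus a i : torus a -> \forall t \near (0 : R), torus (a + t *: delta_mx 0 i).
Proof.
move=> ta.
have H : \forall t \near (0 : R), a 0 i + t != 0.
  have c : (a 0 i + t @[t --> (0 : R)]) --> a 0 i + 0.
    by apply: cvgD; [exact: cvg_cst|exact: cvg_id].
  rewrite addr0 in c.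
  have := c _ (open_nbhs_nbhs (conj (open_neq (y := 0)) (ta i))).
  by apply.
apply: filterS H => t t0 j; rewrite !mxE eqxx /=.
by have [->|_] := eqVneq j i; rewrite ?mulr1 ?mulr0 ?addr0.
Qed.

Lemma rve_shift a i t (k : nat) : rve (a + t *: delta_mx 0 i) k = rve a k + t * (k == i :> nat)%:R.
Proof.
rewrite /rve; case: insubP => [k' _ <-|]; first by rewrite !mxE eqxx.
move=> kn; rewrite (_ : (k == i :> nat) = false) ?mulr0 ?addr0//.
by apply: contraNF kn => /eqP ->; exact: ltn_ord.
Qed.

Lemma derivable_inv_affine (c d : R) : c != 0 -> derivable (fun t : R => (c + t * d)^-1) 0 1.
Proof.
move=> c0; apply: derivableV; first by rewrite mul0r addr0.
apply: derivableD; first exact: derivable_cst.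
by apply: derivableM; [exact: derivable_id|exact: derivable_cst].
Qed.

Lemma derivable_inv_affine2 (c d e : R) : c != 0 -> e != 0 ->
  derivable (fun t : R => ((c + t * d) ^+ 2 * e)^-1) 0 1.
Proof.
move=> c0 e0.
have -> : (fun t : R => ((c + t * d) ^+ 2 * e)^-1) = (fun t => ((c + t * d) * (c + t * d) * e)^-1).
  by apply/funext => t; rewrite expr2.
have da : derivable (fun t : R => c + t * d) 0 1.
  apply: derivableD; first exact: derivable_cst.
  by apply: derivableM; [exact: derivable_id|exact: derivable_cst].
apply: derivableV; first by rewrite mul0r addr0 !mulf_neq0.
by apply: derivableM; [exact: derivableM|exact: derivable_cst].
Qed.

Lemma dmx_slice_v a i : dmx (fun t : R => slice_v (a + t *: delta_mx 0 i)) 0 (slice_v (delta_mx 0 i)).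
Proof.
move=> k l; have -> : (fun t : R => slice_v (a + t *: delta_mx 0 i) k l) =
   (fun t : R => slice_v a k l + t * slice_v (delta_mx 0 i) k l).
  by apply/funext => t; rewrite /slice_v !mul_mx_diag !mxE; ring.
by apply: is_derive_eq; rewrite /GRing.scale /=; ring.
Qed.

(** The mixed block is the derivative of the diagonal [dgJ] in [b]. Its entry [i] involves [b_i]
    with coefficient [1] and otherwise only [b_(i+1)], so the block is upper unipotent. The
    [a]-directions are isotropic because the entry [i] of [dgJ] depends on [a] through [a_i]
    alone. *)
Lemma liouville_J a b : torus a -> torus b -> liouville (@sigma_J R n) a b = 1.
Proof.
move=> ta tb.
have a0 k : (k < n)%N -> rve a k != 0 by exact: rve_neq0.
have b0 k : (k < n)%N -> rve b k != 0 by exact: rve_neq0.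
have D1 i : exists2 B', dsigma1 (@sigma_J R n) a b i = (slice_v (delta_mx 0 i), B') &
    forall j, j != i -> B' j (rev_ord j) = 0.
  have nt := near_torus i ta.
  (* The formula for [BJ], written for all [t]; it describes [sigma_J] near [0], where [a] stays in
     the torus. *)
  pose Bt (t : R) : M := \matrix_(k, l) if rev_ord l == k then rve b k +
     (if (k.+1 < n)%N then ((rve a k + t * (k == i)%:R) ^+ 2 * rve b k.+1)^-1 else 0)
     else if adj (rev_ord l) k then (rve a (minn (rev_ord l) k) + t * (minn (rev_ord l) k == i)%:R)^-1 else 0.
  have E : \forall t \near (0 : R), (slice_v (a + t *: delta_mx 0 i), Bt t) = sigma_J (a + t *: delta_mx 0 i) b.
    apply: filterS nt => t ht; rewrite sigma_JE//; congr (_, _); apply/matrixP => k l.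
    by rewrite BJE// mxE /dgJ /offJ /= !rve_shift.
  have dB : exists B', dmx Bt 0 B'.
    apply: derivable_entries => k l; under eq_fun do rewrite mxE.
    case: eqP => _.
      apply: derivableD; first exact: derivable_cst.
      case: (boolP (k.+1 < n)%N) => k1; last exact: derivable_cst.
      by apply: derivable_inv_affine2; [apply: a0; exact: ltn_ord|exact: b0].
    case: (adj _ _); last exact: derivable_cst.
    by apply: derivable_inv_affine; apply: a0; exact: leq_ltn_trans (geq_minr _ _) (ltn_ord k).
  have [B' dB'] := dB; exists B'.
    have [dd dv] := derivable_pair_mx (dmx_slice_v a i) dB'.
    rewrite /dsigma1 derive1E -(near_eq_derive _ E) -derive1E; exact: dv.
  move=> j ji; apply: is_derive_unique (dB' j (rev_ord j)) _.
  have -> : (fun t => Bt t j (rev_ord j)) = cst (dgJ a b j).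
    by apply/funext => t; rewrite mxE rev_ordK eqxx (negPf ji) mulr0 addr0.
  exact: is_derive_cst.
have D2 i : exists2 B', dsigma2 (@sigma_J R n) a b i = (0, B') &
    B' i (rev_ord i) = 1 /\ forall j : 'I_n, (i < j)%N -> B' j (rev_ord j) = 0.
  have nt := near_torus i tb.
  pose Bt (t : R) : M := \matrix_(k, l) if rev_ord l == k then (rve b k + t * (k == i)%:R) +
     (if (k.+1 < n)%N then ((rve a k) ^+ 2 * (rve b k.+1 + t * (k.+1 == i)%:R))^-1 else 0)
     else offJ a (rev_ord l : nat, k : nat).
  have E : \forall t \near (0 : R), (slice_v a, Bt t) = sigma_J a (b + t *: delta_mx 0 i).
    apply: filterS nt => t ht; rewrite sigma_JE//; congr (_, _); apply/matrixP => k l.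
    by rewrite BJE// mxE /dgJ /offJ /= !rve_shift.
  have dB : exists B', dmx Bt 0 B'.
    apply: derivable_entries => k l; under eq_fun do rewrite mxE.
    case: eqP => _; last exact: derivable_cst.
    apply: derivableD.
      apply: derivableD; first exact: derivable_cst.
      by apply: derivableM; [exact: derivable_id|exact: derivable_cst].
    case: (boolP (k.+1 < n)%N) => k1; last exact: derivable_cst.
    apply: derivableV.
      by rewrite mul0r addr0 mulf_neq0 ?expf_neq0 ?b0// a0//; exact: ltnW.
    apply: derivableM; first exact: derivable_cst.
    apply: derivableD; first exact: derivable_cst.
    by apply: derivableM; [exact: derivable_id|exact: derivable_cst].
  have [B' dB'] := dB; exists B'.
    have [dd dv] := derivable_pair_mx (dmx_cst (slice_v a) 0) dB'.
    rewrite /dsigma2 derive1E -(near_eq_derive _ E) -derive1E; exact: dv.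
  split=> [|j ij].
    apply: is_derive_unique (dB' i (rev_ord i)) _.
    have -> : (fun t => Bt t i (rev_ord i)) = (fun t : R => t + dgJ a b i).
      apply/funext => t; rewrite mxE rev_ordK !eqxx /dgJ (_ : (i.+1 == i) = false); last by lia.
      by rewrite mulr1 mulr0 addr0 addrA [t + _]addrC.
    by apply: is_derive_eq; rewrite addr0.
  apply: is_derive_unique (dB' j (rev_ord j)) _.
  have -> : (fun t => Bt t j (rev_ord j)) = cst (dgJ a b j).
    apply/funext => t; rewrite mxE rev_ordK eqxx /dgJ.
    have -> : (j == i) = false by rewrite -val_eqE /=; lia.
    have -> : (j.+1 == i :> nat) = false by lia.
    by rewrite mulr0 !addr0.
  exact: is_derive_cst.
have H12 i j : omegaM (dsigma1 (@sigma_J R n) a b i) (dsigma2 (@sigma_J R n) a b j) =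
    (dsigma2 (@sigma_J R n) a b j).2 i (rev_ord i).
  by have [B1 -> _] := D1 i; have [B2 -> _] := D2 j; rewrite /omegaM /= mul0mx mxtrace0 subr0 tr_slice_delta.
apply: (@liouville_block _ _ _ _ _ _ (\matrix_(i, j) (dsigma2 (@sigma_J R n) a b j).2 i (rev_ord i))).
- rewrite det_N ?normr1//; apply/NgroupP; split=> [i j ji|i]; rewrite mxE.
    by have [B2 -> [_ H]] := D2 j; exact: H.
  by have [B2 -> [H _]] := D2 i.
- move=> i j; have [<-|ij] := eqVneq i j; first by rewrite /omegaM subrr.
  have [B1 -> H1] := D1 i; have [B2 -> H2] := D1 j; rewrite /omegaM /= !tr_slice_delta.
  by rewrite H2// H1 ?subrr// eq_sym.
- by move=> i j; rewrite H12 mxE.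
- by move=> i j; have [B1 -> _] := D2 i; have [B2 -> _] := D2 j; rewrite /omegaM /= !mul0mx mxtrace0 subrr.
Qed.

End SigmaJ.

(** * Changes of variables in the unipotent integrals *)

Section IterInt.
Variables (R : realType) (V : lmodType R) (I J : eqType).
Local Notation C := R[i].

Fixpoint affine (x : V) (vs : seq V) (ts : seq R) : V :=
  match vs, ts with v :: vs', t :: ts' => affine (x + t *: v) vs' ts' | _, _ => x end.

Lemma iter_intC_IL (vs : seq V) (F : V -> C) (x : V) (s : seq I) (F' : (I -> R) -> C) x' :
  size vs = size s ->
  (forall ts, size ts = size s -> F (affine x vs ts) = F' (upds x' s ts)) ->
  iter_intC vs F x = IL s F' x'.
Proof.
elim: vs s x x' => [|v vs IH] [|i s] x x' //=.
  by move=> _ H; rewrite /IL /= -(H [::] erefl) /iter_intC /=; case: (F x).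
move=> [ss] H; rewrite IL_cons /iter_intC /= /intC.
have E t : IL s F' (upd x' i t) = iter_intC vs F (x + t *: v).
  by apply/esym/IH => // ts sts; exact: (H (t :: ts) (congr1 S sts)).
by congr (_ +i* _); apply: eq_Rintegral => t _; rewrite E.
Qed.

(** [mu] is affine in the chosen slots with directions [vv]; they vanish at [y] so that the
    parameters of the iterated integral are the slot values themselves. *)
Lemma iter_intC_slots (r : seq J) (vv : J -> V) (slot : J -> I) (mu : (I -> R) -> V) F y :
  uniq (map slot r) ->
  (forall y j t, j \in r -> mu (upd y (slot j) t) = mu y + (t - y (slot j)) *: vv j) ->
  (forall j, j \in r -> y (slot j) = 0) ->
  iter_intC (map vv r) F (mu y) = IL (map slot r) (fun y => F (mu y)) y.
Proof.
move=> ur Hmu y0; apply: iter_intC_IL; first by rewrite !size_map.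
move=> ts sts; congr F; elim: r y ts sts ur Hmu y0 => [|j r IH] y [|t ts] //= [sts] /andP[jr ur] Hmu y0.
have -> : mu y + t *: vv j = mu (upd y (slot j) t) by rewrite Hmu ?mem_head// y0 ?mem_head// subr0.
apply: IH => // [y' j' t' j'r|j' j'r]; first by apply: Hmu; rewrite inE j'r orbT.
rewrite upd_other ?y0//; first by rewrite inE j'r orbT.
by apply: contraNneq jr => <-; exact: map_f.
Qed.

Lemma upds_agree (x x' : I -> R) s ts i : size ts = size s -> i \in s ->
  upds x s ts i = upds x' s ts i.
Proof.
elim: s x x' ts => [//|j s IH] x x' [//|t ts] /= [sts]; rewrite inE.
have [is_ _|is_] := boolP (i \in s); first exact: IH.
by rewrite orbF => /eqP ij; rewrite !upds_notin// ij !upd_same.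
Qed.

Lemma IL_agree (s : seq I) (F : (I -> R) -> C) x x' :
  (forall y y', (forall i, i \in s -> y i = y' i) -> F y = F y') -> IL s F x = IL s F x'.
Proof. by move=> H; apply: IL_eq => // ts sts; apply: H => i; exact: upds_agree. Qed.

End IterInt.

Section TriRank.
Variables (R : realType) (hbar : R) (I : eqType).
Local Notation C := R[i].
Implicit Types (s : seq I) (y : I -> R).

Lemma triangular_rank (rk : I -> nat) s (g : I -> (I -> R) -> R) :
  sorted (fun i j => (rk i <= rk j)%N) s ->
  (forall i j y t, i \in s -> j \in s -> (rk i <= rk j)%N -> g i (upd y j t) = g i y) ->
  triangular s g.
Proof.
elim: s => [//|i s IH] so H; split.
  move=> j y t js; apply: H => //; first exact: mem_head.
  move: js; rewrite inE => /orP[/eqP -> //|js].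
  have tr : transitive (fun i j => (rk i <= rk j)%N) by move=> ? ? ?; exact: leq_trans.
  by have /allP := order_path_min tr so; apply.
apply: IH; first exact: path_sorted so.
by move=> j k y t js ks; apply: H; rewrite inE ?js ?ks orbT.
Qed.

(** Sorting the variables by rank makes the substitution triangular. Ties are harmless, as a shift
    depends on variables of strictly smaller rank. *)
Lemma IL_tri_rank (rk : I -> nat) s (c : I -> R) (Theta : (I -> R) -> I -> R) F x :
  uniq s -> (forall i, `|c i| = 1) ->
  (forall i, scR (fun y => Theta y i)) ->
  (forall y i, i \notin s -> Theta y i = y i) ->
  (forall i j y t, i \in s -> j \in s -> (rk i <= rk j)%N ->
     Theta (upd y j t) i - c i * upd y j t i = Theta y i - c i * y i) ->
  cr s F -> cr s (fun y => F (Theta y)) -> IL s F x = IL s (fun y => F (Theta y)) x.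
Proof.
move=> us c1 sT To rkT cF cFT.
pose le i j := (rk i <= rk j)%N; pose s' := sort le s.
have ps : perm_eq s s' by rewrite perm_sym perm_sort.
have ms i : (i \in s') = (i \in s) by rewrite mem_sort.
rewrite (IL_perm hbar ps us cF) (IL_perm hbar ps us cFT).
rewrite (IL_tri hbar (c := c) (g := fun i y => Theta y i - c i * y i)).
- rewrite big1 ?mul1r => [|i _]; last exact: c1.
  congr (IL _ _ _); apply/funext => y; congr F; apply/funext => i; rewrite /tri ms.
  by case: ifPn => is_; [ring|rewrite To].
- by rewrite -(perm_uniq ps).
- by move=> i _; rewrite -normr_gt0 c1.
- move=> i _; apply: scRD; first exact: sT.
  by apply/scRN/scRM; [exact: scR_cst|exact: scR_coord].
- apply: (triangular_rank (rk := rk)); first by apply: sort_sorted => i j; exact: leq_total.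
  by move=> i j y t; rewrite !ms; exact: rkT.
- by apply: crS cF => i; rewrite ms.
Qed.

End TriRank.

Section MatrixPoly.
Variables (R : realType) (I : eqType) (A : pred I).

Definition mp m k (P : (I -> R) -> 'M[R]_(m, k)) := forall i j, polyf A (fun y => P y i j).

Lemma polyf_prod (J : Type) (r : seq J) (Q : pred J) (g : J -> (I -> R) -> R) :
  (forall j, Q j -> polyf A (g j)) -> polyf A (fun x => \prod_(j <- r | Q j) g j x).
Proof.
move=> cg; elim: r => [|j r IH].
  by under eq_fun do rewrite big_nil; exact: polyf_cst.
under eq_fun do rewrite big_cons.
by case: (boolP (Q j)) => Qj //; apply: polyfM => //; exact: cg.
Qed.

Lemma mp_cst m k (B : 'M[R]_(m, k)) : mp (fun=> B).
Proof. by move=> i j; exact: polyf_cst. Qed.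

Lemma mp_mul m k l (P : (I -> R) -> 'M[R]_(m, k)) (Q : (I -> R) -> 'M[R]_(k, l)) :
  mp P -> mp Q -> mp (fun y => P y *m Q y).
Proof.
move=> mP mQ i j; have -> : (fun y => (P y *m Q y) i j) = (fun y => \sum_q P y i q * Q y q j).
  by apply/funext => y; rewrite mxE.
by apply: polyf_sum => q _; apply: polyfM; [exact: mP|exact: mQ].
Qed.

Lemma polyf_det m (P : (I -> R) -> 'M[R]_m) : mp P -> polyf A (fun y => \det (P y)).
Proof.
move=> mP; apply: polyf_sum => s _; apply: polyfM; first exact: polyf_cst.
by apply: polyf_prod => i _; exact: mP.
Qed.

Lemma mp_adj m (P : (I -> R) -> 'M[R]_m) : mp P -> mp (fun y => \adj (P y)).
Proof.
move=> mP i j; have -> : (fun y => (\adj (P y)) i j) =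
    (fun y => (-1) ^+ (j + i) * \det (row' j (col' i (P y)))).
  by apply/funext => y; rewrite mxE.
apply: polyfM; first exact: polyf_cst.
apply: polyf_det => k l.
have -> : (fun y => row' j (col' i (P y)) k l) = (fun y => P y (lift j k) (lift i l)).
  by apply/funext => y; rewrite !mxE.
exact: mP.
Qed.

End MatrixPoly.

(** * Invariance of the integral over pairs of unipotent matrices *)

Section NNChange.
Variables (R : realType) (hbar : R) (n : nat).
Local Notation M := 'M[R]_n.
Local Notation C := R[i].
Local Notation sl := (nat * nat)%type.
Local Notation pt := (sl -> R).
Local Notation Uof := (@Uof R n).
Local Notation Vof := (@Vof R n).
Implicit Types (u v : M) (x y : pt).

(** Distance from the diagonal in truncated subtraction; the storage of [U] below and [V] above the
    diagonal both preserve it. *)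
Definition rk (p : sl) : nat := (p.1 - p.2) + (p.2 - p.1).
Definition agr (d : nat) u v := forall k l : 'I_n, (l < k + d)%N -> u k l = v k l.

Definition offp : pred sl := fun p => p \in off n 0.

(* A polynomial automorphism of the variety of unipotent matrices which in each entry is
   [c] times that entry plus a function of the entries closer to the diagonal. *)
Definition unip_map (c : R) (theta : M -> M) := exists eta : M -> M,
  [/\ `|c| = 1, forall u, Ngroup u -> Ngroup (theta u) /\ eta (theta u) = u,
      forall P : pt -> M, mp offp P -> mp offp (fun y => theta (P y)) /\ mp offp (fun y => eta (P y)) &
      forall u v (i j : 'I_n), Ngroup u -> Ngroup v -> (i < j)%N -> agr (j - i) u v ->
        theta u i j - c * u i j = theta v i j - c * v i j].

Lemma unip_id : unip_map 1 id.
Proof.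
exists id; split=> //; first by rewrite normr1.
by move=> u v i j _ _ _ _; rewrite !mul1r !subrr.
Qed.

Lemma unip_mull (V0 : M) : Ngroup V0 -> unip_map 1 (mulmx V0).
Proof.
move=> NV; exists (mulmx (invmx V0)); split; first by rewrite normr1.
- by move=> u Nu; split; [exact: NgroupM|rewrite mulKmx// unit_N].
- by move=> P mP; split; apply: mp_mul => //; exact: mp_cst.
move=> u v i j Nu Nv ij uv; rewrite !N_mulmx// !mul1r.
have E : \sum_(k < n | (i < k)%N) V0 i k * u k j = \sum_(k < n | (i < k)%N) V0 i k * v k j.
  by apply: eq_bigr => k ik; rewrite uv//; lia.
by rewrite E; ring.
Qed.

Lemma agr_inv d u v : Ngroup u -> Ngroup v -> agr d u v -> agr d (invmx u) (invmx v).
Proof.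
move=> Nu Nv.
have F (w : M) (i j : 'I_n) : Ngroup w ->
    invmx w i j = (i == j)%:R - \sum_(k < n | (k < j)%N) invmx w i k * w k j.
  move=> Nw; have : invmx w *m w = 1%:M by rewrite mulVmx// unit_N.
  by move/(congr1 (fun A : M => A i j)); rewrite mulmx_N// mxE => <-; rewrite addrK.
have [wu0 _] := (NgroupP _).1 (NgroupV Nu); have [wv0 _] := (NgroupP _).1 (NgroupV Nv).
elim: d => [|d IH] uv k l; first by rewrite addn0 => lk; rewrite wu0// wv0.
have uv' : agr d u v by move=> k' l' h; apply: uv; lia.
rewrite addnS ltnS leq_eqVlt => /orP[/eqP e|]; last exact: IH.
rewrite !F//; congr (_ - _); apply: eq_bigr => q ql.
have [qk|kq] := ltnP q k; first by rewrite wu0// wv0// !mul0r.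
by rewrite (IH uv') ?uv//; lia.
Qed.

(** Read off from [u^-1 u = 1]. Inversion thus multiplies an entry by [-1] up to entries closer to
    the diagonal, the source of the coefficient in [unip_invr]. *)
Lemma inv_entry u (i j : 'I_n) : Ngroup u -> (i < j)%N ->
  invmx u i j + u i j = - \sum_(k < n | (i < k < j)%N) invmx u i k * u k j.
Proof.
move=> Nu ij; have [w0 w1] := (NgroupP _).1 (NgroupV Nu).
have : invmx u *m u = 1%:M by rewrite mulVmx// unit_N.
move/(congr1 (fun A : M => A i j)); rewrite mulmx_N// mxE (bigD1 i)//= w1 mul1r.
have -> : \sum_(k < n | (k < j)%N && (k != i)) invmx u i k * u k j =
    \sum_(k < n | (i < k < j)%N) invmx u i k * u k j.
  rewrite (bigID (fun k : 'I_n => (i < k)%N)) /= [X in _ + X]big1 ?addr0.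
    by apply: eq_bigl => k; rewrite -val_eqE /=; lia.
  by move=> k /andP[/andP[_ ki] ik]; rewrite w0 ?mul0r//; move: ki; rewrite -val_eqE /=; lia.
rewrite (_ : (i == j) = false); last by rewrite -val_eqE /=; lia.
by move=> e; apply/eqP; rewrite -subr_eq0 opprK -addrA; apply/eqP.
Qed.

Lemma unip_invr (U0 : M) : Ngroup U0 -> unip_map (-1) (fun u => \adj u *m U0).
Proof.
move=> NU; exists (fun u => U0 *m \adj u); split; first by rewrite normrN1.
- move=> u Nu; rewrite -invmx_N//; have NW := NgroupM (NgroupV Nu) NU; split=> //.
  rewrite -invmx_N// -{1}(mulKVmx (unit_N Nu) U0) mulmxK// unit_N//.
- by move=> P mP; split; apply: mp_mul; (exact: mp_cst || exact: mp_adj).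
move=> u v i j Nu Nv ij uv; rewrite -!invmx_N// !mulmx_N// !mulN1r !opprK.
have W := agr_inv Nu Nv uv.
have E : \sum_(k < n | (k < j)%N) invmx u i k * U0 k j = \sum_(k < n | (k < j)%N) invmx v i k * U0 k j.
  by apply: eq_bigr => k kj; rewrite W//; lia.
rewrite E [LHS]addrAC [RHS]addrAC; congr (_ + _); rewrite !inv_entry//; congr (- _).
by apply: eq_bigr => k /andP[ik kj]; rewrite W ?uv//; lia.
Qed.

Lemma mp_Uof : mp offp Uof.
Proof.
move=> i j; under eq_fun do rewrite mxE; case: eqP => [_|/eqP ij]; first exact: polyf_cst.
case: ltnP => _; last exact: polyf_cst.
by apply: polyf_coord; apply: off_ord; rewrite eq_sym.
Qed.

Lemma mp_Vof : mp offp Vof.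
Proof.
move=> i j; under eq_fun do rewrite mxE; case: eqP => [_|/eqP ij]; first exact: polyf_cst.
case: ltnP => _; last exact: polyf_cst.
by apply: polyf_coord; apply: off_ord; rewrite (inj_eq rev_ord_inj) eq_sym.
Qed.

Definition Theta (theta1 theta2 : M -> M) y : pt := fun p =>
  if p \in off n 0 then slUV (theta2 (Uof y)) (theta1 (Vof y)) p else y p.

Lemma UofE y (i j : 'I_n) : (i < j)%N -> Uof y i j = y (j : nat, i : nat).
Proof. by move=> ij; rewrite mxE ij ifF//; apply/negbTE; rewrite -val_eqE /=; lia. Qed.
Lemma VofE y (i j : 'I_n) : (i < j)%N -> Vof y i j = y (rev_ord j : nat, rev_ord i : nat).
Proof. by move=> ij; rewrite mxE ij ifF//; apply/negbTE; rewrite -val_eqE /=; lia. Qed.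

Lemma off_case p : p \in off n 0 ->
  (exists i j : 'I_n, (i < j)%N /\ p = (j : nat, i : nat)) \/
  (exists i j : 'I_n, (i < j)%N /\ p = (rev_ord j : nat, rev_ord i : nat)).
Proof.
move=> /offP [k [l [-> kl]]]; case: (ltngtP k l) => h.
- right; exists (rev_ord l), (rev_ord k); rewrite ltn_rev; split=> //.
  by rewrite !rev_ordK.
- by left; exists l, k.
- by move: kl; rewrite -val_eqE /= h eqxx.
Qed.

Lemma slUV_U (U V : M) (i j : 'I_n) : (i < j)%N -> slUV U V (j : nat, i : nat) = U i j.
Proof. by move=> ij; rewrite /slUV /= ij mxeE. Qed.
Lemma slUV_V (U V : M) (i j : 'I_n) : (i < j)%N ->
  slUV U V (rev_ord j : nat, rev_ord i : nat) = V i j.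
Proof.
move=> ij; rewrite /slUV ifF; last by apply/negbTE; rewrite -leqNgt ltnW// ltn_rev.
rewrite ifT ?ltn_rev//.
have r (k : 'I_n) : (n - (rev_ord k).+1 = k)%N by rewrite -[RHS](congr1 val (rev_ordK k)).
by rewrite !r mxeE.
Qed.

Lemma UVof_Theta theta1 theta2 y : Ngroup (theta1 (Vof y)) -> Ngroup (theta2 (Uof y)) ->
  Vof (Theta theta1 theta2 y) = theta1 (Vof y) /\ Uof (Theta theta1 theta2 y) = theta2 (Uof y).
Proof.
move=> N1 N2; split.
  rewrite -[RHS](Vof_slUV (theta2 (Uof y)) N1); apply/matrixP => i j; rewrite [LHS]mxE [RHS]mxE.
  case: eqP => // /eqP ij; case: ifP => // _.
  by rewrite /Theta off_ord// (inj_eq rev_ord_inj) eq_sym.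
rewrite -[RHS](Uof_slUV (theta1 (Vof y)) N2); apply/matrixP => i j; rewrite [LHS]mxE [RHS]mxE.
case: eqP => // /eqP ij; case: ifP => // _.
by rewrite /Theta off_ord// eq_sym.
Qed.

Lemma agr_Uof y q t d : (d <= rk q)%N -> agr d (Uof (upd y q t)) (Uof y).
Proof.
move=> dq k l lk; rewrite !mxE; case: eqP => // _; case: ltnP => // kl.
by apply: upd_other; apply: contraTneq dq => <-; rewrite /rk /=; lia.
Qed.

Lemma agr_Vof y q t d : (d <= rk q)%N -> agr d (Vof (upd y q t)) (Vof y).
Proof.
move=> dq k l lk; rewrite !mxE; case: eqP => // _; case: ltnP => // kl.
apply: upd_other; apply: contraTneq dq => <-; rewrite /rk /=.
by have := ltn_ord k; have := ltn_ord l; lia.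
Qed.

(** Invariance of the Haar measure in coordinates: ordered by distance from the diagonal the
    substitution is triangular with coefficients of absolute value [1]. Rapid decrease survives it
    because the inverses [eta1], [eta2] are polynomial. *)
Lemma IL_unip c1 c2 theta1 theta2 (F : pt -> C) x : unip_map c1 theta1 -> unip_map c2 theta2 ->
  cr (off n 0) F ->
  cr (off n 0) (fun y => F (Theta theta1 theta2 y)) /\
  IL (off n 0) (fun y => F (Theta theta1 theta2 y)) x = IL (off n 0) F x.
Proof.
move=> [eta1 [n1 N1 P1 A1]] [eta2 [n2 N2 P2 A2]] cF.
have NU y := @Ngroup_Uof R n y; have NV y := @Ngroup_Vof R n y.
have mpU := P2 _ mp_Uof; have mpV := P1 _ mp_Vof.
have ThU y (i j : 'I_n) : (i < j)%N -> Theta theta1 theta2 y (j : nat, i : nat) = theta2 (Uof y) i j.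
  by move=> ij; rewrite /Theta off_ord ?slUV_U// -val_eqE /=; lia.
have ThV y (i j : 'I_n) : (i < j)%N ->
    Theta theta1 theta2 y (rev_ord j : nat, rev_ord i : nat) = theta1 (Vof y) i j.
  by move=> ij; rewrite /Theta off_ord ?slUV_V// (inj_eq rev_ord_inj) -val_eqE /=; lia.
have sT p : scR (fun y => Theta theta1 theta2 y p).
  have [po|po] := boolP (p \in off n 0); last first.
    by rewrite /Theta (negPf po); exact: scR_coord.
  have [[i [j [ij ->]]]|[i [j [ij ->]]]] := off_case po.
    have -> : (fun y => Theta theta1 theta2 y (j : nat, i : nat)) = (fun y => theta2 (Uof y) i j).
      by apply/funext => y; rewrite ThU.
    exact: polyf_scR (mpU.1 i j).
  have -> : (fun y => Theta theta1 theta2 y (rev_ord j : nat, rev_ord i : nat)) = (fun y => theta1 (Vof y) i j).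
    by apply/funext => y; rewrite ThV.
  exact: polyf_scR (mpV.1 i j).
have cFT : cr (off n 0) (fun y => F (Theta theta1 theta2 y)).
  apply: cr_comp cF => // p po.
  have [[i [j [ij ->]]]|[i [j [ij ->]]]] := off_case po.
    have -> : (fun y : pt => y (j : nat, i : nat)) =
        (fun y => (fun z => eta2 (Uof z) i j) (Theta theta1 theta2 y)).
      apply/funext => y /=; have [_ ->] := UVof_Theta (N1 _ (NV y)).1 (N2 _ (NU y)).1.
      by rewrite (N2 _ (NU y)).2 UofE.
    exact: (polyf_gb _ (fun q qo => qo) (mpU.2 i j)).
  have -> : (fun y : pt => y (rev_ord j : nat, rev_ord i : nat)) =
      (fun y => (fun z => eta1 (Vof z) i j) (Theta theta1 theta2 y)).
    apply/funext => y /=; have [-> _] := UVof_Theta (N1 _ (NV y)).1 (N2 _ (NU y)).1.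
    by rewrite (N1 _ (NV y)).2 VofE.
  exact: (polyf_gb _ (fun q qo => qo) (mpV.2 i j)).
split=> //; apply/esym.
apply: (@IL_tri_rank _ hbar _ rk _ (fun p : sl => if (p.2 < p.1)%N then c2 else c1)) => //.
- exact: uniq_off.
- by move=> p; case: ifP.
- by move=> y p po; rewrite /Theta (negPf po).
move=> p q y t po qo pq; have [[i [j [ij e]]]|[i [j [ij e]]]] := off_case po; rewrite e in pq *.
  rewrite !ThU// /= ij -!(UofE _ ij); apply: A2 => //; apply: agr_Uof.
  by apply: leq_trans pq; rewrite /rk /=; lia.
rewrite !ThV// ifF; last by apply/negbTE; rewrite -leqNgt ltnW// ltn_rev.
rewrite -!(VofE _ ij); apply: A1 => //; apply: agr_Vof.
by apply: leq_trans pq; rewrite /rk /=; have := ltn_ord i; have := ltn_ord j; lia.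
Qed.

Let L : seq ('I_n * 'I_n) := enum [pred ij : 'I_n * 'I_n | (ij.1 < ij.2)%N].
(** The directions of [int_NN] in their order: the tag [true] marks the first group variable, stored
    as [V], and [false] the second, stored as [U]. *)
Let J : seq (bool * ('I_n * 'I_n)) := map (pair true) L ++ map (pair false) L.
Let slot (q : bool * ('I_n * 'I_n)) : sl :=
  if q.1 then (rev_ord q.2.2 : nat, rev_ord q.2.1 : nat) else (q.2.2 : nat, q.2.1 : nat).

Lemma mem_J q : (q \in J) = (q.2.1 < q.2.2)%N.
Proof.
case: q => b ij; rewrite mem_cat.
have inj b' : injective (pair b' : 'I_n * 'I_n -> bool * ('I_n * 'I_n)) by move=> ? ? [].
have nm b' : b' != b -> ((b, ij) \in map (pair b') L) = false.
  by move=> bb; apply/negP => /mapP[ij' _ [e _]]; rewrite e eqxx in bb.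
by case: b nm => nm; rewrite (mem_map (inj _)) nm// ?orbF mem_enum inE.
Qed.

Lemma slot_inj : {in J &, injective slot}.
Proof.
move=> [b [i j]] [b' [i' j']]; rewrite !mem_J /= => ij ij'.
have := ltn_ord i; have := ltn_ord j; have := ltn_ord i'; have := ltn_ord j'.
move=> h1 h2 h3 h4; rewrite /slot /=.
case: b; case: b' => /=; case=> e1 e2; try (exfalso; lia);
  by congr (_, (_, _)); apply: val_inj => /=; lia.
Qed.

Lemma uniq_slot : uniq (map slot J).
Proof.
rewrite map_inj_in_uniq; last exact: slot_inj.
rewrite cat_uniq !map_inj_uniq ?enum_uniq; try by move=> ? ? [].
by rewrite andbT; apply/hasPn => q /mapP[ij _ ->]; apply/negP => /mapP[ij' _ []].
Qed.

Lemma perm_slot : perm_eq (map slot J) (off n 0).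
Proof.
apply: uniq_perm; [exact: uniq_slot|exact: uniq_off|move=> p].
apply/mapP/idP => [[[b [i j]]]|po].
  rewrite mem_J /= => ij ->.
  have ji : (j : 'I_n) != i by rewrite -val_eqE /=; lia.
  case: b; last exact: off_ord.
  have rji : rev_ord (j : 'I_n) != rev_ord i by rewrite (inj_eq rev_ord_inj).
  exact: off_ord rji.
have [[i [j [ij ->]]]|[i [j [ij ->]]]] := off_case po.
  by exists (false, (i, j)); rewrite ?mem_J.
by exists (true, (i, j)); rewrite ?mem_J.
Qed.

Lemma int_NN_IL (F : M * M -> C) x : int_NN F = IL (map slot J) (fun y => F (Vof y, Uof y)) x.
Proof.
pose vv (q : bool * ('I_n * 'I_n)) : M * M :=
  if q.1 then (delta_mx q.2.1 q.2.2, 0) else (0, delta_mx q.2.1 q.2.2).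
transitivity (IL (map slot J) (fun y => F (Vof y, Uof y)) (fun=> 0)); last first.
  apply: IL_agree => y y' H; congr (F (_, _)); apply/matrixP => i j; rewrite !mxE;
    case: eqP => // /eqP ij; case: ifP => // _; apply: H;
    rewrite (perm_mem perm_slot); apply: off_ord; rewrite ?(inj_eq rev_ord_inj) eq_sym//.
rewrite -(iter_intC_slots (vv := vv) (mu := fun y => (Vof y, Uof y))).
- rewrite /int_NN; have -> : Vof (fun=> 0) = 1%:M.
    by apply/matrixP => i j; rewrite !mxE; case: eqP => // _; case: ifP.
  have -> : Uof (fun=> 0) = 1%:M.
    by apply/matrixP => i j; rewrite !mxE; case: eqP => // _; case: ifP.
  have E b (l : seq ('I_n * 'I_n)) : [seq if b then (E, 0 : M) else (0 : M, E) |
      E <- [seq delta_mx ij.1 ij.2 | ij <- l]] = [seq vv i | i <- [seq (b, i) | i <- l]].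
    by elim: l => //= ij l ->.
  by rewrite /J map_cat -(E true) -(E false).
- exact: uniq_slot.
- move=> y [b [i j]] t; rewrite mem_J /= => ij.
  have H1 (W : pt -> M) k l :
     (forall k' l', W (upd y (k, l) t) k' l' = W y k' l' + (t - y (k, l)) * ((k', l') == (i, j))%:R) ->
     W (upd y (k, l) t) = W y + (t - y (k, l)) *: delta_mx i j.
    by move=> H; apply/matrixP => k' l'; rewrite H !mxE -pair_eqE.
  have H2 (W : pt -> M) k l :
     (forall k' l', W (upd y (k, l) t) k' l' = W y k' l') -> W (upd y (k, l) t) = W y.
    by move=> H; apply/matrixP => k' l'; rewrite H.
  have [hi hj] := (ltn_ord i, ltn_ord j).
  rewrite /slot /vv; case: b => /=.
    rewrite -[RHS]/(Vof y + _ *: delta_mx i j, Uof y + _ *: 0) scaler0 addr0; congr (_, _).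
      apply: H1 => k' l'.
      rewrite !mxE xpair_eqE; case: eqP => [->|/eqP kl].
        by rewrite (_ : _ && _ = false) ?mulr0 ?addr0//; rewrite -!val_eqE /=; lia.
      case: ltnP => k'l'; last first.
        by rewrite (_ : _ && _ = false) ?mulr0 ?addr0//; rewrite -!val_eqE /=; lia.
      have [hk hl] := (ltn_ord k', ltn_ord l').
      rewrite /upd xpair_eqE; have -> : ((n - l'.+1 == n - j.+1) && (n - k'.+1 == n - i.+1))%N = ((k' == i) && (l' == j)).
        by rewrite -!val_eqE /=; lia.
      by case: ifP => [/andP[/eqP -> /eqP ->]|_]; rewrite ?mulr1 ?mulr0 ?addr0// addrC subrK.
    apply: H2 => k' l'; rewrite !mxE; case: eqP => // _; case: ltnP => // k'l'.
    by apply: upd_other; rewrite xpair_eqE /=; have [hk hl] := (ltn_ord k', ltn_ord l'); lia.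
  rewrite -[RHS]/(Vof y + _ *: 0, Uof y + _ *: delta_mx i j) scaler0 addr0; congr (_, _).
    apply: H2 => k' l'; rewrite !mxE; case: eqP => // _; case: ltnP => // k'l'.
    by apply: upd_other; rewrite xpair_eqE /=; have [hk hl] := (ltn_ord k', ltn_ord l'); lia.
  apply: H1 => k' l'.
  rewrite !mxE xpair_eqE; case: eqP => [->|/eqP kl].
    by rewrite (_ : _ && _ = false) ?mulr0 ?addr0//; rewrite -!val_eqE /=; lia.
  case: ltnP => k'l'; last first.
    by rewrite (_ : _ && _ = false) ?mulr0 ?addr0//; rewrite -!val_eqE /=; lia.
  rewrite /upd xpair_eqE; have -> : ((l' == j :> nat) && (k' == i :> nat)) = ((k' == i) && (l' == j)).
    by rewrite -!val_eqE /=; lia.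
  by case: ifP => [/andP[/eqP -> /eqP ->]|_]; rewrite ?mulr1 ?mulr0 ?addr0// addrC subrK.
- by [].
Qed.

Lemma int_NN_change c1 c2 theta1 theta2 (F : M * M -> C) (G : M -> M -> C) x :
  unip_map c1 theta1 -> unip_map c2 theta2 ->
  (forall u v, Ngroup u -> Ngroup v -> F (u, v) = G (theta1 u) (theta2 v)) ->
  cr (off n 0) (fun y => G (Vof y) (Uof y)) ->
  int_NN F = IL (off n 0) (fun y => G (Vof y) (Uof y)) x.
Proof.
move=> u1 u2 FG cG; have [cGT <-] := IL_unip x u1 u2 cG.
rewrite (int_NN_IL _ x).
have E : (fun y => F (Vof y, Uof y)) =
    (fun y => G (Vof (Theta theta1 theta2 y)) (Uof (Theta theta1 theta2 y))).
  apply/funext => y; have [e1 [_ N1 _ _]] := u1; have [e2 [_ N2 _ _]] := u2.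
  have [-> ->] := UVof_Theta (N1 _ (@Ngroup_Vof R n y)).1 (N2 _ (@Ngroup_Uof R n y)).1.
  by apply: FG; [exact: Ngroup_Vof|exact: Ngroup_Uof].
rewrite E (IL_perm hbar perm_slot uniq_slot)//.
by apply: crS cGT => p; rewrite (perm_mem perm_slot).
Qed.

End NNChange.

(** * Comparison of the two sides *)

Section Assembly.
Variables (R : realType) (hbar : R) (n : nat).
Hypothesis hbar0 : hbar != 0.
Local Notation M := 'M[R]_n.
Local Notation C := R[i].
Local Notation sl := (nat * nat)%type.
Local Notation pt := (sl -> R).
Local Notation psi := (@psi R hbar).
Local Notation FTL := (@FTL R hbar sl).
Local Notation Uof := (@Uof R n).
Local Notation Vof := (@Vof R n).
Local Notation wslots := (@wslots R n).
Implicit Types (x y z : pt) (a b : 'rV[R]_n).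

Lemma fchar_mxe (X : M) : fchar X = \sum_(0 <= i < n.-1) mxe X i i.+1.
Proof.
transitivity (\sum_(0 <= i < n) mxe X i i.+1).
  rewrite big_mkord; apply: eq_bigr => i _; have [i1|i1] := ltnP i.+1 n.
    rewrite (big_pred1 (Ordinal i1)) => [|j]; first by rewrite -mxeE.
    by rewrite /= -val_eqE.
  rewrite big_pred0 => [|j]; last by have := ltn_ord j; lia.
  by rewrite /mxe valK insubN// -leqNgt.
case: n X => [X|m X]; first by rewrite !big_geq.
by rewrite big_nat_recr//= [X in _ + X](_ : _ = 0) ?addr0// /mxe; case: insub => // i; rewrite insubN// ltnn.
Qed.

Lemma fs_UV y : fs n 0 y = fchar (Uof y) + fchar (Vof y).
Proof.
rewrite !fchar_mxe /fs big_split /= addrC; congr (_ + _).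
  apply: congr_big_nat => // i /andP[_ im].
  have [i0 i1] : (i < n)%N /\ (i.+1 < n)%N by lia.
  by rewrite -[i in RHS]/(nat_of_ord (Ordinal i0)) -[i.+1 in RHS]/(nat_of_ord (Ordinal i1)) mxeE UofE /=.
rewrite [LHS]big_nat_rev /= add0n; apply: congr_big_nat => // i /andP[_ im].
have [i0 i1] : (i < n)%N /\ (i.+1 < n)%N by lia.
have -> : mxe (Vof y) i i.+1 = Vof y (Ordinal i0) (Ordinal i1) by rewrite -mxeE.
by rewrite VofE /=; [congr (y (_, _)); lia|].
Qed.

Variable h : M -> C.
Hypothesis sh : schwartz h.
Let h' y : C := h (wslots y).
Let gh : good hbar (blk n 0) h' := schwartz_good hbar0 sh.

Lemma FTL_agree z z' : (forall p, p \in blk n 0 -> z p = z' p) ->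
  FTL (blk n 0) h' z = FTL (blk n 0) h' z'.
Proof.
move=> zz; have cH := good_cr gh.
rewrite !FTL_IL//; try exact: uniq_blk.
have -> : (fun x => psi (- \sum_(i <- blk n 0) z i * x i) * h' x) =
    (fun x => psi (- \sum_(i <- blk n 0) z' i * x i) * h' x).
  apply/funext => x; congr (psi (- _) * _); rewrite [LHS]big_seq [RHS]big_seq.
  by apply: eq_bigr => p pb; rewrite zz.
apply: IL_agree => y y' yy; congr (psi (- _) * h _).
  by rewrite [LHS]big_seq [RHS]big_seq; apply: eq_bigr => p pb; rewrite yy.
apply/matrixP => i j; rewrite !mxE; apply: yy.
by rewrite mem_blk /inb; have := ltn_ord j; have := ltn_ord (rev_ord i); rewrite /=; lia.
Qed.

Definition vslot (q : 'I_(n * n)) : sl :=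
  let p := enum_val (cast_ord (esym (mxvec_cast n n)) q) in (rev_ord p.1 : nat, p.2 : nat).

Lemma vslotE (i j : 'I_n) : vslot (mxvec_index i j) = (rev_ord i : nat, j : nat).
Proof. by rewrite /vslot /mxvec_index cast_ordK enum_rankK. Qed.

Lemma vslot_inj : injective vslot.
Proof.
move=> q q'; case/mxvec_indexP: q => i j; case/mxvec_indexP: q' => i' j'; rewrite !vslotE.
move=> E; have e1 : rev_ord i = rev_ord i' by apply: val_inj; exact: (congr1 fst E).
have e2 : j = j' by apply: val_inj; exact: (congr1 snd E).
by rewrite (rev_ord_inj e1) e2.
Qed.

Lemma perm_vslot : perm_eq (map vslot (enum 'I_(n * n))) (blk n 0).
Proof.
apply: uniq_perm; [by rewrite map_inj_uniq ?enum_uniq//; exact: vslot_inj|exact: uniq_blk|move=> p].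
apply/mapP/idP => [[q _ ->]|].
  case/mxvec_indexP: q => i j; rewrite vslotE mem_blk /inb.
  by have := ltn_ord j; have := ltn_ord (rev_ord i); rewrite /=; lia.
move=> pb; have [i [j [_ ->]]] := @wslotP n p pb.
by exists (mxvec_index i j); rewrite ?mem_enum// vslotE.
Qed.

Lemma sum_slB (B : M) y : \sum_(p <- blk n 0) slB B p * y p = \tr (B *m wslots y).
Proof.
rewrite tr_mul2 (reindex_inj rev_ord_inj) /= /blk big_allpairs big_mkord.
apply: eq_bigr => r _; rewrite big_mkord; apply: eq_bigr => i _.
rewrite !mxE rev_ordK; congr (_ * _).
by rewrite /slB /= -[(n - r.+1)%N]/(nat_of_ord (rev_ord r)) mxeE.
Qed.

(** Transport along the leaf from [(Y, z.2)] is [psi (tr (z.2 z.1) - tr (z.2 Y))] and the Liouville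
    density is [1], so the leaf integral is a Euclidean Fourier transform times the phase of the
    trivialization. *)
Lemma fourierE (phi : phase_space R n -> C) (z : phase_space R n) :
  (forall A B, phi (A, B) = h A) ->
  fourier hbar phi z = (self_dual hbar ^+ (n * n))%:C *
    (psi (\tr (z.2 *m z.1)) * FTL (blk n 0) h' (slB z.2)).
Proof.
move=> phiE; rewrite /fourier /leaf_integral; congr (_ * _).
rewrite /coord_int /rV_basis.
have cH := good_cr gh.
have cH' : cr (blk n 0) (fun y => psi (- \sum_(p <- blk n 0) slB z.2 p * y p) * h' y).
  apply: cr_psiM => //; apply/scRN/scR_sum => p _.
  by apply: scRM; [exact: scR_cst|exact: scR_coord].
have -> : (0 : 'rV[R]_(n * n)) = mxvec (wslots (fun=> 0)).
  by rewrite (_ : wslots _ = 0) ?linear0//; apply/matrixP => i j; rewrite !mxE.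
rewrite (iter_intC_slots (slot := vslot) (mu := fun y => mxvec (wslots y))).
- have E : (fun y => if `[< [set: 'rV[R]_(n * n)] (mxvec (wslots y)) >]
      then transport hbar (leaf_Fh z) z (vec_mx (mxvec (wslots y)), vec_mx (mxvec z.2)) *
           phi (vec_mx (mxvec (wslots y)), vec_mx (mxvec z.2)) *
           (Num.sqrt (liouville (fun v1 v2 : 'rV[R]_(n * n) => (vec_mx v1, vec_mx v2) : phase_space R n)
              (mxvec (wslots y)) (mxvec z.2)))%:C else 0) =
    (fun y => psi (\tr (z.2 *m z.1)) * (psi (- \sum_(p <- blk n 0) slB z.2 p * y p) * h' y)).
    apply/funext => y; rewrite asboolT// !mxvecK transport_Fh phiE liouville_fourier sqrtr1 mulr1.
    by rewrite sum_slB psiD mulrA.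
  rewrite E (IL_perm hbar perm_vslot); last 2 first.
  + by rewrite (perm_uniq perm_vslot) uniq_blk.
  + by apply: cr_cstM; apply: crS cH' => p; rewrite (perm_mem perm_vslot).
  rewrite (ILZ hbar (c := fun=> psi (\tr (z.2 *m z.1))) (uniq_blk n 0) cH')//; congr (_ * _).
  rewrite FTL_IL//; last exact: uniq_blk.
  apply: IL_agree => y y' yy; congr (psi (- _) * h _).
    by rewrite [LHS]big_seq [RHS]big_seq; apply: eq_bigr => p pb; rewrite yy.
  apply/matrixP => i j; rewrite !mxE; apply: yy.
  by rewrite mem_blk /inb; have := ltn_ord j; have := ltn_ord (rev_ord i); rewrite /=; lia.
- by rewrite (perm_uniq perm_vslot) uniq_blk.
- move=> y q t _; case/mxvec_indexP: q => i j; rewrite vslotE.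
  have -> : t = (t - y (rev_ord i : nat, j : nat)) + y (rev_ord i : nat, j : nat) by rewrite subrK.
  by rewrite wslots_upd upd_id linearD linearZ /= mxvec_delta addrC addrK.
- by [].
Qed.

Lemma slB_UDL_blk b y p : p \in blk n 0 ->
  slB (Uof y *m slice_h b *m Vof y) p = UDL n (rve b) 0 y p.
Proof.
move=> pb; have [i [j [_ ->]]] := @wslotP n p pb.
by rewrite /slB /= -[(n - (n - i.+1).+1)%N]/(nat_of_ord (rev_ord (rev_ord i))) mxeE UbwV !rev_ordK.
Qed.

Lemma cr_rhs b : torus b ->
  cr (off n 0) (fun y => psi (fs n 0 y) * FTL (blk n 0) h' (UDL n (rve b) 0 y)).
Proof.
move=> tb; apply: cr_psiM.
  by apply: scR_sum => i _; apply: scRD; exact: scR_coord.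
have cF : cr (blk n 0) (FTL (blk n 0) h') by apply: gh => //; exact: uniq_blk.
apply: cr_comp cF => [j|p po]; first exact: scR_UDL.
have [q [Pq Eq]] := UDL_inv_off (@rve_neq0 _ _ _ tb) po.
have -> : (fun y : pt => y p) = (fun y => q (UDL n (rve b) 0 y)) by exact/funext.
by apply: (polyf_gb _ _ Pq) => r; rewrite mem_off mem_blk => /andP[].
Qed.

(** The pair [(u, v)] moves [U0 b w V0] to [(v^-1 U0) b w (V0 u)], which suggests [V0 u] and
    [v^-1 U0] as new variables. The phase [tr (B A)] of the Fourier transform cancels the one in
    [prim_h] and leaves the character. *)
Lemma p_h_fourier c b (tb : torus b) (phi : phase_space R n -> C) (x0 : phase_space R n) x :
  0 < c -> (forall A B, phi (A, B) = h A) -> M_ff x0 -> same_orbit (slice_h b) x0.2 ->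
  coord_A2 x0.2 = b ->
  p_h hbar c (fourier hbar phi) x0 =
  (Num.sqrt c * \prod_(k < n) `|b 0 k| ^+ k * self_dual hbar ^+ (n * n))%:C *
  (psi (prim_h tb x0) *
   IL (off n 0) (fun y => psi (fs n 0 y) * FTL (blk n 0) h' (UDL n (rve b) 0 y)) x).
Proof.
move=> c0 phiE mx ob cb; rewrite /p_h cb jac_hE sqrtrM ?ltW// sqrtr_sqr ger0_norm; last first.
  by apply: prodr_ge0 => k _; rewrite exprn_ge0.
rewrite [X in _ = X * _]rmorphM -[RHS]mulrA; congr (_ * _).
have [U0 [V0 [NU NV xE]]] := ob.
pose k1 : C := (self_dual hbar ^+ (n * n))%:C * psi (prim_h tb x0).
pose G (V U : M) : C := k1 * (psi (fchar U + fchar V) * FTL (blk n 0) h' (slB (U *m slice_h b *m V))).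
have GE : (fun y => G (Vof y) (Uof y)) =
    (fun y => k1 * (psi (fs n 0 y) * FTL (blk n 0) h' (UDL n (rve b) 0 y))).
  apply/funext => y; rewrite /G fs_UV; congr (_ * (_ * _)); apply: FTL_agree => p pb.
  exact: slB_UDL_blk.
rewrite (int_NN_change hbar (G := G) x (unip_mull NV) (unip_invr NU)).
- rewrite GE (ILZ hbar (c := fun=> k1) (uniq_off n 0) (cr_rhs tb))//.
  by rewrite /k1 mulrA.
- move=> u v Nu Nv.
  have e2 : (act x0 (u, v)).2 = (invmx v *m U0) *m slice_h b *m (V0 *m u).
    by rewrite /act /= xE !mulmxA.
  have NW := NgroupM (NgroupV Nv) NU; have NV' := NgroupM NV Nu.
  have [EU EV] := UfVf tb NW NV'.
  have T : transport hbar (leaf_Gh x0) x0 (act x0 (u, v)) = psi (prim_h tb x0 - prim_h tb (act x0 (u, v))).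
    have := @transport_Gh_seg R hbar n b x0 x0.1 u v tb ob.
    by rewrite -[(x0.1, x0.2)]surjective_pairing; apply.
  have pE : prim_h tb (act x0 (u, v)) = \tr ((act x0 (u, v)).2 *m (act x0 (u, v)).1) -
      fchar (invmx v *m U0) - fchar (V0 *m u) by rewrite /prim_h e2 EU EV.
  rewrite T (fourierE _ phiE) /G /k1 -invmx_N// -e2 pE.
  set t := \tr _; set fU := fchar _; set fV := fchar (V0 *m u); set H := FTL _ _ _.
  set P := prim_h _ _.
  have -> : psi (P - (t - fU - fV)) = psi P * psi (- t) * psi (fU + fV).
    by rewrite -!psiD; congr (psi _); ring.
  transitivity ((psi t * psi (- t)) * ((self_dual hbar ^+ (n * n))%:C * psi P * (psi (fU + fV) * H))).
    by ring.
  by rewrite psiN mul1r.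
- by rewrite GE; apply: cr_cstM; exact: cr_rhs.
Qed.

(** [tr (B A)] contributes [sum a_i b_i + sum 1 / (a_i b_(i+1))], and the characters of the two
    bidiagonal factors remove the second sum twice. *)
Lemma prim_h_J a b (tb : torus b) x : torus a -> (forall k : 'I_n, x (k : nat, k : nat) = a 0 k) ->
  prim_h tb (sigma_J a b) = - ph n (rve b) 0 x.
Proof.
move=> ta xa; rewrite (sigma_JE ta tb) /prim_h /=.
have [-> ->] := UfVf_of tb (xJ a b).
have xr i : (i < n)%N -> x (i, i) = rve a i.
  by move=> im; rewrite -[X in rve a X]/(nat_of_ord (Ordinal im)) rveE -xa.
have -> : \tr (BJ a b *m slice_v a) = \sum_(0 <= i < n) rve a i * rve b i +
    \sum_(0 <= i < n.-1) (rve a i * rve b i.+1)^-1.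
  have -> : \sum_(0 <= i < n.-1) (rve a i * rve b i.+1)^-1 =
      \sum_(0 <= i < n) if (i.+1 < n)%N then (rve a i * rve b i.+1)^-1 else 0.
    have [n0|n1] := posnP n; first by rewrite !big_geq//; lia.
    rewrite [RHS](big_cat_nat (n := n.-1)) /=; [|lia|lia].
    rewrite [X in _ = _ + X]big1_seq ?addr0; last first.
      by move=> i; rewrite mem_index_iota => ii; rewrite ifF//; lia.
    by apply: congr_big_nat => // i ii; rewrite ifT//; lia.
  rewrite -big_split /= big_mkord /mxtrace; apply: eq_bigr => i _.
  rewrite mul_slice_v BJE// rev_ordK eqxx /dgJ -rveE mulrDl [rve b i * _]mulrC; congr (_ + _).
  case: ltnP => i1; last by rewrite mul0r.
  have ai : rve a i != 0 by exact: rve_neq0.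
  have bi : rve b i.+1 != 0 by exact: rve_neq0.
  by field; rewrite ai bi.
rewrite -addrA -opprD -fs_UV /fs /ph.
have -> : \sum_(0 <= i < n) x (i, i) * rve b i = \sum_(0 <= i < n) rve a i * rve b i.
  by apply: congr_big_nat => // i ii; rewrite xr//; lia.
have -> : \sum_(0 <= i < n.-1) (x (i, i) * rve b i.+1)^-1 = \sum_(0 <= i < n.-1) (rve a i * rve b i.+1)^-1.
  by apply: congr_big_nat => // i ii; rewrite xr//; lia.
have -> : \sum_(0 <= i < n.-1) (xJ a b (i, i.+1) + xJ a b (i.+1, i)) =
   \sum_(0 <= i < n.-1) (rve a i * rve b i.+1)^-1 + \sum_(0 <= i < n.-1) (rve a i * rve b i.+1)^-1.
  rewrite -big_split; apply: eq_bigr => i _; rewrite /xJ /adj /= eqxx orbT /=.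
  by rewrite (minn_idPl (leqnSn i)) (maxn_idPr (leqnSn i)) (minn_idPr (leqnSn i)) (maxn_idPl (leqnSn i)).
by ring.
Qed.

(** An element of the group moves the slice point to a point with second component [x0.2]; acting by
    the inverse on the latter puts the slice point in the form treated by [transport_Gh_seg]. *)
Lemma transport_J a b (tb : torus b) (x0 : phase_space R n) : torus a -> M_ff x0 ->
  same_orbit (slice_h b) x0.2 ->
  transport hbar (leaf_Gh x0) x0 (sigma_J a b) = psi (prim_h tb x0 - prim_h tb (sigma_J a b)).
Proof.
move=> ta mx ob; have [U0 [V0 [NU NV xE]]] := ob.
pose z := sigma_J a b; have zE : z = (slice_v a, BJ a b) by exact: sigma_JE.
have mz : M_ff z by rewrite zE; exact: M_ff_BJ.
have N1 := @Ngroup_Uof R n (xJ a b); have N2 := @Ngroup_Vof R n (xJ a b).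
pose u := invmx (Vof (xJ a b)) *m V0; pose v := Uof (xJ a b) *m invmx U0.
have Nu : Ngroup u by apply: NgroupM => //; exact: NgroupV.
have Nv : Ngroup v by apply: NgroupM => //; exact: NgroupV.
have e2 : (act z (u, v)).2 = x0.2.
  rewrite zE /act /= xE /BJ /u.
  have -> : Uof (xJ a b) = v *m U0 by rewrite /v mulmxKV ?unit_N.
  have cancel (v' U S V : M) : Ngroup v' -> Ngroup V ->
      invmx v' *m (v' *m U *m S *m V) *m (invmx V *m V0) = U *m S *m V0.
    by move=> Nv' NV'; rewrite -!mulmxA mulKmx ?unit_N// mulKVmx ?unit_N.
  exact: cancel.
have := @transport_Gh_seg R hbar n b x0 (act z (u, v)).1 (invmx u) (invmx v) tb ob mx.
rewrite -e2 -surjective_pairing actK//; apply; [|exact: NgroupV|exact: NgroupV].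
exact: M_ff_act.
Qed.

(** The action sends [w a] to [u^-1 w a v], so only the first group variable has to be inverted to
    reach [V w a U]. The diagonal is frozen at the nonzero entries of [a]. *)
Lemma int_NN_lhs a x : torus a -> (forall k : 'I_n, x (k : nat, k : nat) = a 0 k) ->
  let F y := psi (- fs n 0 y) * h' (LDU n 0 (frz (fun i => x (i, i)) y)) in
  cr (off n 0) F /\
  int_NN (fun u : M * M => psi (- (fchar (invmx u.1) + fchar u.2)) * h (invmx u.1 *m slice_v a *m u.2)) =
  IL (off n 0) F x.
Proof.
move=> ta xa F.
have cF : cr (off n 0) F.
  apply: cr_LDU_frz (good_cr gh) => i /andP[_ im].
  by have := ta (Ordinal im); rewrite -xa.
split=> //.
pose G (V U : M) : C := psi (- (fchar V + fchar U)) * h (V *m slice_v a *m U).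
have GE : (fun y => G (Vof y) (Uof y)) = F.
  apply/funext => y; rewrite /G /F fs_UV [fchar (Uof y) + _]addrC; congr (_ * h _).
  apply/matrixP => i j; rewrite [RHS]mxE -(VwaU (a := a)); last by move=> k; rewrite frz_diag xa.
  congr ((_ *m _ *m _) _ _); apply/matrixP => k l; rewrite [LHS]mxE [RHS]mxE; case: eqP => // kl; case: ifP => // kl'.
    by rewrite /frz /= ifF//; have := ltn_ord l; have := ltn_ord k; lia.
  by rewrite /frz /= ifF//; lia.
have := int_NN_change hbar (G := G) x (unip_invr (@Ngroup1 R n)) (unip_id R n).
rewrite GE; apply => // u v Nu Nv.
by rewrite /G /= mulmx1 -invmx_N.
Qed.

Lemma p_v_J c a b (phi : phase_space R n -> C) x : 0 < c -> torus a -> torus b ->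
  (forall A B, phi (A, B) = h A) -> (forall k : 'I_n, x (k : nat, k : nat) = a 0 k) ->
  p_v hbar c phi (sigma_J a b) = (Num.sqrt c * wt n 0 x)%:C *
  IL (off n 0) (fun y => psi (- fs n 0 y) * h' (LDU n 0 (frz (fun i => x (i, i)) y))) x.
Proof.
move=> c0 ta tb phiE xa; rewrite /p_v sigma_JE//= coord_A1_slice//.
have -> : Num.sqrt (c * jac_v a) = Num.sqrt c * wt n 0 x.
  rewrite jac_vE sqrtrM ?ltW// sqrtr_sqr ger0_norm; last first.
    by apply: prodr_ge0 => k _; rewrite exprn_ge0.
  by rewrite /wt big_mkord; congr (_ * _); apply: eq_bigr => k _; rewrite xa.
congr (_ * _); have [_ <-] := int_NN_lhs ta xa.
(* [w a] equals [b w] for [b] the reversed [a], which makes the factor polynomials of [slice_h]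
   available for the first component. *)
pose ra : 'rV[R]_n := \row_i a 0 (rev_ord i).
have tra : torus ra by move=> i; rewrite mxE.
have oz : same_orbit (slice_h ra) (slice_v a).
  by rewrite slice_vE; exists 1%:M, 1%:M; split; [exact: Ngroup1|exact: Ngroup1|rewrite mul1mx mulmx1].
rewrite (int_NN_IL _ (fun=> 0)) [RHS](int_NN_IL _ (fun=> 0)); congr (IL _ _ _); apply/funext => y /=.
have NV := @Ngroup_Vof R n y; have NU := @Ngroup_Uof R n y.
rewrite (@transport_Gv_seg R hbar n ra (slice_v a, BJ a b) _ _ tra oz (M_ff_BJ ta tb) NV NU).
rewrite /act /= phiE; congr (psi _ * _); rewrite /prim_v /=.
have [] := UfVf tra (@Ngroup1 R n) (@Ngroup1 R n); rewrite mul1mx mulmx1 -slice_vE => -> ->.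
have [] := UfVf tra (NgroupV NV) NU; rewrite -slice_vE => -> ->.
by rewrite fchar1 addr0 sub0r.
Qed.

Lemma H_Std_lhs c b (tb : torus b) (phi : phase_space R n -> C) (x0 : phase_space R n) :
  0 < c -> (forall A B, phi (A, B) = h A) -> M_ff x0 -> same_orbit (slice_h b) x0.2 ->
  coord_A2 x0.2 = b ->
  H_Std hbar (p_v hbar c phi) x0 = (self_dual hbar ^+ n)%:C *
  IL (dg n 0) (lhs_int hbar n (rve b) 0 (fun y => psi (prim_h tb x0) * (Num.sqrt c)%:C * h' y)) (fun=> 0).
Proof.
move=> c0 phiE mx ob cb; rewrite /H_Std /leaf_integral cb; congr (_ * _).
rewrite /coord_int /rV_basis.
have dgE : dg n 0 = [seq (nat_of_ord i, nat_of_ord i) | i <- enum 'I_n].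
  by rewrite /dg /index_iota subn0 -val_enum_ord -map_comp.
pose mu y : 'rV[R]_n := \row_i y (i : nat, i : nat).
have -> : (0 : 'rV[R]_n) = mu (fun=> 0) by apply/matrixP => i j; rewrite !mxE.
rewrite (iter_intC_slots (slot := fun i : 'I_n => (nat_of_ord i, nat_of_ord i)) (mu := mu)).
- rewrite dgE; congr (IL _ _ _); apply/funext => y.
  have torE : `[< torus (mu y) >] = tor n 0 y.
    apply/asboolP/allP => [t i|t i]; first by rewrite mem_index_iota => /andP[_ im]; have := t (Ordinal im); rewrite mxE.
    by rewrite mxE; apply: t; rewrite mem_index_iota /=.
  rewrite torE /lhs_int; case: ifPn => // ty.
  have ta : torus (mu y) by apply/asboolP; rewrite torE.
  have ya (k : 'I_n) : y (k : nat, k : nat) = mu y 0 k by rewrite mxE.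
  rewrite (transport_J tb ta mx ob) (prim_h_J tb ta ya) (p_v_J c0 ta tb phiE ya) liouville_J//.
  rewrite sqrtr1 mulr1 opprK.
  have [cF _] := int_NN_lhs ta ya.
  set F := (fun y => _) in cF *.
  have -> : IL (off n 0) (fun y0 => psi (- fs n 0 y0) *
       (psi (prim_h tb x0) * (Num.sqrt c)%:C * h' (LDU n 0 y0))) y =
     psi (prim_h tb x0) * (Num.sqrt c)%:C * IL (off n 0) F y.
    rewrite -(congr1 (fun f => f y) (ILZ hbar (c := fun=> psi (prim_h tb x0) * (Num.sqrt c)%:C) (uniq_off n 0) cF (fun _ _ _ _ => erefl))).
    apply: IL_ext => ts _; rewrite /F.
    have -> : frz (fun i => y (i, i)) (upds y (off n 0) ts) = upds y (off n 0) ts.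
      apply/funext => -[i j]; rewrite /frz /=; case: eqP => // <-; by rewrite upds_diag.
    exact: mulrCA.
  rewrite psiD rmorphM; set I1 := IL _ _ _; set q1 := psi _; set q2 := psi _.
  set q3 := _%:C; set q4 := _%:C; by ring.
- by rewrite -dgE uniq_dg.
- move=> y i t _; apply/matrixP => k j; rewrite ord1 !mxE eqxx /upd xpair_eqE andbb /=.
  have [->|ji] := eqVneq j i; first by rewrite eqxx mulr1 addrC subrK.
  by rewrite ifF ?mulr0 ?addr0//; apply/negbTE; exact: ji.
- by [].
Qed.

(** Splits the self-dual factors of the Fourier transform into those of the reduced space and two
    for each variable inverted during the elimination. *)
Lemma sq_bin2 m : (m * m = m + 'C(m, 2).*2)%N.
Proof. by elim: m => [//|m IH]; rewrite binS bin1; lia. Qed.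

Lemma main_identity c b (tb : torus b) (phi : phase_space R n -> C) (x0 : phase_space R n) :
  0 < c -> (forall A B, phi (A, B) = h A) -> M_ff x0 -> same_orbit (slice_h b) x0.2 ->
  coord_A2 x0.2 = b ->
  H_Std hbar (p_v hbar c phi) x0 = p_h hbar c (fourier hbar phi) x0.
Proof.
move=> c0 phiE mx ob cb.
rewrite (H_Std_lhs tb c0 phiE mx ob cb) (p_h_fourier tb (fun=> 0) c0 phiE mx ob cb).
set k0 := psi _ * _.
rewrite (lhs_rhs hbar0 (@rve_neq0 _ _ _ tb) _ (m := n))//; last exact: good_cstM (uniq_blk n 0) gh.
rewrite FTLZ; [|exact: uniq_blk|exact: good_cr gh].
have -> : (fun y => psi (fs n 0 y) * (k0 * FTL (blk n 0) h' (UDL n (rve b) 0 y))) =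
   (fun y => k0 * (psi (fs n 0 y) * FTL (blk n 0) h' (UDL n (rve b) 0 y))).
  by apply/funext => y; rewrite mulrCA.
rewrite (ILZ hbar (c := fun=> k0) (uniq_off n 0) (cr_rhs tb))//.
set J := IL _ _ _; rewrite /k0.
have sd2 : `|hbar| / (2 * pi) = self_dual hbar ^+ 2.
  by rewrite /self_dual sqr_sqrtr// divr_ge0// mulr_ge0// pi_ge0.
have -> : \prod_(0 <= i < n) `|rve b i| ^+ (i - 0) = \prod_(k < n) `|b 0 k| ^+ k.
  by rewrite big_mkord; apply: eq_bigr => k _; rewrite rveE subn0.
rewrite sd2 -exprM mul2n sq_bin2 exprD.
set P := \prod_(k < n) _; set s1 := self_dual hbar ^+ n; set s2 := self_dual hbar ^+ _.
rewrite !rmorphM; set t1 := psi _; set e1 := s1%:C; set e2 := s2%:C; set e3 := P%:C; set e4 := (Num.sqrt c)%:C.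
by ring.
Qed.

End Assembly.

(* c ranges over the Haar measures on N x N. *)
Theorem theorem4p2p4 (R : realType) (n : nat) (hbar c : R)
    (hbar_neq0 : hbar != 0) (c_gt0 : 0 < c)
    (phi : phase_space R n -> R[i]) (phi_D : D_Fv hbar phi)
    (x : phase_space R n) (x_Mff : M_circ_ff x) :
  H_Std hbar (p_v hbar c phi) x = p_h hbar c (fourier hbar phi) x.
Proof.
have [fl sh] := phi_D; have [mx _ [b tb ob]] := x_Mff.
(* Some coordinate of the orbit exists, so the one selected by [xget] meets its specification; the
   computation takes place at this one. *)
have [tb' ob'] : torus (coord_A2 x.2) /\ same_orbit (slice_h (coord_A2 x.2)) x.2.
  exact: (xgetPex 0 (ex_intro [set b | torus b /\ same_orbit (slice_h b) x.2] b (conj tb ob))).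
apply: (main_identity hbar_neq0 sh tb' c_gt0 _ mx ob' erefl) => A B.
exact: flat_Fv fl.
Qed.
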